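(* Let $\nu\ge 1$, $\rho_1>\rho>0$, and let $F=(F^1,\dots,F^\nu)$ be a $\mathbb{C}^\nu$-valued function of $(\varepsilon,z,f)$, holomorphic in (a neighbourhood of) the closed polydisc $\bar D_\rho\times\bar D_{\rho_1}\times\bar D_\rho^{\,\nu}$, with $F(\varepsilon,0,0)=0$ for all $\varepsilon\in\bar D_\rho$. Consider the differential system $$\varepsilon z f'(\varepsilon,z)=F(\varepsilon,z,f(\varepsilon,z)),\qquad f'=\partial f/\partial z .$$ Assume that the $\nu\times\nu$ matrix $A_{0,1}(0)=F_f(0,0,0)$ is invertible and that, for some $\gamma>\pi$, all its eigenvalues $\lambda_1,\dots,\lambda_\nu$ satisfy $|\arg\lambda_j|>\gamma/2$, $j=1,\dots,\nu$ (with $\arg\lambda_j\in(-\pi,\pi]$). Let $\hat f(\varepsilon,z)=\sum_{i\ge0}a_i(z)\varepsilon^i$ be the unique formal solution of the system with coefficients $a_i$ holomorphic near $z=0$ and $a_0(0)=0$. Then there exists a radius $\sigma>0$ such that, for $z\in\bar D_\sigma$, the formal solution $\hat f(\varepsilon,z)$ is $1$-summable in the direction $\theta=0$.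
   Context: Notation: $D_r=\{z\in\mathbb{C}:|z|<r\}$, $\bar D_r$ is its closure, $F_f$ is the Jacobian matrix of $F$ with respect to $f\in\mathbb{C}^\nu$, and $\|\cdot\|$ is the Euclidean norm on $\mathbb{C}^\nu$. For $\gamma,E>0$, $S(\theta,\gamma;E)=\{\varepsilon:0<|\varepsilon|<E,\ |\arg\varepsilon-\theta|<\gamma/2\}$ is the sector of bisecting direction $\theta$, opening $\gamma$ and radius $E$. Formal solution: $\hat f=\sum_{i\ge0}a_i(z)\varepsilon^i$ with $a_i$ holomorphic ($\mathbb{C}^\nu$-valued) near $z=0$ and $a_0(0)=0$ is a formal solution if, after expanding $F(\varepsilon,z,\hat f(\varepsilon,z))$ in powers of $\varepsilon$, the coefficients of $\varepsilon^i$ on both sides of $\varepsilon z\hat f'=F(\varepsilon,z,\hat f)$ agree for every $i\ge0$. $1$-summability: the formal series $\hat f=\sum_i a_i(z)\varepsilon^i$, with coefficients holomorphic in $D_\sigma$ and continuous on $\bar D_\sigma$, is $1$-summable in the direction $\theta$ for $z\in\bar D_\sigma$ if there exist $\gamma'>\pi$, $E'>0$ and a function $f(\varepsilon,z)$, holomorphic in $S(\theta,\gamma';E')\times D_\sigma$ and continuous on $S(\theta,\gamma';E')\times \bar D_\sigma$, having $\hat f$ as its $1$-Gevrey asymptotic expansion as $\varepsilon\to0$, i.e. for every proper subsector $S'$ of $S(\theta,\gamma';E')$ (with closure contained in $S(\theta,\gamma';E')\cup\{0\}$) there are constants $C,\mu>0$ such that $$\Big\|f(\varepsilon,z)-\sum_{i=0}^{I-1}a_i(z)\varepsilon^i\Big\|\le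 C\,\mu^I\,I!\,|\varepsilon|^I\qquad\text{for all } I\ge0,\ \varepsilon\in S',\ z\in\bar D_\sigma .$$ *)

(* Defs.v *)
From HB Require Import structures.
From mathcomp Require Import all_boot all_order all_algebra.
From mathcomp Require Import complex.
From mathcomp Require Import all_classical all_reals all_analysis.
Set Implicit Arguments.
Unset Strict Implicit.
Unset Printing Implicit Defensive.
Import Order.TTheory GRing.Theory Num.Theory.
Import numFieldNormedType.Exports.
Local Open Scope classical_set_scope.
Local Open Scope ring_scope.
Local Open Scope complex_scope.

(* MathComp and MathComp-Analysis.  [R[i]^o] is [R[i]] seen as a normed space
   over itself, so that [differentiable] below is complex differentiability.
   Vectors of C^nu are row vectors; their library (sup) norm is used only for
   topology and differentiability, where all norms are equivalent. *)

(* The modulus of [z] as an element of [R]; [`|z|] is an element of [R[i]]. *)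
Definition cmod (R : realType) (z : R[i]) : R := Normc.normc z.

Definition enorm (R : realType) (nu : nat) (v : 'rV[R[i]]_nu) : R :=
  Num.sqrt (\sum_(j < nu) cmod (v 0 j) ^+ 2).

Definition disc (R : realType) (r : R) : set R[i]^o := [set z | cmod z < r].

Definition cdisc (R : realType) (r : R) : set R[i]^o := [set z | cmod z <= r].

Definition cpolydisc (R : realType) (nu : nat) (r r1 : R) :
    set (R[i]^o * R[i]^o * 'rV[R[i]]_nu) :=
  [set p : R[i]^o * R[i]^o * 'rV[R[i]]_nu |
    [/\ cdisc r p.1.1, cdisc r1 p.1.2 & forall j, cdisc r (p.2 0 j)]].

(* Meant for open [U]. *)
Definition holomorphic_on (R : realType) (V W : normedModType R[i])
    (U : set V) (f : V -> W) : Prop :=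
  forall x, U x -> differentiable f x.

Definition holomorphic_near (R : realType) (V W : normedModType R[i])
    (K : set V) (f : V -> W) : Prop :=
  exists U : set V, [/\ open U, K `<=` U & holomorphic_on U f].

(* Stated for normed modules so that the topology of ['rV[R[i]]_nu] is inferred. *)
Definition continuous_on (R : realType) (V W : normedModType R[i])
    (U : set V) (f : V -> W) : Prop :=
  {within U, continuous f}.

(* [t] is one of the determinations of the argument of [z]. *)
Definition is_arg (R : realType) (z : R[i]) (t : R) : Prop :=
  z = (cmod z * cos t) +i* (cmod z * sin t).

(* A subset of the complex plane.  An opening larger than 2 pi gives the whole
   punctured disc rather than a sector of the Riemann surface of the logarithm;
   [one_summable] is not affected, as one may always decrease the opening. *)
Definition sector (R : realType) (theta gamma E : R) : set R[i]^o :=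
  [set e | 0 < cmod e < E /\
           exists2 t : R, is_arg e t & `|t - theta| < gamma / 2].

(* F_f(0,0,0), with entry (j, k) equal to dF^j/df^k; the library's [jacobian]
   acts on row vectors, whence the transposition. *)
Definition A01_0 (R : realType) (nu : nat)
    (F : R[i]^o * R[i]^o * 'rV[R[i]]_nu -> 'rV[R[i]]_nu) : 'M[R[i]]_nu :=
  (jacobian (fun w : 'rV[R[i]]_nu => F (0, 0, w)) 0)^T.

(* Coefficient of e^i in the expansion of F (e, z, sum_j a_j(z) e^j).
   The terms with j > i do not contribute, so this is the i-th Taylor
   coefficient at e = 0 after truncating the inner series. *)
Definition rhs_coef (R : realType) (nu : nat)
    (F : R[i]^o * R[i]^o * 'rV[R[i]]_nu -> 'rV[R[i]]_nu)
    (a : nat -> R[i]^o -> 'rV[R[i]]_nu) (i : nat) (z : R[i]) : 'rV[R[i]]_nu :=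
  (i`!%:R : R[i])^-1 *:
    derive1n i (fun e : R[i] => F (e, z, \sum_(j < i.+1) e ^+ j *: a j z)) 0.

(* Coefficient of e^i in e z (d/dz) (sum_j a_j(z) e^j). *)
Definition lhs_coef (R : realType) (nu : nat)
    (a : nat -> R[i]^o -> 'rV[R[i]]_nu) (i : nat) (z : R[i]) : 'rV[R[i]]_nu :=
  if i is k.+1 then z *: derive1 (a k : R[i] -> 'rV[R[i]]_nu) z else 0.

(* The [a i] matter only as germs at 0: the neighbourhoods on which they are
   holomorphic and satisfy the equations may depend on [i]. *)
Definition formal_solution (R : realType) (nu : nat)
    (F : R[i]^o * R[i]^o * 'rV[R[i]]_nu -> 'rV[R[i]]_nu)
    (a : nat -> R[i]^o -> 'rV[R[i]]_nu) : Prop :=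
  [/\ a 0%N 0 = 0,
      forall i, holomorphic_near [set (0 : R[i]^o)] (a i)
    & forall i, \forall z \near (0 : R[i]^o), lhs_coef a i z = rhs_coef F a i z].

(* 1-Gevrey asymptotics of [f] on S(theta, gamma; E), uniformly on the closed
   disc of radius [sigma]; the constants depend on the subsector. *)
Definition gevrey1_asymptotic (R : realType) (nu : nat) (theta gamma E sigma : R)
    (f : R[i]^o * R[i]^o -> 'rV[R[i]]_nu)
    (a : nat -> R[i]^o -> 'rV[R[i]]_nu) : Prop :=
  forall theta1 gamma1 E1 : R, 0 < gamma1 -> 0 < E1 ->
    closure (sector theta1 gamma1 E1) `<=` sector theta gamma E `|` [set 0] ->
    exists K mu : R, [/\ 0 < K, 0 < mu &
      forall (n : nat) (e z : R[i]), sector theta1 gamma1 E1 e -> cdisc sigma z ->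
        enorm (f (e, z) - \sum_(i < n) e ^+ i *: a i z)
          <= K * mu ^+ n * n`!%:R * cmod e ^+ n].

Definition one_summable (R : realType) (nu : nat) (theta sigma : R)
    (a : nat -> R[i]^o -> 'rV[R[i]]_nu) : Prop :=
  (forall i, holomorphic_on (disc sigma) (a i) /\
             continuous_on (cdisc sigma) (a i)) /\
  exists (gamma E : R) (f : R[i]^o * R[i]^o -> 'rV[R[i]]_nu),
    [/\ pi < gamma, 0 < E,
        holomorphic_on (sector theta gamma E `*` disc sigma) f,
        continuous_on (sector theta gamma E `*` cdisc sigma) f
      & gevrey1_asymptotic theta gamma E sigma f a].

(* Main.v *)
(** Write f = sum_n c_n(e) z^n.  Since the linear part A = F_f(0,0,0) acts on
    the coefficients, the system becomes c_n = (e n - A)^-1 N_n, where N_n is the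
    n-th coefficient in z of the remaining part of F.  The spectral hypothesis
    bounds (e n - A)^-1 uniformly in n on a cone of opening larger than pi, and,
    for e n small, also on a disc of radius of order 1/n.  Replacing the
    resolvents of order above n by 0, which does not affect c_n, one solves this
    fixed point equation by Picard iteration in a Wiener algebra of power series
    in z over the union of the cone and of the disc |e| < d/(n+1); hence c_n is
    holomorphic there and bounded by mu / s^n.

    Near e = 0 the Taylor coefficients of c_n are the n-th coefficients of the
    a_i, because truncations of the formal solution solve the same equation up to
    O(e^(i+1)).  Cauchy's estimates on discs of radius d/(n+1), together with
    (n+1)^i <= i! 2^(n+i), then give the 1-Gevrey bounds for f on the cone; it is
    never needed that f solves the system. *)
Require Import Defs.
From mathcomp Require Import all_boot all_order all_algebra.
From mathcomp Require Import fingroup perm complex.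
From mathcomp Require Import all_classical all_reals all_analysis.
From mathcomp Require Import ring lra zify.
Import Order.TTheory GRing.Theory Num.Theory.
Import numFieldNormedType.Exports.
Local Open Scope classical_set_scope.
Local Open Scope ring_scope.
Local Open Scope complex_scope.

Set Implicit Arguments.
Unset Strict Implicit.
Unset Printing Implicit Defensive.

#[global] Arguments cmod : simpl never.

(** * Complex limits and derivatives *)

Section Basics.
Variable R : realType.
Notation C := R[i].
Implicit Types (x y z l h : C) (u w : nat -> C) (f g : C -> C).

(** The poles of [(e n - A)^-1] are the points [lambda / n], [lambda] an eigenvalue of [A]. They
    accumulate at [e = 0], and a disc around 0 that avoids those of order at most [n] has radius of
    order [1 / n]: this shrinking is the source of the factorials. The l1 norm is chosen because
    [e z d/dz] is diagonal on the powers of [z]. A bounded family of matrices, one for each order,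
    acts on this norm with a bound that depends on no regularity in the order, and the norm is also
    compatible with products. All constants of the contraction depend on the bound of the resolvents
    and not on [n], so the bounds on the [c_n] are uniform although each [c_n] is read off a
    truncated equation of its own. The nonlinear part is flat only in the directions of [f]; its
    dependence on [e] and [z] is made small by shrinking their ranges. The complex analysis rests on
    dyadic Riemann sums, whose cancellations are exact at every level, so that limits are taken only
    of sums over squares and of means over circles. *)

Lemma cmodM x y : cmod (x * y) = cmod x * cmod y. Proof. exact: Normc.normcM. Qed.
Lemma cmod0 : cmod (0 : C) = 0. Proof. exact: Normc.normc0. Qed.
Lemma cmod1 : cmod (1 : C) = 1. Proof. exact: Normc.normc1. Qed.
Lemma cmodN x : cmod (- x) = cmod x. Proof. exact: normcN. Qed.
Lemma cmodD x y : cmod (x + y) <= cmod x + cmod y. Proof. exact: le_normcD. Qed.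
Lemma cmodV x : cmod x^-1 = (cmod x)^-1. Proof. exact: Normc.normcV. Qed.
Lemma cmod_ge0 x : 0 <= cmod x. Proof. by case: x => a b; exact: sqrtr_ge0. Qed.
Lemma cmod0_eq0 x : cmod x = 0 -> x = 0. Proof. exact: Normc.eq0_normc. Qed.
Lemma cmod_eq0 x : (cmod x == 0) = (x == 0).
Proof. by apply/eqP/eqP => [|->]; [exact: cmod0_eq0 | exact: cmod0]. Qed.
Lemma cmod_gt0 x : (0 < cmod x) = (x != 0).
Proof. by rewrite lt_def cmod_ge0 andbT cmod_eq0. Qed.
Lemma cmodX x n : cmod (x ^+ n) = cmod x ^+ n.
Proof. by elim: n => [|n IH]; rewrite ?expr0 ?cmod1 // !exprS cmodM IH. Qed.
Lemma cmodC (a : R) : cmod (a%:C) = `|a|.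
Proof. by rewrite /cmod /= expr0n /= addr0 sqrtr_sqr. Qed.
Lemma cmodC_ge0 (a : R) : 0 <= a -> cmod (a%:C) = a.
Proof. by move=> a0; rewrite cmodC ger0_norm. Qed.
Lemma cmodB x y : cmod (x - y) = cmod (y - x).
Proof. by rewrite -cmodN opprB. Qed.
Lemma cmodBD x y : cmod (x - y) <= cmod x + cmod y.
Proof. by rewrite -(cmodN y) cmodD. Qed.
Lemma cmod_lb x y : cmod x - cmod y <= cmod (x - y).
Proof. by have := cmodD (x - y) y; rewrite subrK; lra. Qed.
Lemma cmod_tri y x z : cmod (x - z) <= cmod (x - y) + cmod (y - z).
Proof. by have := cmodD (x - y) (y - z); rewrite addrA subrK. Qed.
Lemma cmod_sum (I : Type) (r : seq I) (P : pred I) (F : I -> C) :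
  cmod (\sum_(i <- r | P i) F i) <= \sum_(i <- r | P i) cmod (F i).
Proof.
apply: (big_ind2 (fun a b => cmod a <= b)); rewrite ?cmod0 //.
by move=> a b c d h1 h2; apply: le_trans (cmodD _ _) (lerD _ _).
Qed.
Lemma Re_le_cmod x : `|complex.Re x| <= cmod x.
Proof.
case: x => a b; rewrite /cmod /= -sqrtr_sqr ler_sqrt ?addr_ge0 ?sqr_ge0 //.
by rewrite lerDl sqr_ge0.
Qed.
Lemma Im_le_cmod x : `|complex.Im x| <= cmod x.
Proof.
case: x => a b; rewrite /cmod /= -sqrtr_sqr ler_sqrt ?addr_ge0 ?sqr_ge0 //.
by rewrite lerDr sqr_ge0.
Qed.
Lemma cmod_sqr x : cmod x ^+ 2 = complex.Re x ^+ 2 + complex.Im x ^+ 2.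
Proof. by case: x => a b; rewrite /cmod /= sqr_sqrtr // addr_ge0 ?sqr_ge0. Qed.
Lemma cmod_le_ReIm x : cmod x <= `|complex.Re x| + `|complex.Im x|.
Proof.
rewrite {1}[x]complexE.
apply: le_trans (cmodD _ _) _; rewrite cmodM !cmodC.
suff -> : cmod ('i%C : C) = 1 by rewrite mul1r.
by rewrite /cmod /= expr0n /= add0r expr1n sqrtr1.
Qed.
Lemma real_complexD (a b : R) : (a + b)%:C = a%:C + b%:C :> C. Proof. exact: rmorphD. Qed.
Lemma real_complexM (a b : R) : (a * b)%:C = a%:C * b%:C :> C. Proof. exact: rmorphM. Qed.
Lemma real_complexB (a b : R) : (a - b)%:C = a%:C - b%:C :> C. Proof. exact: rmorphB. Qed.
Lemma cmod_nat n : cmod (n%:R : C) = n%:R.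
Proof. by rewrite -(rmorph_nat (real_complex R)) cmodC_ge0 // ler0n. Qed.

Definition cv u l := forall e : R, 0 < e ->
  exists N, forall n, (N <= n)%N -> cmod (u n - l) < e.

Lemma cv_cst l : cv (fun=> l) l.
Proof. by move=> e e0; exists 0%N => n _; rewrite subrr cmod0. Qed.

Lemma cv_squeeze (v : nat -> R) u l :
  (forall e : R, 0 < e -> exists N, forall n, (N <= n)%N -> v n < e) ->
  (exists N, forall n, (N <= n)%N -> cmod (u n - l) <= v n) -> cv u l.
Proof.
move=> hv [N1 hN1] e e0; have [N2 hN2] := hv e e0.
exists (maxn N1 N2) => n; rewrite geq_max => /andP[n1 n2].
exact: le_lt_trans (hN1 n n1) (hN2 n n2).
Qed.

Lemma cvD u w a b : cv u a -> cv w b -> cv (fun n => u n + w n) (a + b).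
Proof.
move=> hu hw e e0; have e2 : 0 < e / 2 by lra.
have [N1 h1] := hu _ e2; have [N2 h2] := hw _ e2.
exists (maxn N1 N2) => n; rewrite geq_max => /andP[/h1 n1 /h2 n2].
have -> : u n + w n - (a + b) = (u n - a) + (w n - b) by ring.
by have := cmodD (u n - a) (w n - b); lra.
Qed.

Lemma cvZ c u a : cv u a -> cv (fun n => c * u n) (c * a).
Proof.
move=> hu e e0; have c0 := cmod_ge0 c.
have [N h] := hu (e / (cmod c + 1)) (divr_gt0 e0 (ltr_wpDl c0 ltr01)).
exists N => n /h; rewrite -mulrBr cmodM ltr_pdivlMr; last lra.
by have := cmod_ge0 (u n - a); nra.
Qed.

Lemma cvN u a : cv u a -> cv (fun n => - u n) (- a).
Proof. by move=> h e /h[N hN]; exists N => n /hN; rewrite -opprD cmodN. Qed.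

Lemma cvB u w a b : cv u a -> cv w b -> cv (fun n => u n - w n) (a - b).
Proof. by move=> hu hw; apply: cvD => //; exact: cvN. Qed.

Lemma cv_sum m (u : nat -> nat -> C) (l : nat -> C) :
  (forall k, (k < m)%N -> cv (fun n => u n k) (l k)) ->
  cv (fun n => \sum_(k < m) u n k) (\sum_(k < m) l k).
Proof.
elim: m => [|m IH] h.
  by under eq_fun do rewrite big_ord0; rewrite big_ord0; exact: cv_cst.
under eq_fun do rewrite big_ord_recr /=; rewrite big_ord_recr /=.
by apply: cvD; [apply: IH => k km; apply: h; rewrite ltnS ltnW | exact: h].
Qed.

Lemma cv_le u l c (b : R) : cv u l ->
  (exists N, forall n, (N <= n)%N -> cmod (u n - c) <= b) -> cmod (l - c) <= b.
Proof.
move=> hu [N hN]; rewrite leNgt; apply/negP => hb.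
have [M hM] := hu (cmod (l - c) - b) ltac:(lra).
have n1 := hM _ (leq_maxr N M); have n2 := hN _ (leq_maxl N M).
have := cmod_tri (u (maxn N M)) l c; rewrite (cmodB l (u _)); lra.
Qed.

Lemma cv_le0 u l (b : R) : cv u l ->
  (exists N, forall n, (N <= n)%N -> cmod (u n) <= b) -> cmod l <= b.
Proof.
move=> hu [N hN]; rewrite -(subr0 l); apply: (cv_le hu).
by exists N => n; rewrite subr0; exact: hN.
Qed.

Lemma cv_unique u a b : cv u a -> cv u b -> a = b.
Proof.
move=> ha hb; apply/eqP; rewrite -subr_eq0 -cmod_eq0 eq_le cmod_ge0 andbT.
rewrite leNgt; apply/negP => h.
have [N hN] := hb _ (divr_gt0 h (ltr0n _ 2)).
have : cmod (a - b) <= cmod (a - b) / 2.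
  by apply: (cv_le ha); exists N => n /hN/ltW.
lra.
Qed.

Lemma cv_ext u w a : (forall n, u n = w n) -> cv u a -> cv w a.
Proof. by move=> e h d /h[N hN]; exists N => n /hN; rewrite e. Qed.

Lemma geo_small (q e : R) : 0 <= q < 1 -> 0 < e ->
  exists N, forall n, (N <= n)%N -> q ^+ n < e.
Proof.
move=> /andP[q0 q1] e0; have : `|q| < 1 by rewrite ger0_norm.
move=> /cvg_expr/cvgrPdist_lt/(_ e e0)[N _ hN]; exists N => n /hN /=.
by rewrite sub0r normrN ger0_norm // exprn_ge0.
Qed.

Lemma geo_small_mul (c q e : R) : 0 <= q < 1 -> 0 <= c -> 0 < e ->
  exists N, forall n, (N <= n)%N -> c * q ^+ n < e.
Proof.
move=> hq c0 e0; have c1 : 0 < c + 1 by lra.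
have [N hN] := geo_small hq (divr_gt0 e0 c1).
exists N => n /hN; rewrite ltr_pdivlMr // => h.
have : 0 <= q ^+ n by apply: exprn_ge0; case/andP: hq.
by nra.
Qed.

Lemma real_cauchy (a : nat -> R) :
  (forall e : R, 0 < e -> exists N, forall n m, (N <= n)%N -> (N <= m)%N -> `|a n - a m| < e) ->
  exists l : R, forall e : R, 0 < e -> exists N, forall n, (N <= n)%N -> `|a n - l| < e.
Proof.
move=> h; suff : cvg (a @ \oo).
  move=> /cvg_ex[l /cvgrPdist_lt hl]; exists l => e /hl[N _ hN].
  by exists N => n /hN /=; rewrite distrC.
apply: cauchy_cvg; apply: cauchy_exP => e e0.
have [N hN] := h e e0; exists (a N); exists N => //= n Nn.
exact: hN.
Qed.

Lemma cv_cauchy u :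
  (forall e : R, 0 < e -> exists N, forall n m, (N <= n)%N -> (N <= m)%N ->
     cmod (u n - u m) < e) -> exists l, cv u l.
Proof.
move=> h.
have [a ha] : exists l : R, forall e : R, 0 < e ->
    exists N, forall n, (N <= n)%N -> `|complex.Re (u n) - l| < e.
  apply: real_cauchy => e /h[N hN]; exists N => n m n1 m1.
  apply: le_lt_trans (hN _ _ n1 m1); rewrite -raddfB; exact: Re_le_cmod.
have [b hb] : exists l : R, forall e : R, 0 < e ->
    exists N, forall n, (N <= n)%N -> `|complex.Im (u n) - l| < e.
  apply: real_cauchy => e /h[N hN]; exists N => n m n1 m1.
  apply: le_lt_trans (hN _ _ n1 m1); rewrite -raddfB; exact: Im_le_cmod.
exists (a +i* b) => e e0; have e2 : 0 < e / 2 by lra.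
have [N1 h1] := ha _ e2; have [N2 h2] := hb _ e2.
exists (maxn N1 N2) => n; rewrite geq_max => /andP[/h1 n1 /h2 n2].
apply: le_lt_trans (cmod_le_ReIm _) _.
case: (u n) n1 n2 => c d /=; lra.
Qed.

Lemma cv_cauchyE u l : cv u l -> forall e : R, 0 < e ->
  exists N, forall n m, (N <= n)%N -> (N <= m)%N -> cmod (u n - u m) < e.
Proof.
move=> h e e0; have [N hN] := h _ (divr_gt0 e0 (ltr0n _ 2)).
exists N => n m /hN n1 /hN m1.
by have := cmod_tri l (u n) (u m); rewrite (cmodB l (u m)); lra.
Qed.

Lemma geo_sum_le (q : R) n : 0 <= q <= 1 / 2 -> \sum_(k < n) q ^+ k <= 2.
Proof.
move=> /andP[q0 q1].
suff : \sum_(k < n) q ^+ k <= 2 - 2 * q ^+ n by have := exprn_ge0 n q0; lra.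
elim: n => [|n IH]; first by rewrite big_ord0 expr0; lra.
rewrite big_ord_recr /= exprS.
have := exprn_ge0 n q0; nra.
Qed.

(** A first order approximation in which the increment 0 is allowed: no quotient has to be formed,
    and identities between increments are left to [ring]. *)
Definition cdiff f z := exists l, forall e : R, 0 < e -> exists2 d : R, 0 < d &
  forall h, cmod h <= d -> cmod (f (z + h) - f z - l * h) <= e * cmod h.

Definition hasd f z l := forall e : R, 0 < e -> exists2 d : R, 0 < d &
  forall h, cmod h <= d -> cmod (f (z + h) - f z - l * h) <= e * cmod h.

Lemma hasd_cdiff f z l : hasd f z l -> cdiff f z. Proof. by exists l. Qed.

Lemma hasd_cst a z : hasd (fun=> a) z 0.
Proof.
by move=> e e0; exists 1 => // h _; rewrite subrr mul0r subr0 cmod0 mulr_ge0 ?cmod_ge0 // ltW.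
Qed.
Lemma hasd_id z : hasd id z 1.
Proof.
move=> e e0; exists 1 => // h _.
have -> : id (z + h) - id z - 1 * h = 0 by rewrite /=; ring.
by rewrite cmod0 mulr_ge0 ?cmod_ge0 // ltW.
Qed.
Lemma hasdD f g z a b : hasd f z a -> hasd g z b -> hasd (fun x => f x + g x) z (a + b).
Proof.
move=> hf hg e e0; have e2 : 0 < e / 2 by lra.
have [d1 d10 h1] := hf _ e2; have [d2 d20 h2] := hg _ e2.
exists (Num.min d1 d2) => [|h]; first by rewrite lt_min d10.
rewrite le_min => /andP[/h1 {}h1 /h2 {}h2].
have -> : f (z + h) + g (z + h) - (f z + g z) - (a + b) * h =
  (f (z + h) - f z - a * h) + (g (z + h) - g z - b * h) by ring.
by apply: le_trans (cmodD _ _) _; lra.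
Qed.
Lemma hasd_lip f z a : hasd f z a -> exists2 d : R, 0 < d &
  forall h, cmod h <= d -> cmod (f (z + h) - f z) <= (cmod a + 1) * cmod h.
Proof.
move=> /(_ 1 ltr01)[d d0 hd]; exists d => // h /hd H.
have -> : f (z + h) - f z = (f (z + h) - f z - a * h) + a * h by ring.
by apply: le_trans (cmodD _ _) _; rewrite cmodM; lra.
Qed.
Lemma hasd_comp f g z a b : hasd f z a -> hasd g (f z) b ->
  hasd (fun x => g (f x)) z (b * a).
Proof.
move=> hf hg e e0.
have a0 := cmod_ge0 a; have b0 := cmod_ge0 b.
have [d1 d10 h1] := hasd_lip hf.
have e1 : 0 < e / 2 / (cmod a + 1) by apply: divr_gt0; lra.
have e2 : 0 < e / 2 / (cmod b + 1) by apply: divr_gt0; lra.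
have [d2 d20 h2] := hf _ e2; have [d3 d30 h3] := hg _ e1.
have d40 : 0 < d3 / (cmod a + 1) by apply: divr_gt0; lra.
exists (Num.min d1 (Num.min d2 (d3 / (cmod a + 1)))) => [|h].
  by rewrite !lt_min d10 d20.
rewrite !le_min => /and3P[/h1 H1 /h2 H2]; rewrite ler_pdivlMr; last lra.
move=> H4.
have {}H3 := h3 (f (z + h) - f z) ltac:(lra).
rewrite [f z + _]addrC subrK in H3.
have -> : g (f (z + h)) - g (f z) - b * a * h =
  (g (f (z + h)) - g (f z) - b * (f (z + h) - f z)) + b * (f (z + h) - f z - a * h) by ring.
apply: le_trans (cmodD _ _) _; rewrite cmodM.
have hh := cmod_ge0 h.
have : e / 2 / (cmod a + 1) * cmod (f (z + h) - f z) <= e / 2 * cmod h.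
  rewrite mulrAC ler_pdivrMr; last lra.
  by rewrite -[leRHS]mulrA ler_pM2l; [rewrite [leRHS]mulrC|lra].
have : cmod b * cmod (f (z + h) - f z - a * h) <= e / 2 * cmod h.
  apply: le_trans (ler_wpM2l b0 H2) _.
  rewrite mulrA ler_wpM2r // mulrA ler_pdivrMr; last lra.
  nra.
lra.
Qed.
Lemma hasdZ c f z a : hasd f z a -> hasd (fun x => c * f x) z (c * a).
Proof.
move=> hf e e0; have c0 := cmod_ge0 c.
have [d d0 h] := hf (e / (cmod c + 1)) ltac:(apply: divr_gt0; lra).
exists d => // x /h H.
have -> : c * f (z + x) - c * f z - c * a * x = c * (f (z + x) - f z - a * x) by ring.
rewrite cmodM; apply: le_trans (ler_wpM2l c0 H) _.
rewrite mulrA ler_wpM2r ?cmod_ge0 // mulrA ler_pdivrMr; last lra.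
nra.
Qed.
Lemma hasd_sqr z : hasd (fun x => x * x) z (2 * z).
Proof.
move=> e e0; exists e => // h he.
have -> : (z + h) * (z + h) - z * z - 2 * z * h = h * h by ring.
by rewrite cmodM ler_wpM2r ?cmod_ge0.
Qed.
Lemma hasd_ext f g z a : (forall x, f x = g x) -> hasd f z a -> hasd g z a.
Proof.
move=> e h d d0; have [r r0 hr] := h d d0; exists r => // x /hr; by rewrite !e.
Qed.
(* Polarisation reduces the product rule to that of the square. *)
Lemma hasdM f g z a b : hasd f z a -> hasd g z b ->
  hasd (fun x => f x * g x) z (a * g z + f z * b).
Proof.
move=> hf hg.
have hs := hasd_comp (hasdD hf hg) (hasd_sqr _).
have hd := hasd_comp (hasdD hf (hasdZ (-1) hg)) (hasd_sqr _).
have := hasdZ (4^-1) (hasdD hs (hasdZ (-1) hd)).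
have -> : 4^-1 * (2 * (f z + g z) * (a + b) +
   -1 * (2 * (f z + -1 * g z) * (a + -1 * b))) = a * g z + f z * b.
  by field.
apply: hasd_ext => x; by field.
Qed.
Lemma hasd_inv z : z != 0 -> hasd (fun x => x^-1) z (- (z ^+ 2)^-1).
Proof.
rewrite -cmod_gt0 => z0 e e0.
have d0 : 0 < e * cmod z ^+ 3 / 2 by rewrite divr_gt0 // mulr_gt0 // exprn_gt0.
have z2 : 0 < cmod z / 2 by lra.
exists (Num.min (cmod z / 2) (e * cmod z ^+ 3 / 2)) => [|h].
  by rewrite lt_min z2.
rewrite le_min => /andP[h1 h2].
have zh : cmod z / 2 <= cmod (z + h).
  by have := cmod_lb z (- h); rewrite opprK cmodN; lra.
have zh0 : z + h != 0 by rewrite -cmod_gt0; lra.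
have zn : z != 0 by rewrite -cmod_gt0.
have -> : (z + h)^-1 - z^-1 - - (z ^+ 2)^-1 * h = h * h / (z ^+ 2 * (z + h)).
  by field; rewrite zn zh0.
rewrite !cmodM cmodV cmodM cmodX.
have hh := cmod_ge0 h.
rewrite ler_pdivrMr; last by rewrite mulr_gt0 ?exprn_gt0 // cmod_gt0.
rewrite [leRHS]mulrAC ler_wpM2r //; apply: le_trans h2 _.
rewrite -[e * _ / 2]mulrA ler_pM2l // exprSr -mulrA ler_wpM2l //.
by rewrite exprn_ge0 // ltW.
Qed.

Lemma cdiff_cst a z : cdiff (fun=> a) z. Proof. exact: hasd_cdiff (hasd_cst _ _). Qed.
Lemma cdiff_id z : cdiff id z. Proof. exact: hasd_cdiff (hasd_id _). Qed.
Lemma cdiffD f g z : cdiff f z -> cdiff g z -> cdiff (fun x => f x + g x) z.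
Proof. by move=> [a ha] [b hb]; exact: hasd_cdiff (hasdD ha hb). Qed.
Lemma cdiffM f g z : cdiff f z -> cdiff g z -> cdiff (fun x => f x * g x) z.
Proof. by move=> [a ha] [b hb]; exact: hasd_cdiff (hasdM ha hb). Qed.
Lemma cdiff_comp f g z : cdiff f z -> cdiff g (f z) -> cdiff (fun x => g (f x)) z.
Proof. by move=> [a ha] [b hb]; exact: hasd_cdiff (hasd_comp ha hb). Qed.
Lemma cdiffZ c f z : cdiff f z -> cdiff (fun x => c * f x) z.
Proof. by move=> [a ha]; exact: hasd_cdiff (hasdZ c ha). Qed.
Lemma cdiff_ext f g z : (forall x, f x = g x) -> cdiff f z -> cdiff g z.
Proof. by move=> e [a ha]; exact: hasd_cdiff (hasd_ext e ha). Qed.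
Lemma cdiffB f g z : cdiff f z -> cdiff g z -> cdiff (fun x => f x - g x) z.
Proof.
move=> hf hg; apply: (cdiff_ext (f := fun x => f x + -1 * g x)) => [x|]; first by ring.
by apply: cdiffD => //; exact: cdiffZ.
Qed.
Lemma cdiffV f z : cdiff f z -> f z != 0 -> cdiff (fun x => (f x)^-1) z.
Proof.
by move=> hf h0; apply: (cdiff_comp (g := fun x => x^-1)) => //; exact: hasd_cdiff (hasd_inv h0).
Qed.
Lemma cdiff_sum (I : Type) (r : seq I) (P : pred I) (F : I -> C -> C) z :
  (forall i, P i -> cdiff (F i) z) -> cdiff (fun x => \sum_(i <- r | P i) F i x) z.
Proof.
move=> h; elim: r => [|i r IH].
  by apply: (cdiff_ext (f := fun=> 0)) => [x|]; [rewrite big_nil|exact: cdiff_cst].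
have [Pi|Pi] := boolP (P i).
  apply: (cdiff_ext (f := fun x => F i x + \sum_(i <- r | P i) F i x)) => [x|].
    by rewrite big_cons Pi.
  by apply: cdiffD => //; exact: h.
apply: (cdiff_ext (f := fun x => \sum_(i <- r | P i) F i x)) => // x.
by rewrite big_cons (negbTE Pi).
Qed.
Lemma cdiffX f z n : cdiff f z -> cdiff (fun x => f x ^+ n) z.
Proof.
move=> hf; elim: n => [|n IH].
  by apply: (cdiff_ext (f := fun=> 1)) => [x|]; [rewrite expr0|exact: cdiff_cst].
by apply: (cdiff_ext (f := fun x => f x * f x ^+ n)) => [x|]; [rewrite exprS|exact: cdiffM].
Qed.
Lemma cdiff_eqnear f g z (d : R) : 0 < d -> (forall x, cmod (x - z) < d -> f x = g x) ->
  cdiff f z -> cdiff g z.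
Proof.
move=> d0 e [a ha]; exists a => r r0; have [d' d'0 hd'] := ha r r0.
exists (Num.min d' (d / 2)) => [|h]; first by rewrite lt_min d'0; lra.
rewrite le_min => /andP[/hd' + h2].
rewrite !e ?subrr ?cmod0 //.
by have -> : z + h - z = h by [ring]; lra.
Qed.
Lemma cdiff_cont f z : cdiff f z -> forall e : R, 0 < e -> exists2 d : R, 0 < d &
  forall x, cmod (x - z) <= d -> cmod (f x - f z) <= e.
Proof.
move=> [a /hasd_lip[d d0 hd]] e e0; have a0 := cmod_ge0 a.
have e1 : 0 < e / (cmod a + 1) by apply: divr_gt0; lra.
exists (Num.min d (e / (cmod a + 1))) => [|x]; first by rewrite lt_min d0.
rewrite le_min => /andP[/hd]; rewrite [z + _]addrC subrK => H.
rewrite ler_pdivlMr; last lra.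
nra.
Qed.

End Basics.

(** * Goursat's theorem by bisection *)

Section Goursat.
Variables (R : realType) (u v : R[i]).
Notation C := R[i].
Implicit Types (H : R -> R -> C) (x y s : R).

Definition dyadic_sum n x s (f : R -> C) : C :=
  \sum_(j < 2 ^ n) f (x + s * j%:R / 2 ^+ n).

(* Riemann sum of H d(x u + y v) along the boundary of the square with lower
   left corner (x, y) and side s. *)
Definition loop_sum H n x y s : C := (s / 2 ^+ n)%:C *
  (u * (dyadic_sum n x s (H ^~ y) - dyadic_sum n x s (H ^~ (y + s))) +
   v * (dyadic_sum n y s (H (x + s)) - dyadic_sum n y s (H x))).

Lemma dyadic_sum_split n x s f :
  dyadic_sum n.+1 x s f = dyadic_sum n x (s / 2) f + dyadic_sum n (x + s / 2) (s / 2) f.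
Proof.
have p0 : (2 ^+ n : R) != 0 by rewrite expf_eq0 pnatr_eq0 andbF.
rewrite /dyadic_sum -(big_mkord xpredT (fun j => f (x + s * j%:R / 2 ^+ n.+1))).
rewrite (big_cat_nat _ (n := 2 ^ n)) //=; last by rewrite leq_exp2l.
rewrite big_mkord; congr (_ + _).
  apply: eq_bigr => j _; congr f; rewrite exprS; field; exact: p0.
rewrite -{1}[(2 ^ n)%N]add0n big_addn expnS mul2n -addnn addnK big_mkord.
apply: eq_bigr => j _; congr f; rewrite natrD natrX exprS; field; exact: p0.
Qed.

(** Neighbouring quarters sample their common edge at the same nodes, so the inner edges cancel
    exactly at every level; the price is that the level drops by one. *)
Lemma loop_sum_split H n x y s : loop_sum H n.+1 x y s =
  loop_sum H n x y (s / 2) + loop_sum H n (x + s / 2) y (s / 2) +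
  loop_sum H n x (y + s / 2) (s / 2) + loop_sum H n (x + s / 2) (y + s / 2) (s / 2).
Proof.
have e2 a : a + s / 2 + s / 2 = a + s by field.
have p0 : (2 ^+ n : R) != 0 by rewrite expf_eq0 pnatr_eq0 andbF.
rewrite /loop_sum !e2 !dyadic_sum_split.
have -> : s / 2 ^+ n.+1 = s / 2 / 2 ^+ n by rewrite exprS; field; exact: p0.
ring.
Qed.

Lemma dyadic_sumB n x s f g :
  dyadic_sum n x s (fun t => f t - g t) = dyadic_sum n x s f - dyadic_sum n x s g.
Proof. by rewrite /dyadic_sum sumrB. Qed.

Lemma dyadic_node n x s (j : 'I_(2 ^ n)) : 0 <= s ->
  x <= x + s * j%:R / 2 ^+ n <= x + s.
Proof.
move=> s0; have p0 : 0 < (2 ^+ n : R) by rewrite exprn_gt0.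
have j0 : 0 <= (j%:R : R) by rewrite ler0n.
have j1 : (j%:R : R) <= 2 ^+ n by rewrite -natrX ler_nat ltnW.
rewrite lerDl lerD2l ler_pdivrMr // ler_wpM2l // andbT.
by rewrite divr_ge0 ?mulr_ge0 // ltW.
Qed.

Lemma dyadic_sum_le n x s f (m : R) : 0 <= s ->
  (forall t, x <= t <= x + s -> cmod (f t) <= m) ->
  cmod (dyadic_sum n x s f) <= 2 ^+ n * m.
Proof.
move=> s0 h; apply: le_trans (cmod_sum _ _ _) _.
have -> : 2 ^+ n * m = \sum_(j < 2 ^ n) m.
  by rewrite sumr_const card_ord -[m *+ _]mulr_natl natrX.
by apply: ler_sum => j _; apply: h; exact: dyadic_node.
Qed.

(** Discrete form of the existence of a primitive. Opposite sides are sampled at the same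
    parameters, so values at corresponding nodes differ by the constants [b s v] and [b s u], whose
    contributions [u (b s v)] and [v (b s u)] cancel. *)
Lemma loop_sum_affine a b n x y s :
  loop_sum (fun x' y' => a + b * (x'%:C * u + y'%:C * v)) n x y s = 0.
Proof.
rewrite /loop_sum /dyadic_sum -!sumrB !mulr_sumr -big_split /=.
rewrite big1 ?mulr0 // => j _; rewrite !real_complexD; ring.
Qed.

Lemma loop_sumB H K n x y s : loop_sum (fun a b => H a b - K a b) n x y s =
  loop_sum H n x y s - loop_sum K n x y s.
Proof.
rewrite /loop_sum (dyadic_sumB _ _ _ (H^~ y) (K^~ y)).
rewrite (dyadic_sumB _ _ _ (H^~ (y + s)) (K^~ (y + s))).
rewrite (dyadic_sumB _ _ _ (H (x + s)) (K (x + s))) (dyadic_sumB _ _ _ (H x) (K x)).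
ring.
Qed.

Lemma loop_sum_bound H n x y s (m : R) : 0 <= s ->
  (forall x' y', x <= x' <= x + s -> y <= y' <= y + s -> cmod (H x' y') <= m) ->
  cmod (loop_sum H n x y s) <= s * (2 * m * (cmod u + cmod v)).
Proof.
move=> s0 h; rewrite /loop_sum cmodM cmodC_ge0; last first.
  by rewrite divr_ge0 // exprn_ge0.
have p0 : 0 < (2 ^+ n : R) by rewrite exprn_gt0.
rewrite -[s / _ * _]mulrA ler_wpM2l // mulrC ler_pdivrMr //.
apply: le_trans (cmodD _ _) _; rewrite !cmodM.
have aux a b c : cmod a <= 2 ^+ n * m -> cmod b <= 2 ^+ n * m ->
    cmod c * cmod (a - b) <= cmod c * (2 * (2 ^+ n * m)).
  move=> h1 h2; rewrite ler_wpM2l ?cmod_ge0 //.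
  by apply: le_trans (cmodBD _ _) _; lra.
have -> : 2 * m * (cmod u + cmod v) * 2 ^+ n =
  cmod u * (2 * (2 ^+ n * m)) + cmod v * (2 * (2 ^+ n * m)) by ring.
by apply: lerD; apply: aux; apply: dyadic_sum_le => // t ht; apply: h; rewrite // lexx ?lerDl ?s0.
Qed.

(** Complex differentiability of [H] as a function of [x u + y v], written in the real
    coordinates. *)
Definition pdiff H x y := exists b : C, forall e : R, 0 < e -> exists2 d : R, 0 < d &
  forall x' y', `|x' - x| <= d -> `|y' - y| <= d ->
  cmod (H x' y' - H x y - b * ((x' - x)%:C * u + (y' - y)%:C * v))
    <= e * (`|x' - x| + `|y' - y|).

Lemma loop_sum_local H x y (c : R) : pdiff H x y -> 0 < c ->
  exists2 d : R, 0 < d & forall x' y' s n, 0 <= s <= d ->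
    x' <= x <= x' + s -> y' <= y <= y' + s ->
    cmod (loop_sum H n x' y' s) <= c * s ^+ 2.
Proof.
move=> [b hb] c0; set w := cmod u + cmod v.
have w0 : 0 <= w by rewrite addr_ge0 ?cmod_ge0.
(* On a square of side [s] containing the point, [H] differs from its affine part by at most [2 s]
   times this constant; [loop_sum_bound] multiplies by [2 s w], and [4 w / (4 (w + 1)) <= 1]. *)
have e0 : 0 < c / (4 * (w + 1)) by rewrite divr_gt0 //; lra.
have [d d0 hd] := hb _ e0; exists d => // x' y' s n /andP[s0 sd] hx hy.
pose K x1 y1 : C := (H x y - b * (x%:C * u + y%:C * v)) + b * (x1%:C * u + y1%:C * v).
have -> : loop_sum H n x' y' s = loop_sum (fun a b => H a b - K a b) n x' y' s.
  by rewrite loop_sumB loop_sum_affine subr0.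
have := @loop_sum_bound (fun a b => H a b - K a b) n x' y' s
  (c / (4 * (w + 1)) * (2 * s)) s0.
move=> /(_ _)/le_trans; apply.
  move=> x1 y1 h1 h2.
  have n1 : `|x1 - x| <= s by rewrite ler_norml; lra.
  have n2 : `|y1 - y| <= s by rewrite ler_norml; lra.
  have -> : H x1 y1 - K x1 y1 =
     H x1 y1 - H x y - b * ((x1 - x)%:C * u + (y1 - y)%:C * v).
    by rewrite /K !real_complexB; ring.
  apply: le_trans (hd _ _ (le_trans n1 sd) (le_trans n2 sd)) _.
  by rewrite ler_wpM2l ?(ltW e0) //; lra.
rewrite -/w.
have -> : s * (2 * (c / (4 * (w + 1)) * (2 * s)) * w) = c * s ^+ 2 * (w / (w + 1)).
  by field; lra.
rewrite ler_piMr ?mulr_ge0 ?exprn_ge0 ?(ltW c0) // ler_pdivrMr; lra.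
Qed.

Lemma bisection_limit (a s : nat -> R) :
  (forall k, a k <= a k.+1) -> (forall k, a k.+1 + s k.+1 <= a k + s k) ->
  (forall k, 0 <= s k) -> exists t, forall k, a k <= t <= a k + s k.
Proof.
move=> ha hb hs; have amono k j : a k <= a (k + j)%N.
  by elim: j => [|j IH]; rewrite ?addn0 // addnS (le_trans IH).
have bmono k j : a (k + j)%N + s (k + j)%N <= a k + s k.
  by elim: j => [|j IH]; rewrite ?addn0 // addnS (le_trans (hb _)).
have ab k j : a k <= a j + s j.
  have [kj|/ltnW jk] := leqP k j.
    rewrite -(subnKC kj); apply: le_trans (amono k (j - k)%N) _.
    by rewrite lerDl hs.
  rewrite -(subnKC jk); apply: le_trans (bmono j (k - j)%N).
  by rewrite lerDl hs.
have hsup : has_sup (range a).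
  split; first by exists (a 0%N); exists 0%N.
  by exists (a 0%N + s 0%N) => _ [j _ <-].
exists (sup (range a)) => k; apply/andP; split.
  by apply: (ub_le_sup hsup.2); exists k.
by apply: ge_sup => [|_ [j _ <-]]; [exists (a 0%N); exists 0%N|exact: ab].
Qed.

(** Largeness at arbitrarily fine levels, the negation of being eventually small. It survives the
    loss of a level in each bisection, and it passes to one of the quarters because four eventual
    bounds hold together from some level on. *)
Definition big_loop H (c : R) (p : R * R * R) := forall N, exists2 n, (N <= n)%N &
  c * p.2 ^+ 2 < cmod (loop_sum H n p.1.1 p.1.2 p.2).

Definition quarter (p q : R * R * R) := [/\ q.2 = p.2 / 2,
  q.1.1 = p.1.1 \/ q.1.1 = p.1.1 + p.2 / 2 & q.1.2 = p.1.2 \/ q.1.2 = p.1.2 + p.2 / 2].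

Lemma big_loop_quarter H c p : big_loop H c p ->
  exists2 q, quarter p q & big_loop H c q.
Proof.
case: p => [[x y] s] hb; apply: contrapT => hn.
have small q : quarter (x, y, s) q -> exists N, forall n, (N <= n)%N ->
    cmod (loop_sum H n q.1.1 q.1.2 q.2) <= c * (s / 2) ^+ 2.
  move=> hq; have : ~ big_loop H c q by move=> h; apply: hn; exists q.
  move=> /existsNP[N hN]; exists N => n Nn; rewrite leNgt; apply/negP => h.
  apply: hN; exists n; first exact: Nn.
  by case: hq h => ->.
have [N1 h1] := small (x, y, s / 2) (And3 erefl (or_introl erefl) (or_introl erefl)).
have [N2 h2] := small (x + s / 2, y, s / 2) (And3 erefl (or_intror erefl) (or_introl erefl)).
have [N3 h3] := small (x, y + s / 2, s / 2) (And3 erefl (or_introl erefl) (or_intror erefl)).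
have [N4 h4] := small (x + s / 2, y + s / 2, s / 2)
  (And3 erefl (or_intror erefl) (or_intror erefl)).
have [[|n]] := hb (maxn (maxn N1 N2) (maxn N3 N4)).+1 => //.
rewrite ltnS !geq_max => /andP[/andP[/h1 n1 /h2 n2] /andP[/h3 n3 /h4 n4]] /=.
rewrite loop_sum_split /= in n1 n2 n3 n4 *.
have := cmodD (loop_sum H n x y (s / 2) + loop_sum H n (x + s / 2) y (s / 2) +
  loop_sum H n x (y + s / 2) (s / 2)) (loop_sum H n (x + s / 2) (y + s / 2) (s / 2)).
have := cmodD (loop_sum H n x y (s / 2) + loop_sum H n (x + s / 2) y (s / 2))
  (loop_sum H n x (y + s / 2) (s / 2)).
have := cmodD (loop_sum H n x y (s / 2)) (loop_sum H n (x + s / 2) y (s / 2)).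
have : c * s ^+ 2 = 4 * (c * (s / 2) ^+ 2) by field.
lra.
Qed.

(** Otherwise loops larger than [c] times the square of the side persist through nested quarters,
    against the local estimate at their common point. *)
Lemma goursat H x y s : 0 < s ->
  (forall x' y', x <= x' <= x + s -> y <= y' <= y + s -> pdiff H x' y') ->
  cv (fun n => loop_sum H n x y s) 0.
Proof.
move=> s0 hd; apply: contrapT => /existsNP[e /not_implyP[e0 he]].
pose c := e / 2 / s ^+ 2.
have s20 : 0 < s ^+ 2 by rewrite exprn_gt0.
have c0 : 0 < c by rewrite /c !divr_gt0.
have big0 : big_loop H c (x, y, s).
  move=> N; apply: contrapT => hn; apply: he; exists N => n Nn.
  rewrite subr0 ltNge; apply/negP => h; apply: hn; exists n => //=.
  by rewrite /c divfK ?gt_eqF //; lra.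
pose next p := xget p [set q | quarter p q /\ big_loop H c q].
have nextP p : big_loop H c p -> quarter p (next p) /\ big_loop H c (next p).
  move=> /big_loop_quarter[q q1 q2]; rewrite /next.
  by case: xgetP => [r -> //|/(_ q)]; case.
pose P k := iter k next (x, y, s).
have Pbig k : big_loop H c (P k) by elim: k => //= k /nextP[].
have Pq k : quarter (P k) (P k.+1) by case: (nextP _ (Pbig k)).
have Ps k : (P k).2 = s / 2 ^+ k.
  elim: k => [|k IH]; first by rewrite expr0 divr1.
  by case: (Pq k) => -> _ _; rewrite IH exprS; field; rewrite expf_eq0 pnatr_eq0 andbF.
have sk0 k : 0 <= (P k).2 by rewrite Ps divr_ge0 ?(ltW s0) // exprn_ge0.
have [xs hx] : exists t, forall k, (P k).1.1 <= t <= (P k).1.1 + (P k).2.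
  apply: bisection_limit => // k; have := sk0 k;
  by case: (Pq k) => e1 [] e2 _; rewrite ?e1 e2; lra.
have [ys hy] : exists t, forall k, (P k).1.2 <= t <= (P k).1.2 + (P k).2.
  apply: bisection_limit => // k; have := sk0 k;
  by case: (Pq k) => e1 _ [] e2; rewrite ?e1 e2; lra.
have [d d0 hloc] := loop_sum_local (hd _ _ (hx 0%N) (hy 0%N)) c0.
have [k /(_ k (leqnn k)) hk] := @geo_small_mul R s (1 / 2) d
  ltac:(lra) (ltW s0) d0.
have [n _] := Pbig k 0%N; rewrite ltNge => /negP; apply; apply: hloc => //.
rewrite sk0 /= Ps; apply: le_trans (ltW hk).
by rewrite expr_div_n expr1n mul1r.
Qed.

(* The value at one corner is exceptional: the loop around it has vanishing
   length, the other quarters are regular. *)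
Lemma goursat_corner H (K : R) (b : bool) x y s : 0 < s ->
  (forall x' y', x <= x' <= x + s -> y <= y' <= y + s ->
     x' = x /\ y' = y + b%:R * s \/ pdiff H x' y') ->
  (forall x' y', x <= x' <= x + s -> y <= y' <= y + s -> cmod (H x' y') <= K) ->
  cv (fun n => loop_sum H n x y s) 0.
Proof.
move=> s0 hd hK; pose M := 2 * K * (cmod u + cmod v).
(* After [k] bisections only the quarter at the exceptional corner is left: its loop is at most its
   side [s / 2 ^ k] times [M], and the regular squares met on the way share [e]. *)
suff main k : forall x y s e, 0 < s -> 0 < e ->
  (forall x' y', x <= x' <= x + s -> y <= y' <= y + s ->
     x' = x /\ y' = y + b%:R * s \/ pdiff H x' y') ->
  (forall x' y', x <= x' <= x + s -> y <= y' <= y + s -> cmod (H x' y') <= K) ->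
  exists N, forall n, (N <= n)%N -> cmod (loop_sum H n x y s) <= s / 2 ^+ k * M + e.
  move=> e e0; have e2 : 0 < e / 3 by lra.
  have M0 : 0 <= M.
    rewrite !mulr_ge0 ?addr_ge0 ?cmod_ge0 //.
    by apply: le_trans (hK x y _ _); rewrite ?cmod_ge0 // lexx; lra.
  have [k /(_ k (leqnn k))] := @geo_small_mul R (s * M) (1 / 2) _ ltac:(lra)
     (mulr_ge0 (ltW s0) M0) e2.
  rewrite expr_div_n expr1n mul1r mulrAC => hk.
  have [N hN] := main k x y s _ s0 e2 hd hK; exists N => n /hN.
  by rewrite subr0; lra.
elim: k => [|k IH] {hd hK}x {}y {s0}s e s0 e0 hd hK.
  exists 0%N => n _; rewrite expr0 divr1; apply: le_trans (loop_sum_bound _ _ hK) _.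
    exact: ltW.
  by rewrite -/M; lra.
have e4 : 0 < e / 4 by lra.
have s2 : 0 < s / 2 by lra.
(* [y1] is the lower end of the left quarter that contains the exceptional corner, [y2] that of the
   other left quarter. *)
pose y1 := if b then y + s / 2 else y.
pose y2 := if b then y else y + s / 2.
have [N1 h1] : exists N, forall n, (N <= n)%N ->
    cmod (loop_sum H n x y1 (s / 2)) <= s / 2 / 2 ^+ k * M + e / 4.
  apply: IH => // x' y' hx hy;
    (have hx1 : x <= x' <= x + s by lra);
    (have hy1 : y <= y' <= y + s by move: hy; rewrite /y1; case: (b); lra).
    have [[e1 e2]|] := hd x' y' hx1 hy1; last by right.
    by left; split=> //; rewrite e2 /y1; case: (b) => /=; field.
  exact: hK.
have reg a c : (a = x + s / 2 /\ (c = y \/ c = y + s / 2)) \/ (a = x /\ c = y2) ->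
    exists N, forall n, (N <= n)%N -> cmod (loop_sum H n a c (s / 2)) <= e / 4.
  move=> hac; have : cv (fun n => loop_sum H n a c (s / 2)) 0.
    apply: goursat => // x' y' hx hy.
    have hx' : x <= x' <= x + s by case: hac => [[e1 _]|[e1 _]]; subst; lra.
    have hy' : y <= y' <= y + s.
      case: hac => [[_ [e1|e1]]|[_ e1]]; subst; rewrite ?/y2 in hy *; try lra.
      by case: (b) hy; lra.
    have [[e1 e2]|//] := hd x' y' hx' hy'; exfalso.
    case: hac => [[e3 _]|[e3 e4']]; first by subst; lra.
    by subst; rewrite /y2 in hy; case: (b) hy => /=; lra.
  by move=> /(_ _ e4)[N hN]; exists N => n /hN; rewrite subr0 => /ltW.
have [N2 h2] := reg x y2 (or_intror (conj erefl erefl)).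
have [N3 h3] := reg (x + s / 2) y (or_introl (conj erefl (or_introl erefl))).
have [N4 h4] := reg (x + s / 2) (y + s / 2) (or_introl (conj erefl (or_intror erefl))).
exists (maxn (maxn N1 N2) (maxn N3 N4)).+1 => -[//|n].
rewrite ltnS !geq_max => /andP[/andP[/h1 n1 /h2 n2] /andP[/h3 n3 /h4 n4]] /=.
have -> : loop_sum H n.+1 x y s = loop_sum H n x y1 (s / 2) + loop_sum H n x y2 (s / 2)
   + loop_sum H n (x + s / 2) y (s / 2) + loop_sum H n (x + s / 2) (y + s / 2) (s / 2).
  by rewrite loop_sum_split /y1 /y2; case: (b); ring.
have -> : s / 2 ^+ k.+1 * M = s / 2 / 2 ^+ k * M.
  by rewrite exprS; field; rewrite expf_eq0 pnatr_eq0 andbF.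
have := cmodD (loop_sum H n x y1 (s / 2) + loop_sum H n x y2 (s / 2) +
  loop_sum H n (x + s / 2) y (s / 2)) (loop_sum H n (x + s / 2) (y + s / 2) (s / 2)).
have := cmodD (loop_sum H n x y1 (s / 2) + loop_sum H n x y2 (s / 2))
  (loop_sum H n (x + s / 2) y (s / 2)).
have := cmodD (loop_sum H n x y1 (s / 2)) (loop_sum H n x y2 (s / 2)).
lra.
Qed.

(** In logarithmic coordinates a full turn of a circle sends both ends of the left side to the same
    point, so one exceptional point of the plane occurs at two corners. One bisection puts each of
    them in a quarter of its own. *)
Lemma goursat_two_corners H (K : R) x y s : 0 < s ->
  (forall x' y', x <= x' <= x + s -> y <= y' <= y + s ->
     x' = x /\ (y' = y \/ y' = y + s) \/ pdiff H x' y') ->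
  (forall x' y', x <= x' <= x + s -> y <= y' <= y + s -> cmod (H x' y') <= K) ->
  cv (fun n => loop_sum H n x y s) 0.
Proof.
move=> s0 hd hK; have s2 : 0 < s / 2 by lra.
have h1 : cv (fun n => loop_sum H n x y (s / 2)) 0.
  apply: (@goursat_corner H K false) => // x' y' hx hy; last by apply: hK; lra.
  have [[-> [->|h]]|] := hd x' y' ltac:(lra) ltac:(lra); last by right.
    by left; split => //=; lra.
  by lra.
have h2 : cv (fun n => loop_sum H n x (y + s / 2) (s / 2)) 0.
  apply: (@goursat_corner H K true) => // x' y' hx hy; last by apply: hK; lra.
  have [[-> [h|->]]|] := hd x' y' ltac:(lra) ltac:(lra); last by right.
    by lra.
  by left; split => //=; lra.
have h3 : cv (fun n => loop_sum H n (x + s / 2) y (s / 2)) 0.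
  apply: goursat => // x' y' hx hy.
  by have [[h _]|//] := hd x' y' ltac:(lra) ltac:(lra); lra.
have h4 : cv (fun n => loop_sum H n (x + s / 2) (y + s / 2) (s / 2)) 0.
  apply: goursat => // x' y' hx hy.
  by have [[h _]|//] := hd x' y' ltac:(lra) ltac:(lra); lra.
have := cvD (cvD (cvD h1 h3) h2) h4; rewrite !addr0 => h.
move=> e /h[N hN]; exists N.+1 => -[//|n]; rewrite ltnS => /hN.
by rewrite loop_sum_split.
Qed.

End Goursat.

(** * The complex exponential *)

Section ComplexExp.
Variable R : realType.
Notation C := R[i].
Implicit Types (x y z w : C).

Lemma is_derive_approx (f : R -> R) (x l : R) : is_derive x (1 : R) f l ->
  forall e : R, 0 < e -> exists2 d : R, 0 < d &
    forall h, `|h| <= d -> `|f (x + h) - f x - l * h| <= e * `|h|.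
Proof.
move=> hf e e0; have := @ex_derive _ _ _ _ _ _ _ hf.
move=> /cvgrPdist_lt /(_ e e0); rewrite -/(derive f x 1) derive_val.
move=> [d /= d0 hd]; exists (d / 2); first by rewrite divr_gt0.
move=> h hh; have [->|h0] := eqVneq h 0.
  by rewrite addr0 subrr mulr0 subr0 normr0 mulr0.
have := hd h; rewrite /= sub0r normrN => /(_ _ h0)/ltW.
have hd' : `|h| < d by have := normr_ge0 h; lra.
move=> /(_ hd'); rewrite [h *: _]mulr1 [h + x]addrC => H.
have -> : f (x + h) - f x - l * h = - ((l - h^-1 *: (f (x + h) - f x)) * h).
  rewrite /GRing.scale /=; field; exact: h0.
by rewrite normrN normrM ler_wpM2r.
Qed.

Definition cexp (w : C) : C :=
  (expR (complex.Re w))%:C * (cos (complex.Im w) +i* sin (complex.Im w)).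

Lemma cexpD x y : cexp (x + y) = cexp x * cexp y.
Proof.
case: x y => a b [c d]; rewrite /cexp /= expRD cosD sinD.
by apply/eqP; rewrite eq_complex /=; apply/andP; split; apply/eqP; ring.
Qed.

Lemma cmod_cis (t : R) : cmod (cos t +i* sin t : C) = 1.
Proof. by rewrite /cmod /= cos2Dsin2 sqrtr1. Qed.

Lemma cmod_cexp w : cmod (cexp w) = expR (complex.Re w).
Proof. by rewrite /cexp cmodM cmod_cis mulr1 cmodC_ge0 // expR_ge0. Qed.

Lemma cexp_neq0 w : cexp w != 0.
Proof. by rewrite -cmod_gt0 cmod_cexp expR_gt0. Qed.

Lemma cexp0 : cexp 0 = 1.
Proof. by rewrite /cexp /= expR0 cos0 sin0 mul1r. Qed.

Definition two_pi_i : C := 0 +i* (2 * pi).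

Lemma cexp_two_pi_i : cexp two_pi_i = 1.
Proof. by rewrite /cexp /= expR0 mul1r mulr_natl cos2pi sin2pi. Qed.

Lemma hasd_cexp0 : hasd cexp 0 1.
Proof.
move=> e e0; have e3 : 0 < Num.min 1 (e / 6) by rewrite lt_min ltr01 /=; lra.
have [d1 d10 h1] := is_derive_approx (is_derive_expR 0) e3.
have [d2 d20 h2] := is_derive_approx (is_derive_cos 0) e3.
have [d3 d30 h3] := is_derive_approx (is_derive_sin 0) e3.
exists (Num.min (Num.min d1 d2) (Num.min d3 (Num.min 1 (e / 6)))).
  by rewrite !lt_min d10 d20 d30 ltr01 /=; lra.
case=> a b; rewrite !le_min => /and3P[/andP[k1 k2] k3 /andP[k4 k5]].
have na := Re_le_cmod (a +i* b); have nb := Im_le_cmod (a +i* b).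
set m := cmod _ in k1 k2 k3 k4 k5 na nb *; rewrite /= in na nb.
have {}h1 := h1 a (le_trans na k1); have {}h2 := h2 b (le_trans nb k2).
have {}h3 := h3 b (le_trans nb k3).
rewrite !add0r expR0 mul1r in h1; rewrite !add0r cos0 sin0 oppr0 mul0r subr0 in h2.
rewrite !add0r cos0 sin0 mul1r subr0 in h3.
have e31 : Num.min 1 (e / 6) <= 1 by rewrite ge_min lexx.
have e32 : Num.min 1 (e / 6) <= e / 6 by rewrite ge_min lexx orbT.
set e' := Num.min _ _ in e3 h1 h2 h3 e31 e32.
have a0 := normr_ge0 a; have b0 := normr_ge0 b.
(* Separates the errors of the real functions [expR], [cos] and [sin]; what is left is the product
   [a b], quadratic in the increment. *)
have -> : cexp (0 + (a +i* b)) - cexp 0 - 1 * (a +i* b) =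
  (expR a - 1 - a)%:C * (cos b +i* sin b) +
  ((1 + a)%:C * ((cos b - 1) +i* (sin b - b)) + (a * b)%:C * 'i%C).
  rewrite cexp0 add0r /cexp /=.
  by apply/eqP; rewrite eq_complex /=; apply/andP; split; apply/eqP; ring.
apply: le_trans (cmodD _ _) _.
have : cmod ((expR a - 1 - a)%:C * (cos b +i* sin b) : C) <= e / 6 * m.
  rewrite cmodM cmod_cis mulr1 cmodC; apply: le_trans h1 _.
  by apply: ler_pM => //; exact: ltW.
have := cmodD ((1 + a)%:C * ((cos b - 1) +i* (sin b - b))) ((a * b)%:C * 'i%C : C).
have : cmod ((1 + a)%:C * ((cos b - 1) +i* (sin b - b)) : C) <= 2 * (2 * (e / 6 * m)).
  rewrite cmodM cmodC; apply: ler_pM; rewrite ?cmod_ge0 //.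
    by apply: le_trans (ler_normD _ _) _; rewrite normr1; lra.
  apply: le_trans (cmod_le_ReIm _) _ => /=.
  have : e' * `|b| <= e / 6 * m by apply: ler_pM => //; exact: ltW.
  lra.
have : cmod ((a * b)%:C * 'i%C : C) <= e / 6 * m.
  have -> : cmod ((a * b)%:C * 'i%C : C) = `|a| * `|b|.
    rewrite cmodM cmodC normrM [cmod 'i](_ : _ = 1) ?mulr1 //.
    by rewrite /cmod /= expr0n /= add0r expr1n sqrtr1.
  by apply: ler_pM => //; lra.
lra.
Qed.

Lemma hasd_cexp w : hasd cexp w (cexp w).
Proof.
have h := hasdZ (cexp w) (hasd_comp (hasdD (hasd_id w) (hasd_cst (- w) w)) _).
have /h : hasd cexp (id w - w) 1 by rewrite subrr; exact: hasd_cexp0.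
rewrite addr0 !mulr1; apply: hasd_ext => x.
by rewrite -cexpD addrCA subrr addr0.
Qed.

(** Locates the exceptional point of a circle: it is met only at the two ends of a full turn. The
    equation gives [cos (2 pi t) = 1], hence [sin (pi t) = 0] by the double angle formula. *)
Lemma cis_eq1 (t : R) : 0 <= t <= 1 -> cexp (t%:C * two_pi_i) = 1 -> t = 0 \/ t = 1.
Proof.
move=> ht /(congr1 (@complex.Re R)); rewrite /cexp /two_pi_i /= mulr0 !mul0r !subr0.
rewrite addr0 expR0 mul1r => hc.
have : sin (pi * t) ^+ 2 = 0.
  have := cos2Dsin2 (pi * t); have := cosD (pi * t) (pi * t).
  have -> : pi * t + pi * t = t * (2 * pi) by ring.
  rewrite hc; lra.
move=> /eqP; rewrite sqrf_eq0 => /eqP hs.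
have [t0|t0] := eqVneq t 0; first by left.
have [t1|t1] := eqVneq t 1; first by right.
have : 0 < sin (pi * t).
  apply: sin_gt0_pi; rewrite mulr_gt0 ?pi_gt0 //=; last lra.
  by rewrite gtr_pMr ?pi_gt0 //; lra.
by rewrite hs ltxx.
Qed.

Lemma arg_exists z : z != 0 -> exists2 t : R, - pi < t <= pi & is_arg z t.
Proof.
rewrite -cmod_gt0 /is_arg; move: (cmod z) (cmod_sqr z) => m.
case: z => a b /= hm m0.
have m0' : m != 0 by lra.
have h1 : -1 <= a / m <= 1.
  have hb := sqr_ge0 b.
  rewrite ler_pdivlMr // ler_pdivrMr //; nra.
have hin : a / m \in `[-1, 1] by rewrite in_itv.
have hs : m * sin (acos (a / m)) = `|b|.
  rewrite sin_acos //; have -> : 1 - (a / m) ^+ 2 = (b / m) ^+ 2.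
    have hb : b ^+ 2 = m ^+ 2 - a ^+ 2 by lra.
    by rewrite [in RHS]expr_div_n hb; field; exact: m0'.
  by rewrite sqrtr_sqr normrM normfV (ger0_norm (ltW m0)) mulrC divfK.
have t1 := acos_ge0 h1; have t2 := acos_lepi h1; have p0 := pi_gt0 R.
have [b0|b0] := leP 0 b.
  exists (acos (a / m)); first by lra.
  rewrite acosK // hs ger0_norm //.
  by rewrite [m * _]mulrC divfK.
exists (- acos (a / m)); last first.
  rewrite cosN sinN mulrN acosK // hs ltr0_norm // opprK.
  by rewrite [m * _]mulrC divfK.
rewrite ltrN2; apply/andP; split; last lra.
apply: acos_ltpi; case/andP: h1 => h1 ->; rewrite andbT lt_def h1 andbT.
apply/eqP => h3.
have : a = - m by have := divfK m0' a; rewrite h3; lra.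
nra.
Qed.

Lemma cexp_surj z : z != 0 -> exists w, z = cexp w.
Proof.
move=> z0; have [t _ ht] := arg_exists z0; exists (ln (cmod z) +i* t).
rewrite {1}ht /cexp /= lnK ?posrE ?cmod_gt0 //.
by apply/eqP; rewrite eq_complex /=; apply/andP; split; apply/eqP; ring.
Qed.

End ComplexExp.

(** * Power series and Cauchy's estimates *)

Section PowerSeries.
Variable R : realType.
Notation C := R[i].
Implicit Types (z : C) (s b r : R) (a : nat -> C) (f g : C -> C).

(* f is the sum of a power series on |z| < s with l1-norm at most b at radius s,
   expressed through an explicit bound on the tails. *)
Definition pser s b a f :=
  (forall L, \sum_(k < L) cmod (a k) * s ^+ k <= b) /\
  (forall z, cmod z < s -> forall L,
     cmod (f z - \sum_(k < L) a k * z ^+ k) <= b * (cmod z / s) ^+ L).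

Lemma pser_b0 s b a f : pser s b a f -> 0 <= b.
Proof. by case=> /(_ 0%N); rewrite big_ord0. Qed.

Lemma pser_coef s b a f k : 0 < s -> pser s b a f -> cmod (a k) * s ^+ k <= b.
Proof.
move=> s0 [h _]; apply: le_trans (h k.+1); rewrite big_ord_recr /= lerDr.
by apply: sumr_ge0 => i _; rewrite mulr_ge0 ?cmod_ge0 // exprn_ge0 // ltW.
Qed.

Lemma pser_val s b a f z : cmod z < s -> pser s b a f -> cmod (f z) <= b.
Proof. by move=> zs [_ /(_ z zs 0%N)]; rewrite big_ord0 subr0 expr0 mulr1. Qed.

(** For [k >= L] the term of order [k] is at most [|a_k| s ^ k (|z| / s) ^ L], so the l1 bound
    controls the tails as well. Proving [pser] thereby reduces to a norm bound and pointwise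
    convergence. *)
Lemma sum_cv_upgrade s b a f : 0 < s ->
  (forall L, \sum_(k < L) cmod (a k) * s ^+ k <= b) ->
  (forall z, cmod z < s -> cv (fun L => \sum_(k < L) a k * z ^+ k) (f z)) ->
  pser s b a f.
Proof.
move=> s0 hn hc; split=> // z zs L; apply: (cv_le (hc z zs)).
have q0 : 0 <= cmod z / s by rewrite divr_ge0 ?cmod_ge0 // ltW.
have q1 : cmod z / s <= 1 by rewrite ler_pdivrMr // mul1r ltW.
exists L => n Ln; rewrite -(subnKC Ln).
rewrite -(big_mkord xpredT (fun k => a k * z ^+ k)).
rewrite (big_cat_nat _ (n := L)) ?leq_addr //= big_mkord [X in X - _]addrC addrK.
apply: le_trans (cmod_sum _ _ _) _.
apply: le_trans (_ : \sum_(L <= k < L + (n - L)) (cmod (a k) * s ^+ k) * (cmod z / s) ^+ L <= _).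
  apply: ler_sum_nat => k /andP[Lk _]; rewrite cmodM cmodX.
  have -> : cmod z ^+ k = s ^+ k * (cmod z / s) ^+ k.
    by rewrite -exprMn mulrC divfK // gt_eqF.
  rewrite mulrA ler_wpM2l ?mulr_ge0 ?cmod_ge0 ?exprn_ge0 // ?(ltW s0) //.
  by apply: ler_wiXn2l => //; rewrite q0.
rewrite -mulr_suml ler_wpM2r ?exprn_ge0 //.
apply: le_trans (hn n).
rewrite -(big_mkord xpredT (fun k => cmod (a k) * s ^+ k)) (subnKC Ln).
rewrite [leRHS](big_cat_nat _ (n := L)) //= lerDr.
by apply: sumr_ge0 => k _; rewrite mulr_ge0 ?cmod_ge0 // exprn_ge0 // ltW.
Qed.

Lemma pser_cv s b a f z : 0 < s -> cmod z < s -> pser s b a f ->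
  cv (fun L => \sum_(k < L) a k * z ^+ k) (f z).
Proof.
move=> s0 zs hp; apply: (@cv_squeeze _ (fun n => b * (cmod z / s) ^+ n)).
  move=> e e0; apply: geo_small_mul => //; last exact: pser_b0 hp.
  by rewrite divr_ge0 ?cmod_ge0 ?(ltW s0) //= ltr_pdivrMr // mul1r.
by exists 0%N => n _; rewrite cmodB; case: hp => _; apply.
Qed.

Lemma pser_cst s (c : C) : 0 < s ->
  pser s (cmod c) (fun k => if k is 0%N then c else 0) (fun=> c).
Proof.
move=> s0; apply: sum_cv_upgrade => // [[|L]|z zs].
- by rewrite big_ord0 cmod_ge0.
- rewrite big_ord_recl /= expr0 mulr1 big1 ?addr0 // => i _.
  by rewrite /bump leq0n add1n cmod0 mul0r.
- move=> e e0; exists 1%N => -[//|n] _.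
  rewrite big_ord_recl /= expr0 mulr1 big1 ?addr0 ?subrr ?cmod0 // => i _.
  by rewrite /bump leq0n add1n mul0r.
Qed.

Lemma pser_mono s b s' b' a f : 0 < s' <= s -> b <= b' -> pser s b a f -> pser s' b' a f.
Proof.
move=> /andP[s0 ss] bb hp; have s0' : 0 < s by lra.
apply: sum_cv_upgrade => // [L|z zs]; last first.
  by apply: pser_cv hp => //; lra.
apply: le_trans bb; apply: le_trans (hp.1 L); apply: ler_sum => k _.
by apply: ler_wpM2l; rewrite ?cmod_ge0 // lerXn2r // nnegrE ltW.
Qed.

Lemma pserD s b b' a a' f g : 0 < s -> pser s b a f -> pser s b' a' g ->
  pser s (b + b') (fun k => a k + a' k) (fun z => f z + g z).
Proof.
move=> s0 hf hg; apply: sum_cv_upgrade => // [L|z zs].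
  apply: le_trans (lerD (hf.1 L) (hg.1 L)); rewrite -big_split /=.
  apply: ler_sum => k _; rewrite -mulrDl ler_wpM2r ?cmodD // exprn_ge0 //.
  exact: ltW.
apply: cv_ext (cvD (pser_cv s0 zs hf) (pser_cv s0 zs hg)) => n.
by rewrite -big_split /=; apply: eq_bigr => k _; rewrite mulrDl.
Qed.

Lemma pserZ s b a f (c : C) : 0 < s -> pser s b a f ->
  pser s (cmod c * b) (fun k => c * a k) (fun z => c * f z).
Proof.
move=> s0 hf; apply: sum_cv_upgrade => // [L|z zs].
  apply: le_trans (ler_wpM2l (cmod_ge0 c) (hf.1 L)); rewrite mulr_sumr.
  by apply: ler_sum => k _; rewrite cmodM mulrA.
apply: cv_ext (cvZ c (pser_cv s0 zs hf)) => n.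
by rewrite mulr_sumr; apply: eq_bigr => k _; rewrite mulrA.
Qed.

Lemma pserB s b b' a a' f g : 0 < s -> pser s b a f -> pser s b' a' g ->
  pser s (b + b') (fun k => a k - a' k) (fun z => f z - g z).
Proof.
move=> s0 hf hg; have := pserD s0 hf (pserZ (-1) s0 hg).
rewrite cmodN cmod1 mul1r; congr pser; apply: funext => x; ring.
Qed.

Lemma pser_ext s b a f g : (forall z, cmod z < s -> f z = g z) ->
  pser s b a f -> pser s b a g.
Proof. by move=> e [h1 h2]; split=> // z zs L; rewrite -e //; exact: h2. Qed.

Definition cauchy_prod a a' k : C := \sum_(i < k.+1) a i * a' (k - i)%N.

Lemma sum_triangle (V : nmodType) (F : nat -> nat -> V) L :
  \sum_(k < L) \sum_(i < k.+1) F i (k - i)%N =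
  \sum_(i < L) \sum_(j < L | (i + j < L)%N) F i j.
Proof.
elim: L => [|L IH]; first by rewrite !big_ord0.
rewrite big_ord_recr /= IH [RHS]big_ord_recr /=.
have -> : \sum_(i < L) \sum_(j < L.+1 | (i + j < L.+1)%N) F i j =
  \sum_(i < L) \sum_(j < L | (i + j < L)%N) F i j + \sum_(i < L) F i (L - i)%N.
  rewrite -big_split /=; apply: eq_bigr => i _.
  have hi : (L - i < L.+1)%N by rewrite ltnS leq_subr.
  rewrite (bigD1 (Ordinal hi)) /=; last by rewrite subnKC // ltnW.
  rewrite addrC; congr (_ + _).
  rewrite big_mkcond [RHS]big_mkcond big_ord_recr /=.
  have -> : (i + L < L.+1)%N && (ord_max != Ordinal hi) = false.
    case: i hi => -[|i] hiL hi /=; last by rewrite ltnS -{2}[L]add0n leq_add2r.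
    by rewrite -val_eqE /= subn0 eqxx andbF.
  rewrite addr0; apply: eq_bigr => j _; congr (if _ then _ else _).
  by rewrite -val_eqE /=; apply/idP/idP; have := ltn_ord i; lia.
rewrite -addrA; congr (_ + _); rewrite big_ord_recr /= subnn; congr (_ + _).
rewrite big_mkcond big_ord_recl /= addn0 ltnSn big1 ?addr0 // => j _.
by rewrite ifF //; apply/negbTE; rewrite /bump leq0n; lia.
Qed.

Lemma sum_square_split (V : nmodType) (F : nat -> nat -> V) L :
  \sum_(i < L) \sum_(j < L) F i j =
  \sum_(i < L) \sum_(j < L | (i + j < L)%N) F i j +
  \sum_(i < L) \sum_(j < L | ~~ (i + j < L)%N) F i j.
Proof.
rewrite -big_split /=; apply: eq_bigr => i _.
by rewrite (bigID (fun j : 'I_L => (i + j < L)%N)).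
Qed.

Lemma pserM s b b' a a' f g : 0 < s -> pser s b a f -> pser s b' a' g ->
  pser s (b * b') (cauchy_prod a a') (fun z => f z * g z).
Proof.
move=> s0 hf hg; have sge := ltW s0.
have b0 := pser_b0 hf; have b0' := pser_b0 hg.
have norm_le L : \sum_(k < L) \sum_(i < k.+1)
    (cmod (a i) * s ^+ i) * (cmod (a' (k - i)%N) * s ^+ (k - i)) <= b * b'.
  rewrite (sum_triangle (fun i j => (cmod (a i) * s ^+ i) * (cmod (a' j) * s ^+ j))).
  apply: le_trans (_ : (\sum_(i < L) cmod (a i) * s ^+ i) *
     (\sum_(j < L) cmod (a' j) * s ^+ j) <= _); last first.
    by apply: ler_pM; rewrite ?hf.1 ?hg.1 //; apply: sumr_ge0 => i _;
       rewrite mulr_ge0 ?cmod_ge0 ?exprn_ge0.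
  rewrite mulr_suml; apply: ler_sum => i _; rewrite mulr_sumr.
  rewrite [leRHS](bigID (fun j : 'I_L => (i + j < L)%N)) /= lerDl.
  by apply: sumr_ge0 => j _; rewrite !mulr_ge0 ?cmod_ge0 ?exprn_ge0.
apply: sum_cv_upgrade => // [L|z zs].
  apply: le_trans (norm_le L); apply: ler_sum => k _.
  apply: le_trans (ler_wpM2r (exprn_ge0 _ sge) (cmod_sum _ _ _)) _.
  rewrite mulr_suml; apply: ler_sum => i _.
  have ik : (i <= k)%N by rewrite -ltnS.
  have -> : s ^+ k = s ^+ i * s ^+ (k - i) by rewrite -exprD subnKC.
  by rewrite cmodM [leLHS]mulrACA.
pose q := cmod z / s.
have q0 : 0 <= q by rewrite divr_ge0 ?cmod_ge0.
have q1 : q < 1 by rewrite ltr_pdivrMr // mul1r.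
have zE : cmod z = s * q by rewrite /q mulrC divfK // gt_eqF.
(* One [b b' q ^ n] for each of three errors: the two tails, and the terms of total degree at least
   [n] by which the product of the partial sums exceeds the partial sum of the Cauchy product. *)
apply: (@cv_squeeze _ (fun n => (3 * b * b') * q ^+ n)).
  by move=> e e0; apply: geo_small_mul => //; rewrite ?q0 // !mulr_ge0.
exists 0%N => L _.
set A := \sum_(k < L) a k * z ^+ k; set B := \sum_(k < L) a' k * z ^+ k.
have hA : cmod (f z - A) <= b * q ^+ L by exact: hf.2.
have hB : cmod (g z - B) <= b' * q ^+ L by exact: hg.2.
have hf' : cmod (f z) <= b by exact: pser_val hf.
have nB : cmod B <= b'.
  apply: le_trans (cmod_sum _ _ _) _; apply: le_trans (hg.1 L).
  apply: ler_sum => k _; rewrite cmodM cmodX ler_wpM2l ?cmod_ge0 //.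
  by rewrite lerXn2r ?nnegrE ?cmod_ge0 // ltW.
clearbody q; set P := \sum_(k < L) _.
have hP : cmod (A * B - P) <= b * b' * q ^+ L.
  have -> : P = \sum_(k < L) \sum_(i < k.+1) (a i * z ^+ i) * (a' (k - i)%N * z ^+ (k - i)).
    apply: eq_bigr => k _; rewrite mulr_suml; apply: eq_bigr => i _.
    have ik : (i <= k)%N by rewrite -ltnS.
    have -> : z ^+ k = z ^+ i * z ^+ (k - i) by rewrite -exprD subnKC.
    by rewrite mulrACA.
  rewrite (sum_triangle (fun i j => (a i * z ^+ i) * (a' j * z ^+ j))).
  have -> : A * B = \sum_(i < L) \sum_(j < L) (a i * z ^+ i) * (a' j * z ^+ j).
    by rewrite mulr_suml; apply: eq_bigr => i _; rewrite mulr_sumr.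
  rewrite (sum_square_split (fun i j => (a i * z ^+ i) * (a' j * z ^+ j))).
  rewrite [X in X - _]addrC addrK.
  apply: le_trans (cmod_sum _ _ _) _.
  apply: le_trans (_ : \sum_(i < L) \sum_(j < L)
     ((cmod (a i) * s ^+ i) * (cmod (a' j) * s ^+ j)) * q ^+ L <= _); last first.
    under eq_bigr do rewrite -mulr_suml -mulr_sumr.
    rewrite -mulr_suml -mulr_suml ler_wpM2r ?exprn_ge0 //.
    by apply: ler_pM; rewrite ?hf.1 ?hg.1 //; apply: sumr_ge0 => i _;
       rewrite mulr_ge0 ?cmod_ge0 ?exprn_ge0.
  apply: ler_sum => i _; apply: le_trans (cmod_sum _ _ _) _.
  rewrite big_mkcond /=; apply: ler_sum => j _.
  have nn : 0 <= cmod (a i) * s ^+ i * (cmod (a' j) * s ^+ j).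
    by rewrite !mulr_ge0 ?cmod_ge0 ?exprn_ge0.
  case: ifP => [|_]; last by rewrite mulr_ge0 // exprn_ge0.
  rewrite -leqNgt => Lij; rewrite !cmodM !cmodX zE !exprMn.
  have -> : cmod (a i) * (s ^+ i * q ^+ i) * (cmod (a' j) * (s ^+ j * q ^+ j)) =
    cmod (a i) * s ^+ i * (cmod (a' j) * s ^+ j) * q ^+ (i + j).
    by rewrite exprD; ring.
  rewrite ler_wpM2l //; by apply: ler_wiXn2l => //; exact: ltW.
have -> : P - f z * g z = - (f z * (g z - B) + (f z - A) * B + (A * B - P)) by ring.
rewrite cmodN; apply: le_trans (cmodD _ _) _.
have := cmodD (f z * (g z - B)) ((f z - A) * B); rewrite !cmodM.
have e1 : cmod (f z) * cmod (g z - B) <= b * (b' * q ^+ L).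
  by apply: ler_pM; rewrite ?cmod_ge0.
have e2 : cmod (f z - A) * cmod B <= b * q ^+ L * b'.
  by apply: ler_pM; rewrite ?cmod_ge0.
lra.
Qed.

Lemma pser_X s : 0 < s -> pser s s (fun k => (k == 1%N)%:R) id.
Proof.
move=> s0; have tail (T : pzSemiRingType) (w : nat -> T) n :
    \sum_(k < n.+2) (k == 1%N :> nat)%:R * w k = w 1%N.
  rewrite 2!big_ord_recl /= mul0r add0r mul1r big1 ?addr0 // => i _.
  by rewrite mul0r.
have nk k : cmod ((k == 1%N)%:R : C) = (k == 1%N)%:R.
  by case: eqP; rewrite ?cmod1 ?cmod0.
apply: sum_cv_upgrade => // [[|[|L]]|z zs].
- by rewrite big_ord0 ltW.
- by rewrite big_ord_recl big_ord0 nk /= mul0r addr0 ltW.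
- by under eq_bigr do rewrite nk; rewrite (tail _ (fun k => s ^+ k)) expr1.
- move=> e e0; exists 2%N => -[//|[//|n]] _.
  by rewrite (tail _ (fun k => z ^+ k)) expr1 subrr cmod0.
Qed.

(** A theorem of Vitali type. Under a common bound, the coefficient of order [k] is determined, up
    to [b h / s ^ (k + 1)], by the value at a small real point [h] and by the lower coefficients;
    pointwise convergence thus makes the coefficients Cauchy sequences, by induction on [k]. *)
Lemma pser_limit s b (a : nat -> nat -> C) (f : nat -> C -> C) g : 0 < s ->
  (forall n, pser s b (a n) (f n)) ->
  (forall z, cmod z < s -> cv (fun n => f n z) (g z)) ->
  exists2 l, (forall k, cv (fun n => a n k) (l k)) & pser s b l g.
Proof.
move=> s0 hp hc; have b0 := pser_b0 (hp 0%N).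
have ex k : exists l, cv (fun n => a n k) l.
  elim/ltn_ind: k => k IH; apply: cv_cauchy => e e0.
  have sk0 : 0 < s ^+ k.+1 by rewrite exprn_gt0.
  (* Chosen so that the tail [b (h / s) ^ (k + 1)] is at most [e / 8] times [h ^ k]. *)
  pose h := Num.min (s / 2) (e * s ^+ k.+1 / (8 * (b + 1))).
  have h0 : 0 < h by rewrite lt_min divr_gt0 //= divr_gt0 ?mulr_gt0 //; lra.
  have hs : h < s by apply: le_lt_trans (_ : s / 2 < _); [rewrite ge_min lexx|lra].
  have hh : h <= e * s ^+ k.+1 / (8 * (b + 1)) by rewrite ge_min lexx orbT.
  have nh : cmod (h%:C : C) = h by rewrite cmodC_ge0 // ltW.
  have hk0 : 0 < h ^+ k by rewrite exprn_gt0.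
  pose X n := f n h%:C - \sum_(i < k) a n i * h%:C ^+ i.
  have [l hl] : exists l, cv X l.
    have [l hl] : exists l : nat -> C, forall i, (i < k)%N -> cv (fun n => a n i) (l i).
      have /choice[l hl] : forall i, exists l, (i < k)%N -> cv (fun n => a n i) l.
        by move=> i; have [/IH[l hl]|_] := ltnP i k; [exists l|exists 0].
      by exists l.
    exists (g h%:C - \sum_(i < k) l i * h%:C ^+ i); apply: cvB.
      by apply: hc; rewrite nh.
    apply: (cv_sum (u := fun n i => a n i * h%:C ^+ i) (l := fun i => l i * h%:C ^+ i)).
    move=> i ik; rewrite mulrC; under eq_fun do rewrite mulrC.
    by apply: cvZ; exact: hl.
  have e2 : 0 < e / 2 * h ^+ k by rewrite mulr_gt0 //; lra.
  have [N hN] := cv_cauchyE hl e2; exists N => n m Nn Nm.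
  have {hN} := hN n m Nn Nm => hX.
  have hX' j : cmod (a j k * h%:C ^+ k - X j) <= b * (h / s) ^+ k.+1.
    have := (hp j).2 h%:C; rewrite nh => /(_ hs k.+1).
    rewrite big_ord_recr /= cmodB; congr (_ <= _); congr cmod; rewrite /X; ring.
  have := cmod_tri (X n) (a n k * h%:C ^+ k) (a m k * h%:C ^+ k).
  have := cmod_tri (X m) (X n) (a m k * h%:C ^+ k).
  rewrite (cmodB (X m)); have := hX' n; have := hX' m.
  rewrite -mulrBl cmodM cmodX nh.
  have : b * (h / s) ^+ k.+1 <= e / 8 * h ^+ k.
    rewrite expr_div_n exprSr mulrA ler_pdivrMr //.
    have : h * (8 * (b + 1)) <= e * s ^+ k.+1.
      by rewrite -ler_pdivlMr //; lra.
    set S := s ^+ k.+1; nra.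
  rewrite -(ltr_pM2r hk0); lra.
have [l hl] := choice ex; exists l => //.
split=> [L|z zs L].
  (* Phases of modulus 1 (or 0 if [l k] vanishes) that make the sum of the [|l k| s ^ k] the limit
     of a linear expression in the [a n k], to which the bound on each [a n] applies. *)
  pose c k : C := if l k == 0 then 0 else (cmod (l k))%:C / l k.
  have cn k : cmod (c k) <= 1.
    rewrite /c; case: eqP => [_|/eqP lk]; first by rewrite cmod0.
    by rewrite cmodM cmodV cmodC_ge0 ?cmod_ge0 // divff // cmod_eq0.
  have cl k : c k * l k = (cmod (l k))%:C.
    rewrite /c; case: eqP => [->|/eqP lk]; first by rewrite cmod0 mul0r.
    by rewrite divfK.
  have hcv : cv (fun n => \sum_(k < L) c k * s%:C ^+ k * a n k)
                (\sum_(k < L) c k * s%:C ^+ k * l k).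
    apply: (cv_sum (u := fun n k => c k * s%:C ^+ k * a n k)
       (l := fun k => c k * s%:C ^+ k * l k)) => k _.
    by apply: cvZ; exact: hl.
  have : cmod (\sum_(k < L) c k * s%:C ^+ k * l k) <= b.
    apply: (cv_le0 hcv); exists 0%N => n _; apply: le_trans (cmod_sum _ _ _) _.
    apply: le_trans ((hp n).1 L); apply: ler_sum => k _.
    rewrite !cmodM cmodX (cmodC_ge0 (ltW s0)).
    rewrite -mulrA [s ^+ k * _]mulrC ler_piMl ?cn //.
    by rewrite mulr_ge0 ?cmod_ge0 ?exprn_ge0 // ltW.
  have -> : \sum_(k < L) c k * s%:C ^+ k * l k =
     (\sum_(k < L) cmod (l k) * s ^+ k)%:C.
    rewrite rmorph_sum; apply: eq_bigr => k _.
    by rewrite mulrAC cl rmorphM rmorphXn.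
  by rewrite cmodC; apply: le_trans; exact: ler_norm.
apply: (@cv_le0 _ (fun n => f n z - \sum_(k < L) a n k * z ^+ k)).
  apply: cvB; first exact: hc.
  apply: (cv_sum (u := fun n k => a n k * z ^+ k) (l := fun k => l k * z ^+ k)) => k _.
  by rewrite mulrC; under eq_fun do rewrite mulrC; apply: cvZ; exact: hl.
by exists 0%N => n _; exact: (hp n).2.
Qed.

(** Evaluation at positive reals [h] tending to 0: once the lower coefficients vanish, division by
    [h ^ k] isolates [|a_k|] up to an error of order [h]. This is how two series are shown to agree
    up to a given order. *)
Lemma pser_order s s0 b c a f m : 0 < s0 <= s -> pser s b a f ->
  (forall z, cmod z < s0 -> cmod (f z) <= c * cmod z ^+ m) ->
  (forall k, (k < m)%N -> a k = 0) /\ cmod (a m) <= c.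
Proof.
move=> /andP[s00 ss] hp hf; have s1 : 0 < s by lra.
have b0 := pser_b0 hp.
have main k : (k <= m)%N -> (forall i, (i < k)%N -> a i = 0) ->
    forall e, 0 < e -> exists2 d : R, 0 < d & forall h, 0 < h < d ->
      cmod (a k) <= c * h ^+ (m - k) + e.
  move=> km hi e e0; have sk0 : 0 < s ^+ k.+1 by rewrite exprn_gt0.
  exists (Num.min s0 (e * s ^+ k.+1 / (b + 1))).
    by rewrite lt_min s00 /= divr_gt0 ?mulr_gt0 //; lra.
  move=> h; rewrite lt_min => /and3P[h0 hs0 he].
  have nh : cmod (h%:C : C) = h by rewrite cmodC_ge0 // ltW.
  have hk0 : 0 < h ^+ k by rewrite exprn_gt0.
  have := hp.2 h%:C; rewrite nh => /(_ ltac:(lra) k.+1).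
  rewrite big_ord_recr /= big1 ?add0r => [H|i _]; last by rewrite hi // mul0r.
  have := hf h%:C; rewrite nh => /(_ hs0) H1.
  have := cmod_lb (a k * h%:C ^+ k) (f h%:C); rewrite cmodB cmodM cmodX nh => H2.
  have H3 : b * (h / s) ^+ k.+1 <= e * h ^+ k.
    rewrite expr_div_n exprSr mulrA ler_pdivrMr //.
    move: he; rewrite ltr_pdivlMr; last lra.
    by set S := s ^+ k.+1 in sk0 *; nra.
  have H4 : h ^+ m = h ^+ (m - k) * h ^+ k by rewrite -exprD subnK.
  rewrite -(ler_pM2r hk0) mulrDl -mulrA -H4; lra.
have z k : (k < m)%N -> a k = 0.
  elim/ltn_ind: k => k IH km; apply/cmod0_eq0/eqP; rewrite eq_le cmod_ge0 andbT.
  rewrite leNgt; apply/negP => hk.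
  have c0 : 0 <= c \/ c < 0 by have [|] := leP 0 c; [left|right].
  have [d d0 hd] := main k (ltnW km) (fun i ik => IH i ik (ltn_trans ik km)) _
     (divr_gt0 hk (ltr0n _ 2)).
  pose h := Num.min (d / 2) (Num.min 1 (cmod (a k) / (4 * (`|c| + 1)))).
  have cc := normr_ge0 c; have ccle := ler_norm c.
  have h0 : 0 < h by rewrite !lt_min ltr01 !divr_gt0 //; lra.
  have hd' : h < d by apply: le_lt_trans (_ : d / 2 < d); [rewrite ge_min lexx|lra].
  have h1 : h <= 1 by rewrite !ge_min lexx orbT.
  have h2 : h * (4 * (`|c| + 1)) <= cmod (a k).
    by rewrite -ler_pdivlMr ?ge_min ?lexx ?orbT //; rewrite ?ge_min ?lexx ?orbT //; lra.
  have := hd h ltac:(rewrite h0; done).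
  have : h ^+ (m - k) <= h.
    rewrite -{2}[h]expr1; apply: ler_wiXn2l; rewrite ?subn_gt0 //.
    by rewrite ltW.
  have : 0 <= h ^+ (m - k) by rewrite exprn_ge0 // ltW.
  by set H := h ^+ _; nra.
split=> //; apply/ler_addgt0Pr => e e0.
have [d d0 /(_ (d / 2) ltac:(lra))] := main m (leqnn m) z e e0.
by rewrite subnn expr0 mulr1.
Qed.

Lemma pser_uniq s s' b b' a a' f g (d : R) : 0 < s -> 0 < s' -> 0 < d ->
  pser s b a f -> pser s' b' a' g -> (forall z, cmod z < d -> f z = g z) -> a = a'.
Proof.
move=> s0 s0' d0 hf hg e; pose t := Num.min s s'.
have t0 : 0 < t by rewrite lt_min s0.
have hf' : pser t b a f by apply: pser_mono hf => //; rewrite t0 ge_min lexx.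
have hg' : pser t b' a' g by apply: pser_mono hg => //; rewrite t0 ge_min lexx orbT.
have hd := pserB t0 hf' hg'.
apply: funext => k; apply/eqP; rewrite -subr_eq0; apply/eqP.
have ht : 0 < Num.min t d <= t by rewrite lt_min t0 d0 /= ge_min lexx.
have hz z : cmod z < Num.min t d -> cmod (f z - g z) <= 0 * cmod z ^+ k.+1.
  by rewrite lt_min => /andP[_ /e ->]; rewrite subrr cmod0 mul0r.
by have [h _] := pser_order ht hd hz; exact: h.
Qed.

End PowerSeries.

(** * Circle means and the Cauchy expansion *)

Section CauchyExpansion.
Variable R : realType.
Notation C := R[i].
Implicit Types (z w u : C) (f g : C -> C).

Definition node n w (j : nat) : C := cexp (w + (j%:R / 2 ^+ n)%:C * two_pi_i R).

(** Riemann sum of [f(z) dz / (2 pi i z)] over the circle of radius [exp (Re w)], started at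
    [cexp w]. The number of nodes is a power of 2 so that these means are sides of a [loop_sum]. *)
Definition cmean n f w : C :=
  ((2 ^+ n)^-1)%:C * \sum_(j < 2 ^ n) f (node n w j).

Lemma cmod_node n w j : cmod (node n w j) = expR (complex.Re w).
Proof.
rewrite /node cmod_cexp; congr expR; case: w => a b.
by rewrite /two_pi_i /=; ring.
Qed.

Lemma pow2_neq0 n : (2 ^+ n : R) != 0.
Proof. by rewrite expf_eq0 pnatr_eq0 andbF. Qed.

Lemma cmean_le n f w (m : R) : (forall j, cmod (f (node n w j)) <= m) -> cmod (cmean n f w) <= m.
Proof.
move=> h; have p0 : 0 < (2 ^+ n : R) by rewrite exprn_gt0.
rewrite /cmean cmodM cmodC_ge0 ?invr_ge0 ?(ltW p0) // mulrC ler_pdivrMr //.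
apply: le_trans (cmod_sum _ _ _) _.
apply: (@le_trans _ _ (\sum_(j < 2 ^ n) m)); first by apply: ler_sum => j _; exact: h.
by rewrite sumr_const card_ord -[m *+ _]mulr_natl natrX mulrC.
Qed.

Lemma cmeanD n f g w : cmean n (fun z => f z + g z) w = cmean n f w + cmean n g w.
Proof. by rewrite /cmean big_split mulrDr. Qed.

Lemma cmeanZ n c f w : cmean n (fun z => c * f z) w = c * cmean n f w.
Proof. by rewrite /cmean -mulr_sumr mulrCA. Qed.

Lemma cmeanB n f g w : cmean n (fun z => f z - g z) w = cmean n f w - cmean n g w.
Proof. by rewrite /cmean sumrB mulrBr. Qed.

Lemma cmean_sum n m (F : nat -> C -> C) w :
  cmean n (fun z => \sum_(k < m) F k z) w = \sum_(k < m) cmean n (F k) w.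
Proof. by rewrite /cmean exchange_big mulr_sumr. Qed.

Lemma cmean_eq n f g w : (forall j, f (node n w j) = g (node n w j)) ->
  cmean n f w = cmean n g w.
Proof. by move=> h; rewrite /cmean; congr (_ * _); apply: eq_bigr. Qed.

Lemma cmean_cst n c w : cmean n (fun=> c) w = c.
Proof.
rewrite /cmean sumr_const card_ord -[c *+ _]mulr_natl mulrA natrX.
have -> : (2 ^+ n : C) = (2 ^+ n : R)%:C by rewrite rmorphXn /= rmorph_nat.
by rewrite -real_complexM mulVf ?pow2_neq0 // mul1r.
Qed.

Definition log_polar f w u (x y : R) : C :=
  f (cexp (w + (x%:C * u + y%:C * two_pi_i R))).

Lemma log_polar_pdiff f w u x y :
  cdiff f (cexp (w + (x%:C * u + y%:C * two_pi_i R))) ->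
  pdiff u (two_pi_i R) (log_polar f w u) x y.
Proof.
set W := w + _ => hf.
have [l hl] := cdiff_comp (hasd_cdiff (hasd_cexp W)) hf.
exists l => e e0; set M := cmod u + cmod (two_pi_i R).
have M0 : 0 <= M by rewrite addr_ge0 ?cmod_ge0.
have e1 : 0 < e / (M + 1) by rewrite divr_gt0 //; lra.
have [d d0 hd] := hl _ e1; exists (d / (2 * (M + 1))).
  by rewrite divr_gt0 //; lra.
move=> x' y'; rewrite !ler_pdivlMr; [|lra..] => hx hy.
set h := (x' - x)%:C * u + _.
have hh : cmod h <= M * (`|x' - x| + `|y' - y|).
  apply: le_trans (cmodD _ _) _; rewrite !cmodM !cmodC /M.
  have := cmod_ge0 u; have := cmod_ge0 (two_pi_i R).
  have := normr_ge0 (x' - x); have := normr_ge0 (y' - y); nra.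
have n1 := normr_ge0 (x' - x); have n2 := normr_ge0 (y' - y).
have := hd h ltac:(nra).
have -> : W + h = w + (x'%:C * u + y'%:C * two_pi_i R).
  by rewrite /W /h !real_complexB; ring.
move=> /le_trans; apply; rewrite mulrAC ler_pdivrMr; last lra.
by rewrite -mulrA ler_wpM2l ?(ltW e0) //; nra.
Qed.

(** The integrand is [f d(log z)]. The two sides in the direction [u] cancel because [cexp] has
    period [two_pi_i]; the other two are circle means. *)
Lemma log_polar_loop f w u n : loop_sum u (two_pi_i R) (log_polar f w u) n 0 0 1 =
  two_pi_i R * (cmean n f (w + u) - cmean n f w).
Proof.
rewrite /loop_sum /dyadic_sum -!sumrB !mulr_sumr -big_split /=.
rewrite /cmean -mulrBr -sumrB !mulr_sumr; apply: eq_bigr => j _.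
rewrite /log_polar /node !add0r !mul1r [0%:C](_ : _ = 0) ?rmorph0 // !mul0r.
rewrite addr0 add0r !addrA [cexp (_ + two_pi_i R)]cexpD cexp_two_pi_i mulr1.
by rewrite subrr mulr0 add0r mulrCA.
Qed.

Lemma two_pi_i_neq0 : two_pi_i R != 0.
Proof.
by rewrite eq_complex /= eqxx /= mulf_neq0 ?pnatr_eq0 // gt_eqF ?pi_gt0.
Qed.

(* Circle means agree in the limit for two radii; the point cexp w on one of
   the circles may be exceptional. *)
Lemma cmean_radius f w u (K : R) : complex.Re u != 0 ->
  (forall (x : R) z, 0 <= x <= 1 -> cmod z = expR (complex.Re w + x * complex.Re u) ->
     z = cexp w \/ cdiff f z) ->
  (forall (x : R) z, 0 <= x <= 1 -> cmod z = expR (complex.Re w + x * complex.Re u) ->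
     cmod (f z) <= K) ->
  cv (fun n => cmean n f (w + u) - cmean n f w) 0.
Proof.
move=> hu hf hK.
have hm x y : cmod (cexp (w + (x%:C * u + y%:C * two_pi_i R))) =
    expR (complex.Re w + x * complex.Re u).
  rewrite cmod_cexp; congr expR; case: (w) (u) => a b [c d].
  by rewrite /two_pi_i /=; ring.
have : cv (fun n => loop_sum u (two_pi_i R) (log_polar f w u) n 0 0 1) 0.
  apply: (@goursat_two_corners _ _ _ _ K) => // x y; rewrite add0r => hx hy; last first.
    exact: (hK x _ hx (hm x y)).
  have [e|] := hf x _ hx (hm x y); last by move=> h; right; exact: log_polar_pdiff.
  left; have := congr1 (@cmod R) e; rewrite hm cmod_cexp => /expR_inj /eqP.
  rewrite -subr_eq0 addrAC subrr add0r mulf_eq0 (negbTE hu) orbF => /eqP x0.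
  split=> //; subst x; move: e; rewrite rmorph0 mul0r add0r cexpD.
  move=> /(congr1 (fun t => (cexp w)^-1 * t)); rewrite mulrA mulVf ?cexp_neq0 // mul1r.
  exact: cis_eq1.
move=> /(cvZ (two_pi_i R)^-1); rewrite mulr0; apply: cv_ext => n.
by rewrite log_polar_loop mulrA mulVf ?two_pi_i_neq0 // mul1r.
Qed.

Section Expansion.
Variables (g : C -> C) (r' r K : R).
Hypotheses (hr : 0 < r < r') (hg : forall z, cmod z < r' -> cdiff g z).
Hypothesis hK : forall z, cmod z < r' -> cmod (g z) <= K.

Let r0 : 0 < r. Proof. by case/andP: hr. Qed.
Let lr : C := (ln r)%:C.

Let Relr : expR (complex.Re lr) = r. Proof. by rewrite /lr /= lnK. Qed.

Lemma cmod_circle n j : cmod (node n lr j) = r.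
Proof. by rewrite cmod_node. Qed.

(** Enlarging the circle does not change the limit of the means, and far out [z / (z - z0)] is close
    to 1. *)
Lemma cmean_kernel z0 : cmod z0 < r ->
  cv (fun n => cmean n (fun z => z / (z - z0)) lr) 1.
Proof.
move=> z0r e e0; have m0 := cmod_ge0 z0.
(* On this circle [|z0 / (z - z0)| <= e / 2], because [rb - |z0| >= 2 |z0| / e]. *)
pose rb := 2 * r + 2 * cmod z0 / e.
have q0 : 0 <= 2 * cmod z0 / e by rewrite divr_ge0 ?mulr_ge0 // ltW.
have rb0 : 0 < rb by rewrite /rb; have := r0; lra.
have rbr : r < rb by rewrite /rb; have := r0; lra.
pose u : C := (ln rb)%:C - lr.
have uE : complex.Re u = ln rb - ln r by [].
have ne z : r <= cmod z -> z - z0 != 0.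
  by move=> h; rewrite -cmod_gt0; have := cmod_lb z z0; lra.
have lnrb : ln r < ln rb by rewrite ltr_ln ?posrE.
have lb (x : R) z : 0 <= x <= 1 -> cmod z = expR (complex.Re lr + x * complex.Re u) ->
    r <= cmod z.
  move=> hx ->; rewrite -{1}[r](@lnK R) ?posrE // ler_expR uE /lr /=.
  by rewrite lerDl mulr_ge0 //; lra.
have /cvN : cv (fun n => cmean n (fun z => z / (z - z0)) (lr + u) -
    cmean n (fun z => z / (z - z0)) lr) 0.
  apply: (@cmean_radius _ _ _ (r / (r - cmod z0))).
  - by rewrite uE; lra.
  - move=> x z hx hz; right; have := lb x z hx hz => rz.
    apply: cdiffM; first exact: cdiff_id.
    by apply: cdiffV; [apply: cdiffB; [exact: cdiff_id|exact: cdiff_cst]|exact: ne].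
  - move=> x z hx hz; have rz := lb x z hx hz.
    rewrite cmodM cmodV ler_pdivrMr ?cmod_gt0 ?ne //.
    rewrite mulrAC ler_pdivlMr; last lra.
    by have := cmod_lb z z0; have := r0; nra.
rewrite oppr0 => /(_ (e / 2) ltac:(lra))[N hN]; exists N => n /hN{hN}.
have luE : lr + u = (ln rb)%:C by rewrite /u addrC subrK.
rewrite subr0 opprB luE => h.
have : cmod (cmean n (fun z => z / (z - z0)) (ln rb)%:C - 1) <= e / 2.
  rewrite -[X in _ - X](cmean_cst n 1 (ln rb)%:C) -cmeanB.
  apply: cmean_le => j; set z := node _ _ _.
  have zE : cmod z = rb by rewrite /z cmod_node /= lnK.
  have zz : z - z0 != 0 by apply: ne; rewrite zE ltW.
  have -> : z / (z - z0) - 1 = z0 / (z - z0) by field; exact: zz.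
  rewrite cmodM cmodV ler_pdivrMr ?cmod_gt0 //.
  have := cmod_lb z z0; rewrite zE => h1.
  have : e * (2 * cmod z0 / e) = 2 * cmod z0 by field; lra.
  have := r0; rewrite /rb in h1 *; nra.
have := cmod_tri (cmean n (fun z => z / (z - z0)) (ln rb)%:C)
  (cmean n (fun z => z / (z - z0)) lr) 1.
lra.
Qed.

(** Near [z0] by the local Lipschitz bound, elsewhere by [K]. At [z0] the expression is 0, which in
    general is not its limit: only boundedness is kept there, and this is why [cmean_radius] admits
    an exceptional point. *)
Lemma quot_bounded z0 : cmod z0 < r -> exists2 M : R, 0 <= M &
  forall z, cmod z <= r -> cmod ((g z - g z0) * (z / (z - z0))) <= M.
Proof.
move=> z0r; have rr' : r < r' by case/andP: hr.
have [l /hasd_lip[d d0 hd]] := hg (lt_trans z0r rr').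
have l0 := cmod_ge0 l.
have K0 : 0 <= K by apply: le_trans (hK (z := 0) _); rewrite ?cmod0 ?cmod_ge0 //; have := r0; lra.
have M1 : 0 <= (cmod l + 1) * r by rewrite mulr_ge0 ?(ltW r0) //; lra.
have M2 : 0 <= 2 * K * r / d by rewrite divr_ge0 ?mulr_ge0 // ltW.
exists ((cmod l + 1) * r + 2 * K * r / d); first lra.
move=> z zr; have [->|zz] := eqVneq z z0; first by rewrite subrr mul0r cmod0; lra.
have zz' : 0 < cmod (z - z0) by rewrite cmod_gt0 subr_eq0.
rewrite !cmodM cmodV mulrA ler_pdivrMr //.
have c0 := cmod_ge0 z.
have [h|h] := leP (cmod (z - z0)) d.
  have := hd _ h; rewrite [z0 + _]addrC subrK => H.
  apply: le_trans (_ : (cmod l + 1) * cmod (z - z0) * r <= _).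
    by apply: ler_pM; rewrite ?cmod_ge0.
  by rewrite mulrAC ler_wpM2r ?(ltW zz') //; lra.
apply: le_trans (_ : (2 * K) * r <= _).
  apply: ler_pM; rewrite ?cmod_ge0 //; apply: le_trans (cmodBD _ _) _.
  by have := hK (le_lt_trans zr rr'); have := hK (lt_trans z0r rr'); lra.
apply: le_trans (_ : 2 * K * r / d * d <= _); first by rewrite divfK // gt_eqF.
by apply: ler_pM => //; rewrite ?(ltW d0) ?(ltW h) //; lra.
Qed.

(** The circle is shrunk towards 0, where the factor [z] makes the quotient small; if [z0 = 0] this
    factor cancels and the continuity of [g] takes its place. *)
Lemma cmean_quot z0 : cmod z0 < r ->
  cv (fun n => cmean n (fun z => (g z - g z0) * (z / (z - z0))) lr) 0.
Proof.
move=> z0r; set q := fun z => _; have rr' : r < r' by case/andP: hr.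
have [M M0 hM] := quot_bounded z0r.
have K0 : 0 <= K by apply: le_trans (hK (z := 0) _); rewrite ?cmod0 ?cmod_ge0 //; have := r0; lra.
have qd z : cmod z < r' -> z != z0 -> cdiff q z.
  move=> h1 h2; apply: cdiffM; first by apply: cdiffB; [exact: hg|exact: cdiff_cst].
  apply: cdiffM; first exact: cdiff_id.
  by apply: cdiffV; [apply: cdiffB; [exact: cdiff_id|exact: cdiff_cst]|rewrite subr_eq0].
have between w u (x : R) z : expR (complex.Re w) <= r -> expR (complex.Re (w + u)) <= r ->
    0 <= x <= 1 -> cmod z = expR (complex.Re w + x * complex.Re u) -> cmod z <= r.
  move=> h1 h2 hx ->; rewrite raddfD /= in h2.
  have [ul|ul] := leP 0 (complex.Re u).
    by apply: le_trans h2; rewrite ler_expR lerD2l; nra.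
  by apply: le_trans h1; rewrite ler_expR; nra.
have inner e : 0 < e -> exists2 w, cv (fun n => cmean n q lr - cmean n q w) 0 &
    forall n, cmod (cmean n q w) <= e.
  move=> e0.
  have [eta /andP[eta0 etar] heta] : exists2 eta : R, 0 < eta < r & forall z, cmod z = eta ->
      (z0 != 0 -> eta < cmod z0) /\ cmod (q z) <= e.
    have [z00|z00] := eqVneq z0 0.
      subst z0; have [d d0 hd] := cdiff_cont (hg (lt_trans z0r rr')) e0.
      exists (Num.min d (r / 2)); first rewrite lt_min d0 /=.
        rewrite divr_gt0 ?r0 //=; apply: le_lt_trans (_ : r / 2 < _).
          by rewrite ge_min lexx orbT.
        by have := r0; lra.
      move=> z hz; split=> //; rewrite /q subr0 divff ?mulr1; last first.
        by rewrite -cmod_gt0 hz lt_min d0 divr_gt0 ?r0.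
      by apply: hd; rewrite subr0 hz ge_min lexx.
    have m0 : 0 < cmod z0 by rewrite cmod_gt0.
    pose eta := Num.min (cmod z0 / 2) (e * cmod z0 / (4 * (K + 1))).
    have eta0 : 0 < eta by rewrite lt_min divr_gt0 //= divr_gt0 ?mulr_gt0 //; lra.
    have eta1 : eta <= cmod z0 / 2 by rewrite ge_min lexx.
    have eta2 : eta * (4 * (K + 1)) <= e * cmod z0.
      by rewrite -ler_pdivlMr ?ge_min ?lexx ?orbT //; lra.
    exists eta => [|z hz]; first by rewrite eta0 /=; lra.
    split=> [_|]; first lra.
    have h1 : cmod z0 / 2 <= cmod (z - z0).
      by rewrite cmodB; have := cmod_lb z0 z; rewrite hz; lra.
    rewrite /q !cmodM cmodV mulrA ler_pdivrMr; last lra.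
    have := cmodBD (g z) (g z0); have := hK (lt_trans z0r rr').
    have := hK (z := z) ltac:(rewrite hz; lra); rewrite hz => k1 k2 k3.
    apply: le_trans (_ : (2 * K) * eta <= _); last by nra.
    by apply: ler_wpM2r; [exact: ltW|lra].
  have lne : expR (ln eta) = eta by rewrite lnK.
  exists (ln eta)%:C; last first.
    move=> n; apply: cmean_le => j; apply: (heta _ _).2.
    by rewrite cmod_node /= lne.
  have [z00|z00] := eqVneq z0 0.
    have -> : (fun n => cmean n q lr - cmean n q (ln eta)%:C) =
       (fun n => cmean n q ((ln eta)%:C + (lr - (ln eta)%:C)) - cmean n q (ln eta)%:C).
      by apply: funext => n; rewrite [_ + (_ - _)]addrC subrK.
    have bb (x : R) z : 0 <= x <= 1 -> cmod z = expR (complex.Re (ln eta)%:C + x *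
       complex.Re (lr - (ln eta)%:C)) -> cmod z <= r.
      move=> hx; apply: between hx; first by rewrite /= lne ltW.
      by rewrite [_ + (_ - _)]addrC subrK Relr.
    apply: (@cmean_radius _ _ _ M) => [|x z hx hz|x z hx hz].
    - by rewrite /lr raddfB /= subr_eq0 gt_eqF // ltr_ln ?posrE ?r0.
    - right; apply: qd; first by apply: le_lt_trans (bb _ _ hx hz) rr'.
      by rewrite z00 -cmod_gt0 hz expR_gt0.
    - by apply: hM; exact: bb hx hz.
  (* Shrinking the circle crosses [z0]. The way is divided at the circle through [z0], parametrised
     so as to start at [z0], which is then the exceptional base point of both halves. *)
  have [w0 w0E] := cexp_surj z00.
  have Rew0 : expR (complex.Re w0) = cmod z0 by rewrite w0E cmod_cexp.
  have piece w : expR (complex.Re w) <= r -> expR (complex.Re w) != cmod z0 ->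
      cv (fun n => cmean n q w - cmean n q w0) 0.
    move=> h1 h2; have wE : w0 + (w - w0) = w by rewrite addrC subrK.
    have bb (x : R) z : 0 <= x <= 1 -> cmod z = expR (complex.Re w0 + x *
       complex.Re (w - w0)) -> cmod z <= r.
      by move=> hx; apply: between hx; rewrite ?wE // Rew0 ltW.
    rewrite -{1}wE; apply: (@cmean_radius _ _ _ M) => [|x z hx hz|x z hx hz].
    - rewrite raddfB subr_eq0; apply/eqP => h3; case/eqP: h2.
      by rewrite -Rew0; congr expR.
    - have [->|zn] := eqVneq z z0; first by left.
      by right; apply: qd => //; exact: le_lt_trans (bb _ _ hx hz) rr'.
    - by apply: hM; exact: bb hx hz.
  have p1 := piece lr ltac:(by rewrite Relr) ltac:(by rewrite Relr; lra).
  have p2 : cv (fun n => cmean n q (ln eta)%:C - cmean n q w0) 0.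
    apply: piece; rewrite /= lne ?(ltW etar) //.
    have := (heta (eta%:C) _).1 z00; rewrite cmodC_ge0 ?(ltW eta0) // => /(_ erefl).
    by move=> h; rewrite lt_eqF.
  by have := cvB p1 p2; rewrite subr0; apply: cv_ext => n; ring.
move=> e e0; have e2 : 0 < e / 2 by lra.
have [w hw1 hw2] := inner _ e2.
have [N hN] := hw1 _ e2; exists N => n /hN; rewrite !subr0 => h.
have := cmodD (cmean n q lr - cmean n q w) (cmean n q w); rewrite subrK.
have := hw2 n; lra.
Qed.

Lemma geometric_remainder z z0 L : z != 0 -> z - z0 != 0 ->
  z / (z - z0) - \sum_(k < L) (z ^+ k)^-1 * z0 ^+ k = (z0 / z) ^+ L * (z / (z - z0)).
Proof.
move=> h1 h2; elim: L => [|L IH]; first by rewrite big_ord0 subr0 expr0 mul1r.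
rewrite big_ord_recr /= opprD addrA IH exprS expr_div_n.
have hz : z ^+ L != 0 by rewrite expf_neq0.
by field; rewrite h1 h2 hz.
Qed.

(** For finite [n] the mean of [g z * (z / (z - z0))] is already a power series in [z0], by the
    geometric series at each node, and [pser_limit] passes to the limit. For [|z0| < r / 2] the
    kernel is at most 2, whence the bound [2 * K]. *)
Theorem cauchy_expansion : exists2 a : nat -> C,
  (forall k, cv (fun n => cmean n (fun z => g z * (z ^+ k)^-1) lr) (a k)) &
  pser (r / 2) (2 * K) a g.
Proof.
have rr' : r < r' by case/andP: hr.
have K0 : 0 <= K by apply: le_trans (hK (z := 0) _); rewrite ?cmod0 ?cmod_ge0 //; have := r0; lra.
have nr : forall n j, cmod (node n lr j) < r' by move=> n j; rewrite cmod_circle.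
have n0 : forall n j, node n lr j != 0 by move=> n j; rewrite -cmod_gt0 cmod_circle r0.
apply: (@pser_limit _ _ _ (fun n k => cmean n (fun z => g z * (z ^+ k)^-1) lr)
  (fun n z0 => cmean n (fun z => g z * (z / (z - z0))) lr)).
- by have := r0; lra.
- move=> n; split=> [L|z0 z0r L].
    apply: le_trans (_ : \sum_(k < L) K * (1 / 2) ^+ k <= _); last first.
      rewrite -mulr_sumr mulrC ler_wpM2r //; apply: geo_sum_le; lra.
    apply: ler_sum => k _; rewrite expr_div_n mulrA.
    have rk : 0 < r ^+ k by rewrite exprn_gt0 ?r0.
    rewrite expr_div_n expr1n mul1r ler_wpM2r ?invr_ge0 ?exprn_ge0 //.
    rewrite -ler_pdivlMr //; apply: cmean_le => j.
    rewrite cmodM cmodV cmodX cmod_circle ler_wpM2r ?invr_ge0 ?(ltW rk) //.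
    exact: hK.
  have z0r' : cmod z0 < r by have := r0; lra.
  have c0 := cmod_ge0 z0.
  have ne j : node n lr j - z0 != 0.
    by rewrite -cmod_gt0; have := cmod_lb (node n lr j) z0; rewrite cmod_circle; lra.
  have -> : cmean n (fun z => g z * (z / (z - z0))) lr -
    \sum_(k < L) cmean n (fun z => g z * (z ^+ k)^-1) lr * z0 ^+ k =
    cmean n (fun z => g z * ((z0 / z) ^+ L * (z / (z - z0)))) lr.
    under eq_bigr do rewrite mulrC -cmeanZ.
    rewrite -(cmean_sum n L (fun k z => z0 ^+ k * (g z * (z ^+ k)^-1))) -cmeanB.
    apply: cmean_eq => j; rewrite -geometric_remainder ?n0 //.
    rewrite mulrBr mulr_sumr; congr (_ - _).
    by apply: eq_bigr => k _; ring.
  apply: cmean_le => j; move: (node n lr j) (cmod_circle n j) (ne j) (nr n j) => t tr nt tr'.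
  rewrite !cmodM cmodX cmodM !cmodV tr.
  have rL : (cmod z0 / r) ^+ L <= (cmod z0 / (r / 2)) ^+ L.
    have r20 : 0 < r / 2 by have := r0; lra.
    rewrite lerXn2r ?nnegrE ?divr_ge0 ?(ltW r0) ?(ltW r20) //.
    by rewrite ler_wpM2l // lef_pV2 ?posrE ?r0 //; have := r0; lra.
  have q2 : r / cmod (t - z0) <= 2.
    by rewrite ler_pdivrMr ?cmod_gt0 //; have := cmod_lb t z0; lra.
  have q3 : 0 <= (cmod z0 / r) ^+ L by rewrite exprn_ge0 // divr_ge0 // ltW ?r0.
  have q4 : 0 <= r / cmod (t - z0) by rewrite divr_ge0 ?cmod_ge0 ?(ltW r0).
  rewrite (_ : 2 * K * _ = K * ((cmod z0 / (r / 2)) ^+ L * 2)); last by ring.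
  have q5 := ler_pM q3 q4 rL q2.
  by apply: ler_pM; rewrite ?cmod_ge0 ?hK ?mulr_ge0 ?invr_ge0 ?cmod_ge0 ?(ltW r0).
- move=> z0 z0r; have z0r' : cmod z0 < r by have := r0; have := cmod_ge0 z0; lra.
  have := cvD (cmean_quot z0r') (cvZ (g z0) (cmean_kernel z0r')).
  rewrite add0r mulr1; apply: cv_ext => n; rewrite -cmeanZ -cmeanD.
  by apply: cmean_eq => j; ring.
Qed.

End Expansion.
End CauchyExpansion.

(** * Local expansions, limits and derivatives of holomorphic functions *)

Section Holomorphy.
Variable R : realType.
Notation C := R[i].
Implicit Types (z c h : C) (s b d K : R) (a : nat -> C) (f g : C -> C).

Lemma hasd_shift f z l c : hasd f (c + z) l -> hasd (fun x => f (c + x)) z l.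
Proof.
by move=> h e /h[d d0 hd]; exists d => // x /hd; rewrite addrA.
Qed.

Lemma cdiff_shift f z c : cdiff f (c + z) -> cdiff (fun x => f (c + x)) z.
Proof. by move=> [l hl]; exists l; exact: hasd_shift. Qed.

Lemma hasd_uniq f z l m : hasd f z l -> hasd f z m -> l = m.
Proof.
move=> hl hm; apply/eqP; rewrite -subr_eq0 -cmod_eq0 eq_le cmod_ge0 andbT.
rewrite leNgt; apply/negP => lm.
have e0 : 0 < cmod (l - m) / 4 by rewrite divr_gt0.
have [d1 d10 h1] := hl _ e0; have [d2 d20 h2] := hm _ e0.
pose t := Num.min d1 d2; have t0 : 0 < t by rewrite lt_min d10.
have nt : cmod (t%:C : C) = t by rewrite cmodC_ge0 // ltW.
have := h1 t%:C; have := h2 t%:C; rewrite nt => /(_ _) k2 /(_ _) k1.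
have {}k1 := k1 ltac:(by rewrite ge_min lexx); have {}k2 := k2 ltac:(by rewrite ge_min lexx orbT).
have := cmodBD (f (z + t%:C) - f z - m * t%:C) (f (z + t%:C) - f z - l * t%:C).
have -> : f (z + t%:C) - f z - m * t%:C - (f (z + t%:C) - f z - l * t%:C) = (l - m) * t%:C.
  by ring.
by rewrite cmodM nt; nra.
Qed.

(** The radius is halved twice: the circle of integration has radius [d / 2], and [cauchy_expansion]
    holds in half of it. *)
Lemma local_expansion f c d K : 0 < d -> (forall z, cmod (z - c) < d -> cdiff f z) ->
  (forall z, cmod (z - c) < d -> cmod (f z) <= K) ->
  exists a, pser (d / 4) (2 * K) a (fun h => f (c + h)).
Proof.
move=> d0 hf hK.
have e h : c + h - c = h by rewrite addrAC subrr add0r.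
have [|z zd|z zd|a _ ha] := @cauchy_expansion R (fun h => f (c + h)) d (d / 2) K.
- by lra.
- by apply: cdiff_shift; apply: hf; rewrite e.
- by apply: hK; rewrite e.
- by exists a; rewrite (_ : d / 4 = d / 2 / 2) //; field.
Qed.

Lemma pser_at0 s b a f : 0 < s -> pser s b a f -> f 0 = a 0%N.
Proof.
move=> s0 [_ /(_ 0)]; rewrite cmod0 => /(_ s0 1%N).
rewrite big_ord_recl big_ord0 expr0 mulr1 addr0 mul0r expr1 mulr0 => h.
by apply/eqP; rewrite -subr_eq0 -cmod_eq0 eq_le h cmod_ge0.
Qed.

Lemma pser_hasd0 s b a f : 0 < s -> pser s b a f -> hasd f 0 (a 1%N).
Proof.
move=> s0 hf e e0; have b0 := pser_b0 hf; have s2 : 0 < s ^+ 2 by rewrite exprn_gt0.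
have e1 : 0 < e * s ^+ 2 / (b + 1) by rewrite divr_gt0 ?mulr_gt0 //; lra.
exists (Num.min (s / 2) (e * s ^+ 2 / (b + 1))).
  by rewrite lt_min e1 divr_gt0.
move=> h; rewrite le_min => /andP[h1]; rewrite ler_pdivlMr; last lra.
move=> h2; have := hf.2 h ltac:(lra) 2%N.
rewrite 2!big_ord_recl big_ord0 /= expr0 mulr1 addr0 expr1 add0r.
rewrite (pser_at0 s0 hf) [f h - _ - _](_ : _ = f h - (a 0%N + a 1%N * h)); last by ring.
move=> /le_trans; apply; rewrite expr_div_n mulrA ler_pdivrMr //.
have := cmod_ge0 h; set S := s ^+ 2 in s2 h2 *; nra.
Qed.

Lemma cauchy_lipschitz f c d K : 0 < d -> (forall z, cmod (z - c) < d -> cdiff f z) ->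
  (forall z, cmod (z - c) < d -> cmod (f z) <= K) ->
  forall h, cmod h < d / 4 -> cmod (f (c + h) - f c) <= 8 * K / d * cmod h.
Proof.
move=> d0 hf hK h hd; have [a ha] := local_expansion d0 hf hK.
have := ha.2 h hd 1%N; rewrite big_ord_recl big_ord0 expr0 mulr1 addr0 expr1.
have := pser_at0 _ ha; rewrite addr0 => <-; last lra.
by rewrite (_ : 2 * K * _ = 8 * K / d * cmod h) //; field; rewrite gt_eqF.
Qed.

(** Pointwise convergence is enough under a common bound: by [pser_limit] the local coefficients
    converge and the limit is again a power series. *)
Lemma cdiff_limit (f : nat -> C -> C) g c d K : 0 < d ->
  (forall n z, cmod (z - c) < d -> cdiff (f n) z) ->
  (forall n z, cmod (z - c) < d -> cmod (f n z) <= K) ->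
  (forall z, cmod (z - c) < d -> cv (fun n => f n z) (g z)) -> cdiff g c.
Proof.
move=> d0 hf hK hc.
have /choice[a ha] : forall n, exists a, pser (d / 4) (2 * K) a (fun h => f n (c + h)).
  by move=> n; exact: (local_expansion d0 (hf n) (hK n)).
have d4 : 0 < d / 4 by rewrite divr_gt0.
have [z zd|l _ hl] := @pser_limit _ _ _ a (fun n h => f n (c + h)) (fun h => g (c + h)) d4 ha.
  by apply: hc; rewrite addrAC subrr add0r; lra.
have := pser_hasd0 d4 hl => h; exists (l 1%N) => e /h[r r0 hr]; exists r => // x /hr.
by rewrite add0r addr0.
Qed.

Lemma poly_cdiff a L z : cdiff (fun x => \sum_(k < L) a k * x ^+ k) z.
Proof.
apply: cdiff_sum => k _; apply: cdiffZ; apply: cdiffX; exact: cdiff_id.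
Qed.

Lemma poly_le s b a f L z : cmod z < s -> pser s b a f ->
  cmod (\sum_(k < L) a k * z ^+ k) <= b.
Proof.
move=> zs hf; apply: le_trans (cmod_sum _ _ _) _; apply: le_trans (hf.1 L).
apply: ler_sum => k _; rewrite cmodM cmodX ler_wpM2l ?cmod_ge0 //.
by rewrite lerXn2r ?nnegrE ?cmod_ge0 ?(ltW zs) //; have := cmod_ge0 z; lra.
Qed.

Lemma pser_cdiff s b a f z : pser s b a f -> cmod z < s -> cdiff f z.
Proof.
move=> hf zs; have d0 : 0 < s - cmod z by lra.
have near x : cmod (x - z) < s - cmod z -> cmod x < s.
  by move=> h; have := cmodD (x - z) z; rewrite subrK; lra.
apply: (@cdiff_limit (fun L x => \sum_(k < L) a k * x ^+ k) f z _ b d0).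
- by move=> n x _; exact: poly_cdiff.
- by move=> n x /near h; exact: poly_le hf.
- by move=> x /near h; apply: pser_cv hf => //; have := cmod_ge0 x; lra.
Qed.

Lemma hasdX n z : hasd (fun x => x ^+ n) z (n%:R * z ^+ n.-1).
Proof.
elim: n => [|n IH]; first by rewrite mul0r; apply: hasd_ext (hasd_cst 1 z).
have := hasdM (hasd_id z) IH; rewrite mul1r.
have -> : z ^+ n + id z * (n%:R * z ^+ n.-1) = n.+1%:R * z ^+ n.+1.-1.
  case: n {IH} => [|n] /=; first by rewrite mul0r mulr0 addr0 mul1r.
  by rewrite exprS -[n.+2%:R]natr1; ring.
by apply: hasd_ext => x; rewrite exprS.
Qed.

Lemma hasd_poly a L z : hasd (fun x => \sum_(k < L) a k * x ^+ k) z
  (\sum_(k < L) a k * (k%:R * z ^+ k.-1)).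
Proof.
elim: L => [|L IH].
  by rewrite big_ord0; apply: hasd_ext (hasd_cst 0 z) => x; rewrite big_ord0.
rewrite big_ord_recr /=; apply: hasd_ext (hasdD IH (hasdZ (a L) (hasdX L z))) => x.
by rewrite big_ord_recr.
Qed.

(** The partial sums are expanded around [z] with a common bound; their coefficients of order 1 are
    their derivatives, and converge to that of [f] by [pser_limit]. *)
Lemma pser_hasd s b a f z : pser s b a f -> cmod z < s ->
  exists2 l, hasd f z l & cv (fun L => \sum_(k < L) a k * (k%:R * z ^+ k.-1)) l.
Proof.
move=> hf zs; have d0 : 0 < s - cmod z by lra.
have near x : cmod (x - z) < s - cmod z -> cmod x < s.
  by move=> h; have := cmodD (x - z) z; rewrite subrK; lra.
have /choice[A hA] : forall L, exists A, pser ((s - cmod z) / 4) (2 * b) A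
    (fun h => \sum_(k < L) a k * (z + h) ^+ k).
  move=> L; apply: (@local_expansion (fun x => \sum_(k < L) a k * x ^+ k)) => // x.
    by move=> _; exact: poly_cdiff.
  by move=> /near h; exact: poly_le hf.
have d4 : 0 < (s - cmod z) / 4 by rewrite divr_gt0.
have [x xd|l hl hf'] := @pser_limit _ _ _ A
    (fun L h => \sum_(k < L) a k * (z + h) ^+ k) (fun h => f (z + h)) d4 hA.
  have xs : cmod (z + x) < s by have := cmodD z x; have := cmod_ge0 x; lra.
  by apply: pser_cv hf => //; have := cmod_ge0 (z + x); lra.
exists (l 1%N).
  have h := pser_hasd0 d4 hf'; move=> e /h[r r0 hr]; exists r => // x /hr.
  by rewrite add0r addr0.
apply: cv_ext (hl 1%N) => L; apply: hasd_uniq (pser_hasd0 d4 (hA L)) _.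
by apply: (@hasd_shift (fun x => \sum_(k < L) a k * x ^+ k)); rewrite addr0; exact: hasd_poly.
Qed.

Lemma sum_arith_geo (n : nat) : \sum_(k < n) (k.+1%:R / 2 ^+ k : R) <= 4.
Proof.
suff -> : \sum_(k < n) (k.+1%:R / 2 ^+ k : R) = 4 - 2 * (n%:R + 2) / 2 ^+ n.
  by rewrite gerBl divr_ge0 // ?exprn_ge0 // mulr_ge0 // addr_ge0.
elim: n => [|n IH]; first by rewrite big_ord0 expr0 divr1; ring.
rewrite big_ord_recr /= IH exprS -[n.+1%:R]natr1; field.
by rewrite expf_neq0 // pnatr_eq0.
Qed.

(** Halving the radius absorbs the factors [k + 1], since the sum of the [(k + 1) / 2 ^ k] is at
    most 4. *)
Lemma pser_deriv s b a f f' : 0 < s -> pser s b a f ->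
  (forall z, cmod z < s -> hasd f z (f' z)) ->
  pser (s / 2) (4 * b / s) (fun k => k.+1%:R * a k.+1) f'.
Proof.
move=> s0 hf hd; have b0 := pser_b0 hf; apply: sum_cv_upgrade; first by lra.
  move=> L; apply: le_trans (_ : \sum_(k < L) b / s * (k.+1%:R / 2 ^+ k) <= _).
    apply: ler_sum => k _; rewrite cmodM cmod_nat expr_div_n.
    have := pser_coef k.+1 s0 hf; rewrite exprS => h.
    have -> : b / s * (k.+1%:R / 2 ^+ k) = k.+1%:R * (b / s) / 2 ^+ k by ring.
    rewrite [leLHS]mulrA ler_wpM2r ?invr_ge0 ?exprn_ge0 // -mulrA ler_wpM2l //.
    by rewrite ler_pdivlMr // -mulrA [_ * s]mulrC.
  rewrite -mulr_sumr (_ : 4 * b / s = b / s * 4); last by ring.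
  by rewrite ler_wpM2l ?sum_arith_geo // divr_ge0 // ltW.
move=> z zs; have zs' : cmod z < s by have := cmod_ge0 z; lra.
have [l hl hcv] := pser_hasd hf zs'.
rewrite (hasd_uniq (hd z zs') hl) => e /hcv[N hN]; exists N => n Nn.
have := hN n.+1 (leqW Nn); rewrite big_ord_recl /= mul0r mulr0 add0r.
by congr (cmod (_ - _) < _); apply: eq_bigr => k _; rewrite /bump leq0n add1n /=; ring.
Qed.

End Holomorphy.

(** * The Wiener algebra *)

Section WienerAlgebra.
Variable R : realType.
Notation C := R[i].
Variables (Om : C -> Prop) (s : R).
Hypothesis s0 : 0 < s.
Implicit Types (f g : C -> C -> C) (b : R).

(* Vacuous when Om has empty interior, in particular for a single point. *)
Definition Hol (p : C -> C) := forall c (d : R), 0 < d ->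
  (forall y, cmod (y - c) < d -> Om y) -> cdiff p c.

Lemma Hol_cst c : Hol (fun=> c). Proof. by move=> *; exact: cdiff_cst. Qed.
Lemma Hol_id : Hol id. Proof. by move=> *; exact: cdiff_id. Qed.
Lemma HolD p q : Hol p -> Hol q -> Hol (fun e => p e + q e).
Proof. by move=> hp hq c d d0 hd; apply: cdiffD; [exact: hp hd|exact: hq hd]. Qed.
Lemma HolM p q : Hol p -> Hol q -> Hol (fun e => p e * q e).
Proof. by move=> hp hq c d d0 hd; apply: cdiffM; [exact: hp hd|exact: hq hd]. Qed.
Lemma Hol_sum n (p : nat -> C -> C) : (forall i, (i < n)%N -> Hol (p i)) ->
  Hol (fun e => \sum_(i < n) p i e).
Proof. by move=> hp c d d0 hd; apply: cdiff_sum => i _; exact: (hp i _ _ _ d0 hd). Qed.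
Lemma Hol_limit (p : nat -> C -> C) q (K : R) : (forall n, Hol (p n)) ->
  (forall n e, Om e -> cmod (p n e) <= K) ->
  (forall e, Om e -> cv (fun n => p n e) (q e)) -> Hol q.
Proof.
move=> hp hK hc c d d0 hd; apply: (@cdiff_limit _ p q c d K d0).
- move=> n z zd; have d' : 0 < d - cmod (z - c) by lra.
  apply: (hp n _ _ d') => y hy; apply: hd.
  by have := cmod_tri z y c; lra.
- by move=> n z /hd; exact: hK.
- by move=> z /hd; exact: hc.
Qed.

(* The algebra of series in z with coefficients holomorphic on Om whose l1-norm
   at radius s is at most b, uniformly on Om. *)
Definition Wn b f := exists2 a : nat -> C -> C,
  forall k, Hol (a k) & forall e, Om e -> pser s b (a^~ e) (f e).

Lemma Wn_cst (p : C -> C) b : Hol p -> (forall e, Om e -> cmod (p e) <= b) ->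
  Wn b (fun e _ => p e).
Proof.
move=> hp hb; exists (fun k e => if k is 0%N then p e else 0).
  by case=> [//|k]; exact: Hol_cst.
move=> e he; have := pser_cst (p e) s0; apply: pser_mono; last exact: hb.
by rewrite s0 lexx.
Qed.

Lemma Wn_z : Wn s (fun _ z => z).
Proof.
exists (fun k _ => (k == 1%N)%:R) => [k|e _]; first exact: Hol_cst.
exact: pser_X.
Qed.

Lemma Wn_mono b b' f : b <= b' -> Wn b f -> Wn b' f.
Proof.
move=> bb [a h1 h2]; exists a => // e /h2; apply: pser_mono => //.
by rewrite s0 lexx.
Qed.

Lemma WnD b b' f g : Wn b f -> Wn b' g -> Wn (b + b') (fun e z => f e z + g e z).
Proof.
move=> [a a1 a2] [c c1 c2]; exists (fun k e => a k e + c k e) => [k|e he].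
  exact: HolD.
by apply: pserD; [|exact: a2|exact: c2].
Qed.

Lemma WnZ c b f : Wn b f -> Wn (cmod c * b) (fun e z => c * f e z).
Proof.
move=> [a a1 a2]; exists (fun k e => c * a k e) => [k|e he].
  by apply: HolM => //; exact: Hol_cst.
by apply: pserZ => //; exact: a2.
Qed.

Lemma WnM b b' f g : Wn b f -> Wn b' g -> Wn (b * b') (fun e z => f e z * g e z).
Proof.
move=> [a a1 a2] [c c1 c2]; exists (fun k e => cauchy_prod (a^~ e) (c^~ e) k) => [k|e he].
  by apply: (Hol_sum (p := fun i e => a i e * c (k - i)%N e)) => i _; exact: HolM.
by apply: pserM; [|exact: a2|exact: c2].
Qed.

Lemma Wn_ext b f g : (forall e z, Om e -> cmod z < s -> f e z = g e z) -> Wn b f -> Wn b g.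
Proof.
move=> h [a a1 a2]; exists a => // e he; apply: pser_ext (a2 e he) => z zs.
exact: h.
Qed.

Lemma Wn_sum (I : Type) (r : seq I) (F : I -> C -> C -> C) (b : I -> R) :
  (forall i, Wn (b i) (F i)) ->
  Wn (\sum_(i <- r) b i) (fun e z => \sum_(i <- r) F i e z).
Proof.
move=> h; elim: r => [|i r IH].
  rewrite big_nil; apply: Wn_ext (Wn_cst (p := fun=> 0) (b := 0) _ _).
  - by move=> e z _ _; rewrite big_nil.
  - exact: Hol_cst.
  - by move=> e _; rewrite cmod0.
rewrite big_cons; apply: Wn_ext (WnD (h i) IH) => e z _ _.
by rewrite big_cons.
Qed.

Lemma WnX b f n : Wn b f -> Wn (b ^+ n) (fun e z => f e z ^+ n).
Proof.
move=> hf; elim: n => [|n IH].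
  rewrite expr0; apply: (Wn_ext _ (Wn_cst (p := fun=> 1) (b := 1) _ _)).
  - by [].
  - exact: Hol_cst.
  - by move=> e _; rewrite cmod1.
by rewrite exprS; apply: Wn_ext (WnM hf IH) => e z _ _; rewrite exprS.
Qed.

Lemma Wn_val b f e z : Wn b f -> Om e -> cmod z < s -> cmod (f e z) <= b.
Proof. by move=> [a _ h] /h he zs; exact: pser_val he. Qed.

Lemma Wn_limit b (f : nat -> C -> C -> C) g : (forall n, Wn b (f n)) ->
  (forall e z, Om e -> cmod z < s -> cv (fun n => f n e z) (g e z)) -> Wn b g.
Proof.
move=> hf hc; have /choice[a ha] : forall n, exists a : nat -> C -> C,
    (forall k, Hol (a k)) /\ forall e, Om e -> pser s b (a^~ e) (f n e).
  by move=> n; have [a a1 a2] := hf n; exists a.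
have /choice[l hl] : forall e, exists l : nat -> C, Om e ->
    (forall k, cv (fun n => a n k e) (l k)) /\ pser s b l (g e).
  move=> e; have [he|he] := pselect (Om e); last by exists (fun=> 0).
  have [z zs|l l1 l2] := @pser_limit _ s b (fun n k => a n k e) (fun n => f n e) (g e) s0
    (fun n => (ha n).2 e he); first exact: hc.
  by exists l.
exists (fun k e => l e k) => [k|e he]; last by have [] := hl e he.
apply: (@Hol_limit (fun n => a n k) _ (b / s ^+ k)).
- by move=> n; exact: (ha n).1.
- move=> n e he; have := pser_coef k s0 ((ha n).2 e he).
  by rewrite ler_pdivlMr // exprn_gt0.
- by move=> e he; have [] := hl e he.
Qed.

Section OneParameter.
Variables (G : C -> C -> C -> C) (B tau tau' K : R).
Hypotheses (htau : 0 < tau < tau') (hG : forall t, cmod t <= tau -> Wn B (G t)).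
Hypothesis G_diff : forall e z t, Om e -> cmod z < s -> cmod t < tau' ->
  cdiff (fun t => G t e z) t.
Hypothesis G_bound : forall e z t, Om e -> cmod z < s -> cmod t < tau' ->
  cmod (G t e z) <= K.

(** Cauchy's estimate in [t] with values in the algebra. A circle mean is a finite average of
    elements of norm at most [B], and [Wn_limit] passes to the limit; the pointwise hypotheses in
    [t] provide the convergence. *)
Lemma Wn_param : exists2 g : nat -> C -> C -> C,
  forall k, Wn (B / tau ^+ k) (g k) &
  forall e z, Om e -> cmod z < s -> pser (tau / 2) (2 * K) (fun k => g k e z) (fun t => G t e z).
Proof.
have t0 : 0 < tau by case/andP: htau.
have /choice[g hg] : forall e, exists g : nat -> C -> C, forall z, Om e -> cmod z < s ->
    (forall k, cv (fun n => cmean n (fun t => G t e z * (t ^+ k)^-1) (ln tau)%:C) (g k z)) /\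
    pser (tau / 2) (2 * K) (g^~ z) (fun t => G t e z).
  move=> e; have /choice[g hg] : forall z, exists a : nat -> C, Om e -> cmod z < s ->
    (forall k, cv (fun n => cmean n (fun t => G t e z * (t ^+ k)^-1) (ln tau)%:C) (a k)) /\
    pser (tau / 2) (2 * K) a (fun t => G t e z).
    move=> z; have [[he hz]|hn] := pselect (Om e /\ cmod z < s); last first.
      by exists (fun=> 0) => he hz; case: hn.
    have [t ht|t ht|a a1 a2] := @cauchy_expansion R (fun t => G t e z) tau' tau K htau.
    - exact: G_diff.
    - exact: G_bound.
    - by exists a.
  by exists (fun k z => g z k).
exists (fun k e z => g e k z) => [k|e z he hz]; last by have [] := hg e z he hz.
apply: (@Wn_limit _ (fun n e z => cmean n (fun t => G t e z * (t ^+ k)^-1) (ln tau)%:C)).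
  move=> n; pose T j : C := node n (ln tau)%:C j.
  have hT j : cmod (T j) = tau by rewrite cmod_node /= lnK.
  have := Wn_sum (index_enum 'I_(2 ^ n)) (F := fun j e z => (T j ^+ k)^-1 * G (T j) e z)
    (b := fun=> (tau ^+ k)^-1 * B) _.
  have hj j : Wn ((tau ^+ k)^-1 * B) (fun e z => (T j ^+ k)^-1 * G (T j) e z).
    rewrite -[tau in X in X * _](hT j) -cmodX -cmodV; apply: WnZ; apply: hG.
    by rewrite hT.
  move=> /(_ (fun j => hj j)) /(WnZ ((2 ^+ n)^-1)%:C).
  have p0 : 0 < (2 ^+ n : R) by rewrite exprn_gt0.
  rewrite cmodC_ge0 ?invr_ge0 ?(ltW p0) // sumr_const card_ord.
  rewrite -[(_ * B) *+ _]mulr_natl natrX mulrA mulVf ?gt_eqF // mul1r mulrC.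
  apply: Wn_ext => e z _ _; rewrite /cmean; congr (_ * _).
  by apply: eq_bigr => j _; rewrite mulrC.
by move=> e z he hz; have [/(_ k)] := hg e z he hz.
Qed.

(* flat : the first derivative in t vanishes at 0 *)
Lemma Wn_param_diff (flat : bool) : 2 < tau ->
  (flat -> forall e z, Om e -> cmod z < s -> hasd (fun t => G t e z) 0 0) ->
  Wn (2 * B / tau ^+ flat.+1) (fun e z => G 1 e z - G 0 e z).
Proof.
move=> tau2 hflat; have [g g1 g2] := Wn_param.
have t0 : 0 < tau by move: htau; lra.
have B0 : 0 <= B \/ forall e z, Om e -> ~ cmod z < s.
  have [h|h] := pselect (exists e, exists z, Om e /\ cmod z < s); last first.
    by right => e z he hz; apply: h; exists e, z.
  have [e [z [he hz]]] := h; left; apply: le_trans (cmod_ge0 (G 0 e z)) _.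
  by apply: Wn_val he hz; apply: hG; rewrite cmod0 ltW.
case: B0 => [B0|hn]; last first.
  by exists (fun _ _ => 0) => [k|e he]; [exact: Hol_cst|case: (hn e 0 he); rewrite cmod0].
have th0 : 0 < tau / 2 by rewrite divr_gt0.
(* The difference is the sum of the coefficients in [t] from order [flat.+1] on, that is from order
   1 or 2. Each order gains a factor [1 / tau], and [tau > 2] bounds the geometric sum by 2. *)
apply: (@Wn_limit _ (fun L e z => \sum_(k < L) g (k + flat.+1)%N e z)).
  move=> L; have := Wn_sum (index_enum 'I_L) (F := fun k => g (k + flat.+1)%N)
    (b := fun k => B / tau ^+ (k + flat.+1)) (fun k => g1 _).
  apply: Wn_mono.
  have -> : \sum_(k < L) B / tau ^+ (k + flat.+1) =
      B / tau ^+ flat.+1 * \sum_(k < L) (tau^-1) ^+ k.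
    rewrite mulr_sumr; apply: eq_bigr => k _; rewrite exprD invfM exprVn; ring.
  rewrite (_ : 2 * B / _ = B / tau ^+ flat.+1 * 2); last by ring.
  rewrite ler_wpM2l ?divr_ge0 ?exprn_ge0 ?(ltW t0) //.
  apply: geo_sum_le; rewrite invr_ge0 ltW //= mul1r lef_pV2 ?posrE //.
  exact: ltW.
move=> e z he hz; have hp := g2 e z he hz.
have h1 : cmod (1 : C) < tau / 2 by rewrite cmod1; lra.
have g0 : G 0 e z = g 0%N e z by have := pser_at0 th0 hp.
have gf : flat -> g 1%N e z = 0.
  by move=> fl; apply: hasd_uniq (pser_hasd0 th0 hp) _; exact: hflat.
have := pser_cv th0 h1 hp => hcv d d0; have [N hN] := hcv d d0.
exists N => n Nn; have := hN (n + flat.+1)%N (leq_trans Nn (leq_addr _ _)).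
rewrite addnC big_split_ord /= => h.
have e1 : \sum_(i < flat.+1) g i e z * 1 ^+ i = G 0 e z.
  rewrite big_ord_recl expr0 mulr1 g0 big1 ?addr0 // => i _.
  move: i gf; case: (flat) => [i gf|[]//]; by rewrite (ord1 i) /= gf // mul0r.
rewrite e1 in h; rewrite (_ : _ - _ = G 0 e z + (\sum_(k < n) g (k + flat.+1)%N e z) - G 1 e z).
  move: h; congr (cmod (_ + _ - _) < _); apply: eq_bigr => i _.
  by rewrite expr1n mulr1 addnC.
by ring.
Qed.

End OneParameter.
End WienerAlgebra.

(** * Substitution of power series into functions of several variables *)

Section Composition.
Variables (R : realType) (I : finType).
Notation C := R[i].
Variables (G : (I -> C) -> C) (r' r K : R).
Hypothesis hr : 0 < r < r'.
Hypothesis G_line : forall (x d : I -> C) t, (forall i, cmod (x i + t * d i) < r') ->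
  cdiff (fun t => G (fun i => x i + t * d i)) t.
Hypothesis G_bound : forall x : I -> C, (forall i, cmod (x i) < r') -> cmod (G x) <= K.

Let r0 : 0 < r. Proof. by case/andP: hr. Qed.
Let rr' : r < r'. Proof. by case/andP: hr. Qed.
Let K0 : 0 <= K.
Proof.
apply: le_trans (G_bound (x := fun=> 0) _); rewrite ?cmod_ge0 // => i.
by rewrite cmod0; have := r0; have := rr'; lra.
Qed.
Let M : R := 2 ^+ #|I| * K.
Let M0 : 0 <= M. Proof. by rewrite mulr_ge0 ?exprn_ge0. Qed.

Section Algebra.
Variables (Om : C -> Prop) (s : R).
Hypothesis s0 : 0 < s.
Notation Wn := (Wn Om s).

(** The series are substituted one variable at a time. With the variable [j] frozen at a number [t],
    [Wn_param] expands the result in [t]; putting for [t] a series of norm [r / 4] costs the sum of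
    the powers of 1/4, bounded by 2. Hence one factor 2 for each variable. *)
Lemma Wn_comp_seq (js : seq I) (u : I -> C -> C -> C) : uniq js ->
  (forall i, i \in js -> Wn (r / 4) (u i)) ->
  (forall i, i \notin js -> exists2 c : C, cmod c <= r & u i = fun _ _ => c) ->
  Wn (2 ^+ size js * K) (fun e z => G (fun i => u i e z)).
Proof.
elim: js u => [|j js IH] u /=.
  move=> _ _ hc; have /choice[c hc'] : forall i, exists c : C, cmod c <= r /\ u i = fun _ _ => c.
    by move=> i; have [//|c c1 c2] := hc i; exists c.
  rewrite expr0 mul1r; apply: (@Wn_ext _ _ _ _ (fun _ _ => G c)).
    by move=> e z _ _; congr G; apply: funext => i; rewrite (hc' i).2.
  apply: (Wn_cst s0 (p := fun=> G c)); first exact: Hol_cst.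
  by move=> e _; apply: G_bound => i; exact: le_lt_trans (hc' i).1 rr'.
move=> /andP[jjs ujs] hW hc.
pose ut (t : C) i := if i == j then fun _ _ => t else u i.
have uval i e z : Om e -> cmod z < s -> cmod (u i e z) < r'.
  move=> he hz; have [/hW h|/hc[c c1 ->]] := boolP (i \in j :: js).
    by have := Wn_val h he hz; have := r0; have := rr'; lra.
  exact: le_lt_trans rr'.
have r4 : r / 4 <= r by have := r0; lra.
have hut t : cmod t <= r -> Wn (2 ^+ size js * K) (fun e z => G (fun i => ut t i e z)).
  move=> tr; apply: IH => // i hi; rewrite /ut; case: eqP => [e|ne].
  - by move: hi; rewrite e (negbTE jjs).
  - by apply: hW; rewrite inE hi orbT.
  - by exists t.
  - by apply: hc; rewrite inE negb_or hi andbT; apply/eqP.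
have utval t i e z : Om e -> cmod z < s -> cmod t < r' -> cmod (ut t i e z) < r'.
  by move=> he hz tr; rewrite /ut; case: eqP => // _; exact: uval.
have [||||g g1 g2] := @Wn_param _ Om s s0 (fun t e z => G (fun i => ut t i e z))
  (2 ^+ size js * K) r r' K.
- exact: hr.
- exact: hut.
- move=> e z t he hz ht.
  pose x i := if i == j then 0 else u i e z; pose d i : C := (i == j)%:R.
  have E t' : (fun i => ut t' i e z) = fun i => x i + t' * d i.
    apply: funext => i; rewrite /ut /x /d; case: eqP => _; last by rewrite mulr0 addr0.
    by rewrite mulr1 add0r.
  apply: (cdiff_ext (f := fun t => G (fun i => x i + t * d i))).
    by move=> t'; rewrite E.
  apply: G_line => i; rewrite -[x i + _](congr1 (@^~ i) (E t)); exact: utval.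
- by move=> e z t he hz ht; apply: G_bound => i; exact: utval.
have hj : Wn (r / 4) (u j) by apply: hW; rewrite mem_head.
have rh : 0 < r / 2 by have := r0; lra.
apply: (@Wn_limit _ _ _ s0 _ (fun L e z => \sum_(k < L) g k e z * u j e z ^+ k)).
  move=> L; have B0 : 0 <= 2 ^+ size js * K by rewrite mulr_ge0 ?exprn_ge0.
  have := Wn_sum s0 (index_enum 'I_L) (fun k : 'I_L => WnM s0 (g1 k) (WnX s0 k hj)).
  apply: Wn_mono => //.
  have -> : 2 ^+ (size js).+1 * K = 2 ^+ size js * K * 2 by rewrite exprS; ring.
  apply: le_trans (_ : \sum_(k < L) 2 ^+ size js * K * (1 / 4) ^+ k <= _).
    apply: ler_sum => k _; rewrite le_eqVlt; apply/orP; left; apply/eqP.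
    have -> : (r / 4) ^+ k = r ^+ k * (1 / 4) ^+ k.
      by rewrite -exprMn; congr (_ ^+ _); field.
    by rewrite mulrA divfK // gt_eqF // exprn_gt0 // r0.
  by rewrite -mulr_sumr ler_wpM2l //; apply: geo_sum_le; lra.
move=> e z he hz; have hz' : cmod (u j e z) < r / 2.
  by have := Wn_val hj he hz; have := r0; lra.
have := pser_cv rh hz' (g2 e z he hz).
rewrite (_ : (fun i => ut _ i e z) = fun i => u i e z) //.
by apply: funext => i; rewrite /ut; case: eqP => // ->.
Qed.

Lemma Wn_comp (u : I -> C -> C -> C) : (forall i, Wn (r / 4) (u i)) ->
  Wn M (fun e z => G (fun i => u i e z)).
Proof.
move=> hu; have := @Wn_comp_seq (enum I) u (enum_uniq I) (fun i _ => hu i).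
by rewrite -cardE; apply=> i; rewrite mem_enum.
Qed.

(** Cauchy's estimate along the line [u + t d]. For [|t| <= tau = r / (8 delta)] its norm stays
    within [r / 8 + r / 8], as [Wn_comp] demands, and [2 * M / tau] is the constant obtained. *)
Lemma Wn_lipschitz (u d : I -> C -> C -> C) (delta : R) : 0 < delta < r / 16 ->
  (forall i, Wn (r / 8) (u i)) -> (forall i, Wn delta (d i)) ->
  Wn (16 * M / r * delta)
    (fun e z => G (fun i => u i e z + d i e z) - G (fun i => u i e z)).
Proof.
move=> /andP[d0 dr] hu hd; pose tau := r / 8 / delta.
have rp := r0; have rp' := rr'.
have tau2 : 2 < tau by rewrite /tau ltr_pdivlMr //; lra.
have tE : tau * delta = r / 8 by rewrite divfK // gt_eqF.
have val t i e z : Om e -> cmod z < s -> cmod t < 2 * tau ->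
    cmod (u i e z + t * d i e z) < r'.
  move=> he hz ht; have := Wn_val (hu i) he hz; have h := Wn_val (hd i) he hz.
  have := cmodD (u i e z) (t * d i e z); rewrite cmodM.
  have : cmod t * cmod (d i e z) <= 2 * tau * delta.
    by apply: ler_pM; rewrite ?cmod_ge0 // ltW.
  lra.
have := @Wn_param_diff _ Om s s0 (fun t e z => G (fun i => u i e z + t * d i e z))
  M tau (2 * tau) K _ _ _ _ false tau2.
rewrite expr1 (_ : 2 * M / tau = 16 * M / r * delta); last first.
  by rewrite /tau; field; rewrite !gt_eqF.
move=> h; apply: Wn_ext (h _ _ _ _ _) => //.
- move=> e z _ _; congr (G _ - G _); apply: funext => i.
    by rewrite mul1r.
  by rewrite mul0r addr0.
- by lra.
- move=> t ht; apply: Wn_comp => i.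
  apply: Wn_mono (WnD s0 (hu i) (WnZ s0 t (hd i))) => //.
  have : cmod t * delta <= tau * delta by rewrite ler_wpM2r // ltW.
  lra.
- by move=> e z t he hz ht; apply: G_line => i; exact: val.
- by move=> e z t he hz ht; apply: G_bound => i; exact: val.
Qed.

(** Flatness is available along [d], while [u] may point in directions where the derivative does not
    vanish. The difference is therefore split into [G d - G 0], which is quadratic in [delta], and a
    mixed second difference, which gains [delta] from [Wn_lipschitz] and [mu] from the scaling of
    [u]. *)
Lemma Wn_lipschitz_flat (u d : I -> C -> C -> C) (mu delta : R) :
  0 < delta < r / 16 -> 0 < mu < r / 16 ->
  (forall i, Wn mu (u i)) -> (forall i, Wn delta (d i)) ->
  (forall e z, Om e -> cmod z < s -> hasd (fun t => G (fun i => t * d i e z)) 0 0) ->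
  Wn (256 * M / r ^+ 2 * (mu + delta) * delta)
    (fun e z => G (fun i => u i e z + d i e z) - G (fun i => u i e z)).
Proof.
move=> hdelta hmu hu hd hflat.
have rp := r0; have rp' := rr'.
have /andP[d0 dr] := hdelta; have /andP[m0 mr] := hmu.
pose tau := r / 8 / delta; pose S := r / 8 / mu.
have tau2 : 2 < tau by rewrite /tau ltr_pdivlMr //; lra.
have tE : tau * delta = r / 8 by rewrite divfK // gt_eqF.
have S2 : 2 < S by rewrite /S ltr_pdivlMr //; lra.
have SE : S * mu = r / 8 by rewrite divfK // gt_eqF.
have h1 : Wn (128 * M / r ^+ 2 * delta ^+ 2) (fun e z => G (fun i => d i e z) - G (fun=> 0)).
  have val t i e z : Om e -> cmod z < s -> cmod t < 2 * tau -> cmod (t * d i e z) < r'.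
    move=> he hz ht; have h := Wn_val (hd i) he hz; rewrite cmodM.
    have : cmod t * cmod (d i e z) <= 2 * tau * delta.
      by apply: ler_pM; rewrite ?cmod_ge0 // ltW.
    lra.
  have := @Wn_param_diff _ Om s s0 (fun t e z => G (fun i => t * d i e z))
    M tau (2 * tau) K _ _ _ _ true tau2 (fun _ => hflat).
  rewrite (_ : 2 * M / tau ^+ 2 = 128 * M / r ^+ 2 * delta ^+ 2); last first.
    by rewrite /tau; field; rewrite !gt_eqF.
  move=> h; apply: Wn_ext (h _ _ _ _) => //.
  - move=> e z _ _; congr (G _ - G _); apply: funext => i.
      by rewrite mul1r.
    by rewrite mul0r.
  - by lra.
  - move=> t ht; apply: Wn_comp => i; apply: Wn_mono (WnZ s0 t (hd i)) => //.
    have : cmod t * delta <= tau * delta by rewrite ler_wpM2r // ltW.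
    lra.
  - move=> e z t he hz ht; apply: (cdiff_ext (f := fun t => G (fun i => 0 + t * d i e z))).
      by move=> t'; congr G; apply: funext => i; rewrite add0r.
    by apply: G_line => i; rewrite add0r; exact: val.
  - by move=> e z t he hz ht; apply: G_bound => i; exact: val.
have val t i e z : Om e -> cmod z < s -> cmod t < 2 * S -> cmod (t * u i e z) < r / 2.
  move=> he hz ht; have h := Wn_val (hu i) he hz; rewrite cmodM.
  have : cmod t * cmod (u i e z) <= 2 * S * mu.
    by apply: ler_pM; rewrite ?cmod_ge0 // ltW.
  lra.
have val2 t i e z : Om e -> cmod z < s -> cmod t < 2 * S ->
    cmod (d i e z + t * u i e z) < r'.
  move=> he hz ht; have := val t i e z he hz ht; have := Wn_val (hd i) he hz.
  by have := cmodD (d i e z) (t * u i e z); lra.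
have h2 : Wn (256 * M / r ^+ 2 * mu * delta) (fun e z =>
    (G (fun i => u i e z + d i e z) - G (fun i => u i e z)) -
    (G (fun i => d i e z) - G (fun=> 0))).
  have := @Wn_param_diff _ Om s s0 (fun t e z =>
     G (fun i => t * u i e z + d i e z) - G (fun i => t * u i e z))
    (16 * M / r * delta) S (2 * S) (2 * K) _ _ _ _ false S2.
  rewrite expr1 (_ : 2 * _ / S = 256 * M / r ^+ 2 * mu * delta); last first.
    by rewrite /S; field; rewrite !gt_eqF.
  move=> h; apply: Wn_ext (h _ _ _ _ _) => //.
  - move=> e z _ _; congr (_ - _ - (_ - _)); congr G; apply: funext => i;
      by rewrite ?mul1r ?mul0r ?add0r.
  - by lra.
  - move=> t ht; apply: Wn_lipschitz => // i; apply: Wn_mono (WnZ s0 t (hu i)) => //.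
    have : cmod t * mu <= S * mu by rewrite ler_wpM2r // ltW.
    lra.
  - move=> e z t he hz ht; apply: cdiffB.
      apply: (cdiff_ext (f := fun t => G (fun i => d i e z + t * u i e z))).
        by move=> t'; congr G; apply: funext => i; rewrite addrC.
      by apply: G_line => i; exact: val2.
    apply: (cdiff_ext (f := fun t => G (fun i => 0 + t * u i e z))).
      by move=> t'; congr G; apply: funext => i; rewrite add0r.
    by apply: G_line => i; rewrite add0r; have := val t i e z he hz ht; lra.
  - move=> e z t he hz ht; apply: le_trans (cmodBD _ _) _.
    have : cmod (G (fun i => t * u i e z + d i e z)) <= K.
      by apply: G_bound => i; rewrite addrC; exact: val2.
    have : cmod (G (fun i => t * u i e z)) <= K.
      by apply: G_bound => i; have := val t i e z he hz ht; lra.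
    lra.
apply: Wn_ext (Wn_mono s0 _ (WnD s0 h1 h2)).
  by move=> e z _ _; ring.
have : 0 <= M / r ^+ 2 * delta ^+ 2.
  by rewrite mulr_ge0 ?divr_ge0 ?M0 ?exprn_ge0 ?(ltW rp) ?(ltW d0).
have -> : 128 * M / r ^+ 2 * delta ^+ 2 = 128 * (M / r ^+ 2 * delta ^+ 2) by ring.
have -> : 256 * M / r ^+ 2 * mu * delta = 256 * (M / r ^+ 2 * mu * delta) by ring.
have -> : 256 * M / r ^+ 2 * (mu + delta) * delta =
  256 * (M / r ^+ 2 * mu * delta) + 256 * (M / r ^+ 2 * delta ^+ 2) by ring.
lra.
Qed.

End Algebra.

Lemma point_lipschitz (x d : I -> C) (delta : R) : 0 < delta < r / 16 ->
  (forall i, cmod (x i) <= r / 8) -> (forall i, cmod (d i) <= delta) ->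
  cmod (G (fun i => x i + d i) - G x) <= 16 * M / r * delta.
Proof.
move=> hd hx hdd.
have h := @Wn_lipschitz (fun=> True) 1 ltr01 (fun i _ _ => x i) (fun i _ _ => d i) delta hd.
have := @Wn_val _ _ _ _ _ 0 0 (h _ _) Logic.I; rewrite cmod0; apply.
- by move=> i; apply: Wn_cst => //; exact: Hol_cst.
- by move=> i; apply: Wn_cst => //; exact: Hol_cst.
- exact: ltr01.
Qed.

End Composition.

(** * Sums and coefficients of power series *)

Section Coefficients.
Variable R : realType.
Notation C := R[i].
Implicit Types (a c : nat -> C) (f g : C -> C) (s b : R).

Definition csum c (z : C) : C :=
  xget 0 [set l | cv (fun L => \sum_(k < L) c k * z ^+ k) l].

Lemma csumE c z l : cv (fun L => \sum_(k < L) c k * z ^+ k) l -> csum c z = l.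
Proof.
move=> h; rewrite /csum; case: xgetP => [x _ hx|/(_ l)//].
exact: cv_unique hx h.
Qed.

Lemma pser_csum s b c : 0 < s -> (forall L, \sum_(k < L) cmod (c k) * s ^+ k <= b) ->
  pser s b c (csum c).
Proof.
move=> s0 hc; apply: sum_cv_upgrade => // z zs.
suff [l hl] : exists l, cv (fun L => \sum_(k < L) c k * z ^+ k) l by rewrite (csumE hl).
have b0 : 0 <= b by have := hc 0%N; rewrite big_ord0.
have q0 : 0 <= cmod z / s by rewrite divr_ge0 ?cmod_ge0 // ltW.
have q1 : cmod z / s < 1 by rewrite ltr_pdivrMr // mul1r.
have tail n m : (n <= m)%N ->
    cmod (\sum_(k < m) c k * z ^+ k - \sum_(k < n) c k * z ^+ k) <= b * (cmod z / s) ^+ n.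
  move=> nm; pose f y := \sum_(k < m) c k * y ^+ k.
  pose c' k := if (k < m)%N then c k else 0.
  have hf : pser s b c' f.
    apply: sum_cv_upgrade => // [L|y ys].
      apply: le_trans (hc L); apply: ler_sum => k _; rewrite /c'; case: ifP => // _.
      by rewrite cmod0 mul0r mulr_ge0 ?cmod_ge0 // exprn_ge0 // ltW.
    move=> e e0; exists m => L mL; rewrite -(subnKC mL) big_split_ord /= /f.
    rewrite [X in _ + X - _]big1 ?addr0.
      rewrite (eq_bigr (fun k : 'I_m => c k * y ^+ k)) ?subrr ?cmod0 // => k _.
      by rewrite /c' ltn_ord.
    by move=> k _; rewrite /c' ltnNge leq_addr /= mul0r.
  have := hf.2 z zs n; congr (cmod (_ - _) <= _).
  by apply: eq_bigr => k _; rewrite /c' (leq_trans (ltn_ord k) nm).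
apply: cv_cauchy => e e0.
have [N hN] := @geo_small_mul R b _ _ (introT andP (conj q0 q1)) b0 e0.
exists N => n m Nn Nm; have [nm|/ltnW mn] := leqP n m.
  by rewrite cmodB; apply: le_lt_trans (tail _ _ nm) (hN _ Nn).
by apply: le_lt_trans (tail _ _ mn) (hN _ Nm).
Qed.

(* The zero sequence if f is not the sum of a power series. *)
Definition coef f : nat -> C :=
  xget (fun=> 0) [set a | exists s, exists2 b, 0 < s & pser s b a f].

Lemma coefE s b a f : 0 < s -> pser s b a f -> coef f = a.
Proof.
move=> s0 hf; rewrite /coef; case: xgetP => [x _ [s' [b' s0' hx]]|/(_ a)].
  exact: (pser_uniq s0' s0 s0 hx hf).
by case; exists s, b.
Qed.

Lemma pser_coefE s b a f : 0 < s -> pser s b a f -> pser s b (coef f) f.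
Proof. by move=> s0 hf; rewrite (coefE s0 hf). Qed.

Lemma pser_trunc s b a f n : 0 < s -> pser s b a f ->
  pser s b (fun k => if (k <= n)%N then a k else 0) (fun z => \sum_(k < n.+1) a k * z ^+ k).
Proof.
move=> s0 hf; apply: sum_cv_upgrade => // [L|z zs].
  apply: le_trans (hf.1 L); apply: ler_sum => k _; case: ifP => // _.
  by rewrite cmod0 mul0r mulr_ge0 ?cmod_ge0 // exprn_ge0 // ltW.
move=> e e0; exists n.+1 => L mL; rewrite -(subnKC mL) big_split_ord /=.
rewrite [X in _ + X - _]big1 ?addr0.
  rewrite (eq_bigr (fun k : 'I_n.+1 => a k * z ^+ k)) ?subrr ?cmod0 // => k _.
  by rewrite -ltnS ltn_ord.
by move=> k _; rewrite leqNgt leq_addr /= mul0r.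
Qed.

Lemma Wn_coef (Om : C -> Prop) s b (f : C -> C -> C) : 0 < s -> Wn Om s b f ->
  (forall k, Hol Om (fun e => coef (f e) k)) /\
  (forall e, Om e -> pser s b (coef (f e)) (f e)).
Proof.
move=> s0 [a a1 a2]; split=> [k|e he]; last by apply: pser_coefE => //; exact: a2.
move=> c d d0 hd; apply: (cdiff_eqnear d0 _ (a1 k c d d0 hd)) => y hy.
by rewrite (coefE s0 (a2 y (hd y hy))).
Qed.

Lemma geometric_cv (u : nat -> C) (c : R) : 0 <= c ->
  (forall k, cmod (u k.+1 - u k) <= c / 2 ^+ k) -> exists l, cv u l.
Proof.
move=> c0 hu; have tail n j : cmod (u (n + j)%N - u n) <= 2 * c / 2 ^+ n - 2 * c / 2 ^+ (n + j).
  elim: j => [|j IH]; first by rewrite addn0 !subrr cmod0.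
  rewrite addnS; apply: le_trans (cmod_tri (u (n + j)%N) _ _) _.
  have := hu (n + j)%N.
  have -> : c / 2 ^+ (n + j) = 2 * c / 2 ^+ (n + j).+1.
    by rewrite exprS; field; rewrite expf_neq0 // pnatr_eq0.
  have E : 2 * c / 2 ^+ (n + j) = 2 * (2 * c / 2 ^+ (n + j).+1).
    by rewrite exprS; field; rewrite expf_neq0 // pnatr_eq0.
  by rewrite E in IH; lra.
have tail' n m : (n <= m)%N -> cmod (u m - u n) <= 2 * c * (1 / 2) ^+ n.
  move=> nm; rewrite -(subnKC nm); apply: le_trans (tail _ _) _.
  rewrite expr_div_n expr1n mulrA mulr1 gerBl.
  by rewrite divr_ge0 ?mulr_ge0 ?exprn_ge0.
apply: cv_cauchy => e e0.
have [N hN] := @geo_small_mul R (2 * c) (1 / 2) e ltac:(lra) ltac:(lra) e0.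
exists N => n m Nn Nm; have [nm|/ltnW mn] := leqP n m.
  by rewrite cmodB; apply: le_lt_trans (tail' _ _ nm) (hN _ Nn).
by apply: le_lt_trans (tail' _ _ mn) (hN _ Nm).
Qed.

End Coefficients.

(** * The fixed point equation in the Wiener algebra *)

Section FixedPoint.
Variables (R : realType) (nu : nat).
Notation C := R[i].
Notation I := (bool + 'I_nu)%type.
Variables (G : 'I_nu -> (I -> C) -> C) (r' r K : R).
Hypothesis hr : 0 < r < r'.
Hypothesis G_line : forall l (x d : I -> C) t, (forall i, cmod (x i + t * d i) < r') ->
  cdiff (fun t => G l (fun i => x i + t * d i)) t.
Hypothesis G_bound : forall l (x : I -> C), (forall i, cmod (x i) < r') -> cmod (G l x) <= K.

(* The coordinates are (epsilon, z, w_1, ..., w_nu). *)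
Definition pt (e z : C) (v : 'I_nu -> C) (i : I) : C :=
  match i with inl false => e | inl true => z | inr j => v j end.

Hypothesis G0 : forall l, G l (fun=> 0) = 0.
Hypothesis G_flat : forall l v, hasd (fun t => G l (fun i => t * pt 0 0 v i)) 0 0.

Let M : R := 2 ^+ #|{: I}| * K.

Variables (C0 mu delta0 : R).
Hypothesis hC0 : 0 <= C0.
Hypothesis hmu : 0 < mu < r / 64.
Hypothesis hdelta0 : 0 < delta0 <= mu.
(** [small1] bounds the image of 0 by [mu / 2], and [small2] makes the map a contraction of ratio
    1/2 on the ball of radius [mu]. The factor [3 * mu] is [mu] for the base point plus [2 * mu] for
    the difference of two elements of the ball. *)
Hypothesis small1 : nu%:R * C0 * (16 * M / r * delta0) <= mu / 2.
Hypothesis small2 : nu%:R * C0 * (256 * M / r ^+ 2 * (3 * mu)) <= 1 / 2.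

Let r0 : 0 < r. Proof. by case/andP: hr. Qed.
Let mu0 : 0 < mu. Proof. by case/andP: hmu. Qed.
Let K0 : (0 < nu)%N -> 0 <= K.
Proof.
move=> n0; apply: le_trans (@G_bound (Ordinal n0) (fun=> 0) _); rewrite ?cmod_ge0 // => i.
by rewrite cmod0; case/andP: hr; lra.
Qed.
Let nuK0 : 0 <= nu%:R * C0 * M.
Proof.
case: (posnP nu) => [->|h]; first by rewrite !mul0r.
by rewrite !mulr_ge0 ?exprn_ge0 ?K0.
Qed.

Section Contraction.
Variables (Om : C -> Prop) (s : R).
Hypothesis hs : 0 < s <= delta0.
Hypothesis hOm : forall e, Om e -> cmod e <= delta0.
Let s0 : 0 < s. Proof. by case/andP: hs. Qed.
Notation Wn := (Wn Om s).

Definition nemytskii (W : 'I_nu -> C -> C -> C) l (e z : C) : C := G l (pt e z (fun j => W j e z)).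

Lemma Wn0 (b : R) : 0 <= b -> Wn b (fun _ _ => 0).
Proof. by move=> b0; apply: (Wn_cst s0 (p := fun=> 0)) => [|e _]; [exact: Hol_cst|rewrite cmod0]. Qed.

Lemma Wn_pt W (b : R) : delta0 <= b -> (forall j, Wn b (W j)) ->
  forall i, Wn b (fun e z => pt e z (fun j => W j e z) i).
Proof.
move=> hb hW [[]|j] /=; last exact: hW.
  by apply: Wn_mono (Wn_z _ s0) => //; case/andP: hs; lra.
by apply: (Wn_cst s0 (p := id)) => [|e /hOm he]; [exact: Hol_id|lra].
Qed.

Lemma nemytskii_diff W V (b : R) : 0 < b <= 2 * mu -> (forall j, Wn mu (W j)) ->
  (forall j, Wn b (fun e z => V j e z - W j e z)) ->
  forall l, Wn (256 * M / r ^+ 2 * (mu + b) * b) (fun e z => nemytskii V l e z - nemytskii W l e z).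
Proof.
move=> hb hW hV l; have [m0 mr] := andP hmu.
(* The increment has zero components in [e] and [z], as [G_flat] requires; these coordinates are
   carried by the base point. *)
have h := @Wn_lipschitz_flat R I (G l) r' r K hr (@G_line l) (@G_bound l) Om s s0
  (fun i e z => pt e z (fun j => W j e z) i)
  (fun i e z => pt 0 0 (fun j => V j e z - W j e z) i) mu b.
apply: Wn_ext (h _ _ _ _ _).
- move=> e z he hz; rewrite /nemytskii; congr (G l _ - _); apply: funext => -[[]|j] /=;
    by rewrite ?addr0 // addrC subrK.
- by lra.
- by lra.
- by apply: Wn_pt => //; case/andP: hdelta0.
- by case=> [[]|j] /=; [apply: Wn0; lra|apply: Wn0; lra|exact: hV].
- by move=> e z he hz; exact: G_flat.
Qed.

Lemma nemytskii0 l : Wn (16 * M / r * delta0) (nemytskii (fun _ _ _ => 0) l).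
Proof.
have [m0 mr] := andP hmu; have [d0 dm] := andP hdelta0; have rp := r0.
have h := @Wn_lipschitz R I (G l) r' r K hr (@G_line l) (@G_bound l) Om s s0
  (fun i e z => 0) (fun i e z => pt e z (fun j => 0) i) delta0.
apply: Wn_ext (h _ _ _).
- move=> e z he hz; rewrite /nemytskii G0 subr0; congr (G l _); apply: funext => i.
  by rewrite add0r.
- by lra.
- by move=> i; apply: Wn0; lra.
- by apply: (@Wn_pt (fun _ _ _ => 0)) => // j; apply: Wn0; lra.
Qed.

Lemma nemytskii_Wn W : (forall j, Wn mu (W j)) -> forall l,
  Wn (16 * M / r * delta0 + 256 * M / r ^+ 2 * (mu + mu) * mu) (nemytskii W l).
Proof.
move=> hW l; have m0 := mu0.
have h := @nemytskii_diff (fun _ _ _ => 0) W mu _ _ _ l.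
apply: Wn_ext (WnD s0 (nemytskii0 l) (h _ _ _)).
- by move=> e z _ _; ring.
- by lra.
- by move=> j; apply: Wn0; exact: ltW.
- by move=> j; apply: Wn_ext (hW j) => e z _ _; rewrite subr0.
Qed.

Variable res : nat -> 'I_nu -> 'I_nu -> C -> C.
Hypothesis res_hol : forall k j l, Hol Om (res k j l).
Hypothesis res_le : forall k j l e, Om e -> cmod (res k j l e) <= C0.

(** A multiplier, acting on the coefficients of order [k] by the matrix [res k]. For
    [res k = (e k - A)^-1] it inverts [e z d/dz - A]. *)
Definition resop (g : 'I_nu -> C -> C -> C) j (e : C) : C -> C :=
  csum (fun k => \sum_l res k j l e * coef (g l e) k).

Lemma resop_pser g (b : R) e : Om e -> (forall l, pser s b (coef (g l e)) (g l e)) ->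
  forall j, pser s (nu%:R * C0 * b) (fun k => \sum_l res k j l e * coef (g l e) k) (resop g j e).
Proof.
move=> he hg j; apply: pser_csum => // L.
apply: le_trans (_ : \sum_(k < L) \sum_l C0 * (cmod (coef (g l e) k) * s ^+ k) <= _).
  apply: ler_sum => k _.
  apply: le_trans (ler_wpM2r (exprn_ge0 _ (ltW s0)) (cmod_sum _ _ _)) _.
  rewrite mulr_suml; apply: ler_sum => l _; rewrite cmodM mulrA.
  rewrite ler_wpM2r ?exprn_ge0 ?(ltW s0) // ler_wpM2r ?cmod_ge0 //.
  exact: res_le.
rewrite exchange_big /=; apply: le_trans (_ : \sum_(l < nu) C0 * b <= _).
  apply: ler_sum => l _; rewrite -mulr_sumr ler_wpM2l //; exact: (hg l).1.
by rewrite sumr_const card_ord -[(C0 * b) *+ _]mulr_natl mulrA.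
Qed.

Lemma resop_Wn g (b : R) : (forall l, Wn b (g l)) -> forall j, Wn (nu%:R * C0 * b) (resop g j).
Proof.
move=> hg j; have hc l := Wn_coef s0 (hg l).
exists (fun k e => \sum_l res k j l e * coef (g l e) k) => [k|e he].
  move=> c d d0 hd; apply: cdiff_sum => l _; apply: cdiffM.
    exact: (res_hol k j l d0 hd).
  exact: ((hc l).1 k c d d0 hd).
by apply: resop_pser => // l; exact: (hc l).2.
Qed.

Lemma resopB g h (b b' : R) : (forall l, Wn b (g l)) -> (forall l, Wn b' (h l)) ->
  forall j e z, Om e -> cmod z < s ->
  resop (fun l e z => g l e z - h l e z) j e z = resop g j e z - resop h j e z.
Proof.
move=> hg hh j e z he hz.
have cg l := (Wn_coef s0 (hg l)).2 e he; have ch l := (Wn_coef s0 (hh l)).2 e he.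
have c l := coefE s0 (pserB s0 (cg l) (ch l)).
apply: csumE; apply: cv_ext (pser_cv s0 hz (pserB s0 (resop_pser he cg j) (resop_pser he ch j))).
move=> L; apply: eq_bigr => k _; congr (_ * _); rewrite -sumrB.
by apply: eq_bigr => l _; rewrite c mulrBr.
Qed.

Fixpoint picard n : 'I_nu -> C -> C -> C :=
  if n is m.+1 then resop (nemytskii (picard m)) else fun _ _ _ => 0.

Let e1 : nu%:R * C0 * (256 * M / r ^+ 2 * (mu + mu) * mu) <= mu / 2.
Proof.
have m0 := mu0.
have -> : nu%:R * C0 * (256 * M / r ^+ 2 * (mu + mu) * mu) =
  nu%:R * C0 * (256 * M / r ^+ 2 * (3 * mu)) * (2 / 3) * mu by field; exact: lt0r_neq0 r0.
by have := small2; nra.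
Qed.

Lemma contract_le (b : R) : 0 < b <= 2 * mu ->
  nu%:R * C0 * (256 * M / r ^+ 2 * (mu + b) * b) <= b / 2.
Proof.
move=> hb; have rp := r0.
have h : 0 <= nu%:R * C0 * M / r ^+ 2 by rewrite divr_ge0 ?nuK0 // exprn_ge0 // ltW.
have h2 : 256 * (nu%:R * C0 * M / r ^+ 2) * (3 * mu) <= 1 / 2.
  apply: le_trans small2; rewrite le_eqVlt; apply/orP; left; apply/eqP; ring.
have -> : nu%:R * C0 * (256 * M / r ^+ 2 * (mu + b) * b) =
  (256 * (nu%:R * C0 * M / r ^+ 2) * (mu + b)) * b by ring.
have b0 : 0 <= b by lra.
have h3 : 256 * (nu%:R * C0 * M / r ^+ 2) * (mu + b) <=
    256 * (nu%:R * C0 * M / r ^+ 2) * (3 * mu).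
  by apply: ler_wpM2l; [rewrite mulr_ge0|lra].
by rewrite [b / 2]mulrC ler_wpM2r //; lra.
Qed.

Lemma nemytskii_stable W : (forall j, Wn mu (W j)) -> forall j, Wn mu (resop (nemytskii W) j).
Proof.
move=> hW j; apply: (Wn_mono s0 _ (resop_Wn (nemytskii_Wn hW) j)).
by rewrite mulrDr; have := e1; have := small1; lra.
Qed.

Lemma nemytskii_contract W V (b : R) : 0 < b <= 2 * mu ->
  (forall j, Wn mu (W j)) -> (forall j, Wn mu (V j)) ->
  (forall j, Wn b (fun e z => V j e z - W j e z)) ->
  forall j, Wn (b / 2) (fun e z => resop (nemytskii V) j e z - resop (nemytskii W) j e z).
Proof.
move=> hb hW hV hd j; have h := resop_Wn (nemytskii_diff hb hW hd) j.
apply: Wn_ext (Wn_mono s0 (contract_le hb) h) => e z he hz.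
exact: (resopB (nemytskii_Wn hV) (nemytskii_Wn hW)).
Qed.

Lemma picard_Wn n j : Wn mu (picard n j).
Proof.
elim: n j => [|n IH] j /=; first by apply: Wn0; exact: ltW mu0.
exact: nemytskii_stable.
Qed.

Lemma picard_step n j : Wn (mu / 2 ^+ n) (fun e z => picard n.+1 j e z - picard n j e z).
Proof.
have m0 := mu0; elim: n j => [|n IH] j.
  rewrite expr0 divr1; apply: Wn_ext (picard_Wn 1 j) => e z _ _.
  by rewrite subr0.
have p0 : 0 < (2 ^+ n : R) by rewrite exprn_gt0.
have p1 : 1 <= (2 ^+ n : R) by rewrite exprn_ege1 // ler1n.
have -> : mu / 2 ^+ n.+1 = mu / 2 ^+ n / 2 by rewrite exprS; field; rewrite gt_eqF.
apply: nemytskii_contract (picard_Wn n) (picard_Wn n.+1) IH j.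
by rewrite divr_gt0 //= ler_pdivrMr //; nra.
Qed.

Lemma picard_tail n m j : Wn (2 * mu / 2 ^+ n) (fun e z => picard (n + m)%N j e z - picard n j e z).
Proof.
have m0 := mu0; suff h : Wn (2 * mu / 2 ^+ n - 2 * mu / 2 ^+ (n + m))
    (fun e z => picard (n + m)%N j e z - picard n j e z).
  apply: (Wn_mono s0 _ h); rewrite gerBl divr_ge0 ?exprn_ge0 //; lra.
elim: m => [|m IH].
  by rewrite addn0 subrr; apply: Wn_ext (Wn0 (lexx 0)) => e z _ _; rewrite subrr.
apply: Wn_ext (Wn_mono s0 _ (WnD s0 IH (picard_step (n + m)%N j))).
  by move=> e z _ _; rewrite addnS /=; ring.
rewrite addnS exprS le_eqVlt; apply/orP; left; apply/eqP.
by field; rewrite !expf_neq0 // pnatr_eq0.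
Qed.

Theorem contraction_solution : exists w : 'I_nu -> C -> C -> C,
  [/\ forall j, Wn mu (w j),
      forall l, Wn (16 * M / r * delta0 + 256 * M / r ^+ 2 * (mu + mu) * mu) (nemytskii w l) &
      forall j e k, Om e -> coef (w j e) k = \sum_l res k j l e * coef (nemytskii w l e) k].
Proof.
have m0 := mu0.
pose w j e z := xget 0 [set l | cv (fun n => picard n j e z) l].
have hw j e z : Om e -> cmod z < s -> cv (fun n => picard n j e z) (w j e z).
  move=> he hz; have [l hl] : exists l, cv (fun n => picard n j e z) l.
    apply: (@geometric_cv _ _ mu (ltW m0)) => k; exact: Wn_val (picard_step k j) he hz.
  by rewrite /w; case: xgetP => [x _ //|/(_ l)].
have wW j : Wn mu (w j).
  by apply: (Wn_limit s0 (fun n => picard_Wn n j)) => e z he hz; exact: hw.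
have wd n j : Wn (2 * mu / 2 ^+ n) (fun e z => w j e z - picard n j e z).
  apply: (Wn_limit s0 (fun m => picard_tail n m j)) => e z he hz.
  apply: cvB (cv_cst _) => d d0; have [N hN] := hw j e z he hz d d0.
  by exists N => m Nm; apply: hN; exact: leq_trans Nm (leq_addl _ _).
(* The image of [w] and the next iterate differ by at most [mu / 2 ^ n], while the iterates converge
   to [w]. *)
have fix_ j e z : Om e -> cmod z < s -> resop (nemytskii w) j e z = w j e z.
  move=> he hz; apply: (@cv_unique _ (fun n => picard n.+1 j e z)); last first.
    by move=> d /(hw j e z he hz)[N hN]; exists N => n Nn; apply: hN; exact: leqW.
  apply: (@cv_squeeze _ (fun n => mu * (1 / 2) ^+ n)).
    by move=> d d0; apply: geo_small_mul => //; [lra|exact: ltW].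
  exists 0%N => n _; rewrite cmodB expr_div_n expr1n mulrA mulr1.
  have p0 : 0 < (2 ^+ n : R) by rewrite exprn_gt0.
  have p1 : 1 <= (2 ^+ n : R) by rewrite exprn_ege1 // ler1n.
  have h := nemytskii_contract _ (picard_Wn n) wW (wd n) j.
  have := Wn_val (h _) he hz; rewrite (_ : 2 * mu / 2 ^+ n / 2 = mu / 2 ^+ n).
    apply; rewrite divr_gt0 ?mulr_gt0 //= ler_pdivrMr //; nra.
  by field; rewrite gt_eqF.
exists w; split=> //; first exact: nemytskii_Wn.
move=> j e k he; have hc l := (Wn_coef s0 (nemytskii_Wn wW l)).2 e he.
by rewrite (pser_uniq s0 s0 s0 ((Wn_coef s0 (wW j)).2 e he) (resop_pser he hc j)
  (fun z hz => esym (fix_ j e z he hz))).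
Qed.

End Contraction.

(** * Stability of the fixed point under a residual *)

Section Perturbation.

(** Over a single parameter value holomorphy is no condition, so the estimates of the algebra can be
    applied with [e0] fixed. *)
Lemma Hol_point (e0 : C) (p : C -> C) : Hol (fun e => e = e0) p.
Proof.
move=> c d d0 hd; exfalso.
have h1 : c = e0 by apply: hd; rewrite subrr cmod0.
have : c + (d / 2)%:C = e0.
  by apply: hd; rewrite addrAC subrr add0r cmodC_ge0; lra.
rewrite -h1 => /eqP; rewrite -subr_eq0 addrAC subrr add0r -cmod_eq0 cmodC_ge0; last lra.
by move=> /eqP; lra.
Qed.

Lemma pser_finite_sum (a : nat -> C) n L (s : R) : 0 < s ->
  (forall k, (n < k)%N -> a k = 0) ->
  \sum_(k < L) cmod (a k) * s ^+ k <= \sum_(k < n.+1) cmod (a k) * s ^+ k.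
Proof.
move=> s0 ha; have nn k : 0 <= cmod (a k) * s ^+ k.
  by rewrite mulr_ge0 ?cmod_ge0 // exprn_ge0 // ltW.
have [Ln|/ltnW nL] := leqP L n.+1.
  by rewrite -(subnKC Ln) big_split_ord /= lerDl sumr_ge0.
rewrite -(subnKC nL) big_split_ord /= [X in _ + X]big1 ?addr0 // => k _.
by rewrite ha ?cmod0 ?mul0r // addSn ltnS leq_addr.
Qed.

Variables (e0 : C) (s : R) (n : nat) (rs : nat -> 'I_nu -> 'I_nu -> C).
Hypothesis hs : 0 < s <= delta0.
Hypothesis he0 : cmod e0 <= delta0.
Hypothesis rs_le : forall k j l, cmod (rs k j l) <= C0.
Variables (w D : 'I_nu -> C -> C) (c a h : 'I_nu -> nat -> C).
Let nemz (W : 'I_nu -> C -> C) l z : C := G l (pt e0 z (fun j => W j z)).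
Hypothesis hw : forall j, pser s mu (c j) (w j).
Hypothesis hc : forall j k, (k <= n)%N -> c j k = \sum_l rs k j l * coef (nemz w l) k.
Hypothesis hc0 : forall j k, (n < k)%N -> c j k = 0.
Hypothesis hD : forall j, pser s mu (a j) (D j).
Hypothesis ha : forall j k, (k <= n)%N ->
  a j k = \sum_l rs k j l * (coef (nemz D l) k + h l k).

Let s0 : 0 < s. Proof. by case/andP: hs. Qed.
Let Om : C -> Prop := fun e => e = e0.
Let hOm e : Om e -> cmod e <= delta0. Proof. by move=> ->. Qed.

Let Wn_point (b : R) (W : C -> C) x : pser s b x W -> Wn Om s b (fun _ => W).
Proof. by exists (fun k _ => x k) => [k|e _] //; exact: Hol_point. Qed.

Let nemz_pser (W : 'I_nu -> C -> C) x : (forall j, pser s mu (x j) (W j)) ->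
  forall l, exists b, pser s b (coef (nemz W l)) (nemz W l).
Proof.
move=> hW l; have := @nemytskii_Wn Om s hs hOm (fun j _ => W j) (fun j => Wn_point (hW j)) l.
move=> /(Wn_coef s0)[_ /(_ e0 erefl) H].
by exists (16 * M / r * delta0 + 256 * M / r ^+ 2 * (mu + mu) * mu).
Qed.

(** [c] solves the truncated equation exactly; [a] solves it with the residual [h], and only in
    orders at most [n]. By the contraction, the largest l1 distance [del] of their components up to
    order [n] satisfies [del <= del / 2 + P], where [P] is the contribution of the residual. *)
Theorem perturbation j k : (k <= n)%N -> cmod (c j k - a j k) * s ^+ k <=
  2 * (C0 * \sum_(l < nu) \sum_(k < n.+1) cmod (h l k) * s ^+ k).
Proof.
set P := C0 * _ => kn; have m0 := mu0; have rp := r0; have sp := s0.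
pose Dh j z := \sum_(k < n.+1) a j k * z ^+ k.
pose ah j k := if (k <= n)%N then a j k else 0.
have hDh i : pser s mu (ah i) (Dh i) by exact: pser_trunc.
(* Coefficients of order at most [n] of the image depend only on those of the argument: the two
   arguments differ by [O(z ^ (n + 1))], and by the pointwise Lipschitz bound so do the images. *)
have low l i : (i <= n)%N -> coef (nemz Dh l) i = coef (nemz D l) i.
  move=> hi; have [b1 h1] := nemz_pser hDh l; have [b2 h2] := nemz_pser hD l.
  apply/eqP; rewrite eq_sym -subr_eq0; apply/eqP.
  have [||H _] := @pser_order _ s s _ (16 * M / r * (mu / s ^+ n.+1)) _ _ n.+1 _ (pserB sp h2 h1).
  - by rewrite sp lexx.
  - move=> z zs; have tail i' : cmod (D i' z - Dh i' z) <= mu * (cmod z / s) ^+ n.+1.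
      exact: (hD i').2.
    have [z0|z0] := eqVneq z 0.
      have -> : nemz D l z = nemz Dh l z.
        congr (G l _); congr (pt _ _ _); apply: funext => i'.
        apply/eqP; rewrite -subr_eq0 -cmod_eq0 eq_le cmod_ge0 andbT.
        by apply: le_trans (tail i') _; rewrite z0 cmod0 mul0r expr0n mulr0.
      by rewrite subrr cmod0 z0 cmod0 expr0n mulr0.
    have z0' : 0 < cmod z by rewrite cmod_gt0.
    have q0 : 0 < cmod z / s by rewrite divr_gt0.
    have q1 : (cmod z / s) ^+ n.+1 <= 1.
      by rewrite exprn_ile1 ?(ltW q0) // ler_pdivrMr // mul1r ltW.
    have q2 : 0 < (cmod z / s) ^+ n.+1 by rewrite exprn_gt0.
    have [mr1 mr2] := andP hmu; have [d1 d2] := andP hdelta0; have [_ s1] := andP hs.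
    have r8 : mu <= r / 8 by lra.
    have pl := @point_lipschitz R I (G l) r' r K hr (@G_line l) (@G_bound l)
      (pt e0 z (fun i => Dh i z)) (pt 0 0 (fun i => D i z - Dh i z))
      (mu * (cmod z / s) ^+ n.+1).
    rewrite (_ : 16 * M / r * _ * cmod z ^+ n.+1 =
      16 * M / r * (mu * (cmod z / s) ^+ n.+1)); last first.
      by rewrite expr_div_n; ring.
    rewrite (_ : nemz D l z = G l (fun i => pt e0 z (fun i => Dh i z) i +
        pt 0 0 (fun i => D i z - Dh i z) i)); last first.
      congr (G l _); apply: funext => -[[]|i'] /=; rewrite ?addr0 //.
      by rewrite addrC subrK.
    apply: pl.
    - rewrite mulr_gt0 //=; apply: le_lt_trans (_ : mu < _); last by lra.
      by rewrite ler_piMr // ltW.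
    - case=> [[]|i'] /=.
      + exact: le_trans (ltW zs) (le_trans s1 (le_trans d2 r8)).
      + exact: le_trans he0 (le_trans d2 r8).
      + exact: le_trans (pser_val zs (hDh i')) r8.
    - case=> [[]|i'] /=; last exact: tail.
        by rewrite cmod0 mulr_ge0 // ltW.
      by rewrite cmod0 mulr_ge0 // ltW.
  - by rewrite H.
pose sig i := \sum_(k < n.+1) cmod (c i k - a i k) * s ^+ k.
pose del := \big[Num.max/0]_(i < nu) sig i.
have sig_le i : sig i <= del by apply: le_bigmax.
have del_ge0 : 0 <= del by apply: bigmax_ge_id.
suff del_le : del <= 2 * P.
  apply: le_trans del_le; apply: le_trans (sig_le j).
  have kn' : (k < n.+1)%N by [].
  rewrite /sig (bigD1 (Ordinal kn')) //= lerDl sumr_ge0 // => i _.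
  by rewrite mulr_ge0 ?cmod_ge0 // exprn_ge0 // ltW.
have P0 : 0 <= P.
  rewrite mulr_ge0 // sumr_ge0 // => l _; rewrite sumr_ge0 // => i _.
  by rewrite mulr_ge0 ?cmod_ge0 // exprn_ge0 // ltW.
have [del0|del0] := leP del 0; first lra.
have sigE i : sig i = \sum_(k < n.+1) cmod (c i k - ah i k) * s ^+ k.
  by apply: eq_bigr => i' _; rewrite /ah -ltnS ltn_ord.
have del2 : del <= 2 * mu.
  apply: bigmax_le => [|i _]; first lra.
  by rewrite sigE; have := (pserB sp (hw i) (hDh i)).1 n.+1; lra.
have hWd i : pser s del (fun k => c i k - ah i k) (fun z => w i z - Dh i z).
  split=> [L|z zs L].
    apply: le_trans (sig_le i); rewrite sigE.
    apply: (pser_finite_sum (a := fun k => c i k - ah i k)) => // k' hk'.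
    by rewrite hc0 // /ah leqNgt hk' subrr.
  have [_ ] : pser s del (fun k => c i k - ah i k) (fun z => w i z - Dh i z).
    apply: sum_cv_upgrade => // [L'|y ys].
      apply: le_trans (sig_le i); rewrite sigE.
      apply: (pser_finite_sum (a := fun k => c i k - ah i k)) => // k' hk'.
      by rewrite hc0 // /ah leqNgt hk' subrr.
    exact: pser_cv ys (pserB sp (hw i) (hDh i)).
  by apply.
have hb : 0 < del <= 2 * mu by rewrite del0.
have dif := @nemytskii_diff Om s hs hOm (fun i _ => Dh i) (fun i _ => w i) del hb
  (fun i => Wn_point (hDh i)) (fun i => Wn_point (hWd i)).
have difc l L : \sum_(k < L) cmod (coef (nemz w l) k - coef (nemz Dh l) k) * s ^+ k <=
    256 * M / r ^+ 2 * (mu + del) * del.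
  have [_ /(_ e0 erefl)] := Wn_coef sp (dif l).
  have [b1 h1] := nemz_pser hw l; have [b2 h2] := nemz_pser hDh l.
  by rewrite (coefE sp (pserB sp h1 h2)) => -[].
suff : del <= del / 2 + P by lra.
  apply: bigmax_le => [|i _]; first by rewrite addr_ge0 // divr_ge0.
apply: le_trans (_ : \sum_(k < n.+1) \sum_(l < nu) (C0 *
      (cmod (coef (nemz w l) k - coef (nemz Dh l) k) * s ^+ k) +
      C0 * (cmod (h l k) * s ^+ k)) <= _).
    apply: ler_sum => k' _; have hk' : (k' <= n)%N by rewrite -ltnS.
    rewrite hc // ha // -sumrB.
    apply: le_trans (ler_wpM2r (exprn_ge0 _ (ltW sp)) (cmod_sum _ _ _)) _.
    rewrite mulr_suml; apply: ler_sum => l _; rewrite -low //.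
    rewrite -mulrBr opprD addrA cmodM -mulrDr -mulrDl -mulrA.
    apply: ler_pM; rewrite ?cmod_ge0 ?mulr_ge0 ?cmod_ge0 ?exprn_ge0 ?(ltW sp) //.
    by apply: ler_wpM2r; [rewrite exprn_ge0 // ltW|exact: cmodBD].
  rewrite exchange_big /=; under eq_bigr do rewrite big_split /= -!mulr_sumr.
  rewrite big_split /= -!mulr_sumr -/P lerD2r.
  apply: le_trans (contract_le hb).
  apply: le_trans (_ : C0 * (\sum_(l < nu) 256 * M / r ^+ 2 * (mu + del) * del) <= _).
    by rewrite ler_wpM2l //; apply: ler_sum => l _; exact: difc.
  by rewrite sumr_const card_ord -[(_ * del) *+ _]mulr_natl mulrCA mulrA.
Qed.

End Perturbation.
End FixedPoint.

(** * Resolvent bounds *)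

Section Resolvent.
Variable R : realType.
Notation C := R[i].

Lemma cmod_prod (I : finType) (F : I -> C) : cmod (\prod_i F i) = \prod_i cmod (F i).
Proof.
apply: (big_ind2 (fun a b => cmod a = b)) => //; first exact: cmod1.
by move=> a b c d <- <-; exact: cmodM.
Qed.

Lemma cmod_prod_seq (T : eqType) (s : seq T) (F : T -> C) :
  cmod (\prod_(i <- s) F i) = \prod_(i <- s) cmod (F i).
Proof.
apply: (big_ind2 (fun a b => cmod a = b)) => //; first exact: cmod1.
by move=> a b c d <- <-; exact: cmodM.
Qed.

Lemma cmod_det_le n (B : 'M[C]_n) (b : R) : (forall i j, cmod (B i j) <= b) ->
  cmod (\det B) <= n`!%:R * b ^+ n.
Proof.
move=> hB; apply: le_trans (cmod_sum _ _ _) _.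
have -> : n`!%:R * b ^+ n = \sum_(s : 'S_n) b ^+ n.
  by rewrite sumr_const -cardsE cardsT card_Sn -[(b ^+ n) *+ _]mulr_natl.
apply: ler_sum => s _; rewrite cmodM cmodX cmodN cmod1 expr1n mul1r cmod_prod.
apply: le_trans (_ : \prod_(i < n) b <= _); last by rewrite prodr_const card_ord.
by apply: ler_prod => i _; rewrite cmod_ge0 hB.
Qed.

Lemma cmod_adj_le n (B : 'M[C]_n) (b : R) : (forall i j, cmod (B i j) <= b) ->
  forall i j, cmod ((\adj B) i j) <= n.-1`!%:R * b ^+ n.-1.
Proof.
move=> hB i j; rewrite mxE /cofactor cmodM cmodX cmodN cmod1 expr1n mul1r.
by apply: cmod_det_le => i' j'; rewrite !mxE.
Qed.

Lemma char_poly_eval n (A : 'M[C]_n) x : (char_poly A).[x] = \det (x%:M - A).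
Proof.
rewrite -[LHS]/(horner_eval x _) -det_map_mx; congr (\det _).
apply/matrixP => i j; rewrite /char_poly_mx !mxE /= /horner_eval hornerD hornerN hornerC.
by rewrite hornerMn hornerX.
Qed.

(** The region to which the argument [e k] of the resolvent is confined: a cone around the positive
    axis, [kappa'] being the cosine of its half opening, together with a small disc. *)
Definition spectral_gap (kappa' d : R) (x : C) : Prop :=
  kappa' * cmod x <= complex.Re x \/ cmod x <= d.

(** For [x] in the cone, let [k] be the midpoint of [kappa] and [kappa']: the function [Re - k |.|]
    is at least [(kappa' - kappa) / 2 |x|] at [x], at most [- (kappa' - kappa) / 2 |l|] at [l], and
    has Lipschitz constant 2. For [x] small the reverse triangle inequality suffices. *)
Lemma cone_separation (kappa kappa' : R) (x l : C) :
  -1 <= kappa -> kappa < kappa' -> kappa' <= 1 ->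
  complex.Re l <= kappa * cmod l -> spectral_gap kappa' (cmod l / 2) x ->
  (kappa' - kappa) / 8 * (cmod x + cmod l) <= cmod (x - l).
Proof.
move=> k1 k2 k3 hl; have x0 := cmod_ge0 x; have l0 := cmod_ge0 l.
case=> hx; last first.
  by have := cmod_lb l x; rewrite cmodB; nra.
have h1 := Re_le_cmod (x - l); rewrite raddfB /= in h1.
have h2 := cmod_lb x l; have h3 := cmod_lb l x; rewrite cmodB in h3.
have [h4 _] := andP (introT andP (conj (ler_norm (complex.Re x - complex.Re l)) isT)).
set D := cmod (x - l) in h1 h2 h3 *; set k := (kappa + kappa') / 2.
have kb : -1 <= k <= 1 by rewrite /k; lra.
have h5 : (kappa' - kappa) / 2 * (cmod x + cmod l) <=
   (complex.Re x - complex.Re l) - k * (cmod x - cmod l) by rewrite /k; nra.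
have h6 : - (k * (cmod x - cmod l)) <= D.
  have [s|s] := leP 0 (cmod x - cmod l); nra.
have D0 : 0 <= D by exact: cmod_ge0.
have : (kappa' - kappa) / 8 * (cmod x + cmod l) = (kappa' - kappa) / 2 * (cmod x + cmod l) / 4.
  by field.
lra.
Qed.

Lemma seq_gap (ls : seq C) : (forall l, l \in ls -> l != 0) ->
  exists2 d : R, 0 < d <= 1 & forall l, l \in ls -> d <= cmod l.
Proof.
elim: ls => [|l ls IH] h; first by exists 1; rewrite // ltr01 lexx.
have [l' hl'|d d0 hd] := IH; first by apply: h; rewrite inE hl' orbT.
have l0 : 0 < cmod l by rewrite cmod_gt0 h // mem_head.
exists (Num.min d (cmod l)) => [|l'].
  by rewrite lt_min l0 ge_min; case/andP: d0 => -> ->.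
rewrite inE => /orP[/eqP ->|/hd h']; first by rewrite ge_min lexx orbT.
by rewrite ge_min h'.
Qed.

(** The bound must hold for arbitrarily large [x]. It follows from Cramer's rule: the minors grow at
    most like [(1 + |x|) ^ (n - 1)], while the determinant, a product over the eigenvalues, is at
    least of order [(1 + |x|) ^ n]. *)
Lemma resolvent_bound n (A : 'M[C]_n) (kappa kappa' : R) :
  -1 <= kappa -> kappa < kappa' -> kappa' <= 1 ->
  (forall l, eigenvalue A l -> l != 0 /\ complex.Re l <= kappa * cmod l) ->
  exists B d : R, [/\ 0 < B, 0 < d & forall x, spectral_gap kappa' d x ->
    (x%:M - A \in unitmx) /\ forall i j, cmod (invmx (x%:M - A) i j) <= B].
Proof.
move=> k1 k2 k3 hA.
have [ls hls] := closed_field_poly_normal (char_poly A).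
have hmon : char_poly A = \prod_(z <- ls) ('X - z%:P).
  by rewrite hls (monicP (char_poly_monic A)) scale1r.
have szls : size ls = n.
  by have := size_char_poly A; rewrite hmon size_prod_XsubC => -[].
have eig l : l \in ls -> l != 0 /\ complex.Re l <= kappa * cmod l.
  by move=> hl; apply: hA; rewrite eigenvalue_root_char hmon root_prod_XsubC.
have [d /andP[d0 d1] hd] := seq_gap (fun l hl => (eig l hl).1).
have [m m1 hm] : exists2 m : R, 1 <= m & forall i j, cmod (A i j) <= m.
  exists (1 + \sum_i \sum_j cmod (A i j)).
    by rewrite lerDl sumr_ge0 // => i _; rewrite sumr_ge0 // => j _; exact: cmod_ge0.
  move=> i j; rewrite (bigD1 i) //= (bigD1 j) //=.
  have : 0 <= \sum_(i0 < n | i0 != j) cmod (A i i0) by apply: sumr_ge0 => *; exact: cmod_ge0.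
  have : 0 <= \sum_(i0 < n | i0 != i) \sum_j cmod (A i0 j).
    by apply: sumr_ge0 => i' _; apply: sumr_ge0 => *; exact: cmod_ge0.
  lra.
(* Since [d <= 1] and every eigenvalue [l] has modulus at least [d], [|x| + |l| >= d (1 + |x|)]. *)
pose c := (kappa' - kappa) / 8 * d.
have c0 : 0 < c by rewrite mulr_gt0 // divr_gt0 // subr_gt0.
exists (n.-1`!%:R * m ^+ n.-1 / c ^+ n), (d / 2); split.
- by rewrite divr_gt0 ?mulr_gt0 ?ltr0n ?fact_gt0 ?exprn_gt0 //; lra.
- by rewrite divr_gt0.
move=> x hx; have x0 := cmod_ge0 x.
have hfac l : l \in ls -> c * (1 + cmod x) <= cmod (x - l).
  move=> hl; have dl := hd l hl.
  apply: le_trans (cone_separation k1 k2 k3 (eig l hl).2 _); last first.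
    by case: hx => [h|h]; [left|right; lra].
  rewrite (_ : c * _ = (kappa' - kappa) / 8 * (d * (1 + cmod x))); last by rewrite /c; ring.
  by rewrite ler_pM2l ?divr_gt0 ?subr_gt0 //; nra.
clearbody c; have hdet : (c * (1 + cmod x)) ^+ n <= cmod (\det (x%:M - A)).
  rewrite -char_poly_eval hmon horner_prod cmod_prod_seq -{1}szls.
  rewrite -[X in X <= _](_ : \prod_(l <- ls) (c * (1 + cmod x)) = _); last first.
    by rewrite big_const_seq count_predT iter_mulr_1.
  rewrite [leLHS]big_seq [leRHS]big_seq; apply: ler_prod => l hl.
  by rewrite hornerXsubC hfac // andbT mulr_ge0 // ?(ltW c0) //; lra.
have cx0 : 0 < c * (1 + cmod x) by rewrite mulr_gt0 //; lra.
have det0 : 0 < cmod (\det (x%:M - A)) by apply: lt_le_trans hdet; rewrite exprn_gt0.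
have hunit : x%:M - A \in unitmx by rewrite unitmxE unitfE -cmod_gt0.
split=> // i j; rewrite /invmx hunit mxE cmodM cmodV mulrC ler_pdivrMr //.
have hent i' j' : cmod ((x%:M - A) i' j') <= m * (1 + cmod x).
  rewrite !mxE; apply: le_trans (cmodBD _ _) _; have := hm i' j'.
  have : cmod (x *+ (i' == j')) <= cmod x by case: eqP; rewrite ?mulr1n // mulr0n cmod0.
  by nra.
apply: le_trans (cmod_adj_le hent i j) _.
have h1 : (1 + cmod x) ^+ n.-1 <= cmod (\det (x%:M - A)) / c ^+ n.
  rewrite ler_pdivlMr ?exprn_gt0 //; apply: le_trans hdet.
  rewrite exprMn [leLHS]mulrC ler_pM2l ?exprn_gt0 //.
  by apply: ler_weXn2l; [lra|exact: leq_pred].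
rewrite exprMn mulrA (_ : n.-1`!%:R * m ^+ n.-1 / c ^+ n * _ =
  n.-1`!%:R * m ^+ n.-1 * (cmod (\det (x%:M - A)) / c ^+ n)); last by ring.
by rewrite ler_wpM2l // mulr_ge0 // exprn_ge0 //; lra.
Qed.

Lemma cdiff_prod (I : finType) (F : I -> C -> C) z : (forall i, cdiff (F i) z) ->
  cdiff (fun x => \prod_i F i x) z.
Proof.
move=> h; elim: (index_enum I) => [|i r IH].
  by apply: (cdiff_ext (f := fun=> 1)) => [x|]; [rewrite big_nil|exact: cdiff_cst].
apply: (cdiff_ext (f := fun x => F i x * \prod_(i <- r) F i x)) => [x|].
  by rewrite big_cons.
exact: cdiffM.
Qed.

Lemma cdiff_det n (B : C -> 'M[C]_n) z : (forall i j, cdiff (fun x => B x i j) z) ->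
  cdiff (fun x => \det (B x)) z.
Proof.
move=> h; apply: cdiff_sum => s _; apply: cdiffZ.
by apply: cdiff_prod => i; exact: h.
Qed.

Lemma Hol_resolvent (Om : C -> Prop) n (A : 'M[C]_n) (k : C) i j :
  (forall e, Om e -> (e * k)%:M - A \in unitmx) ->
  Hol Om (fun e => invmx ((e * k)%:M - A) i j).
Proof.
move=> hu c d d0 hd; have ent i' j' : cdiff (fun e => ((e * k)%:M - A) i' j') c.
  apply: (cdiff_ext (f := fun e => e * (k *+ (i' == j')) - A i' j')).
    by move=> e; rewrite !mxE mulrnAr.
  apply: cdiffB; last exact: cdiff_cst.
  by apply: cdiffM; [exact: cdiff_id|exact: cdiff_cst].
apply: (cdiff_eqnear (f := fun e => (\det ((e * k)%:M - A))^-1 * (\adj ((e * k)%:M - A)) i j) d0).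
  by move=> e /hd /hu h; rewrite /invmx h [in RHS]mxE.
apply: cdiffM.
  apply: cdiffV; first exact: (cdiff_det (B := fun e => (e * k)%:M - A)).
  by rewrite -unitfE -unitmxE; apply: hu; apply: hd; rewrite subrr cmod0.
apply: (cdiff_ext (f := fun e => (-1) ^+ (j + i) * \det (row' j (col' i ((e * k)%:M - A))))).
  by move=> e; rewrite mxE.
apply: cdiffZ; apply: (cdiff_det (B := fun e => row' j (col' i ((e * k)%:M - A)))) => i' j'.
by apply: cdiff_ext (ent _ _) => e; rewrite [in RHS]mxE [in RHS]mxE.
Qed.

Lemma cos_lt_iff (t b : R) : - pi <= t <= pi -> 0 <= b <= pi ->
  (cos b < cos t) = (`|t| < b).
Proof.
move=> ht hb; have -> : cos t = cos `|t|.
  by have [h|h] := leP 0 t; rewrite ?(ger0_norm h) ?(ltr0_norm h) ?cosN.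
by rewrite ltr_cos // in_itv /= ?hb // normr_ge0 ler_norml.
Qed.

(** For half openings up to [pi] the condition on the argument becomes an inequality between [Re z]
    and [|z|], a form in which openness and stability under positive multiples are immediate. *)
Lemma arg_cone (z : C) t (b : R) : is_arg z t -> `|t| < b -> 0 < cmod z -> b <= pi ->
  cos b * cmod z < complex.Re z.
Proof.
move=> hz tb z0 bp; rewrite [X in _ < complex.Re X]hz /= mulrC ltr_pM2l // cos_lt_iff //.
  by rewrite -ler_norml; lra.
by have := normr_ge0 t; lra.
Qed.

Lemma cone_arg (z : C) (b : R) : 0 < cmod z -> 0 <= b <= pi ->
  cos b * cmod z < complex.Re z -> exists2 t, is_arg z t & `|t| < b.
Proof.
move=> z0 hb hz; have [t ht harg] := arg_exists (z := z) ltac:(by rewrite -cmod_gt0).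
exists t => //; rewrite -cos_lt_iff //; last lra.
by move: hz; rewrite [X in _ < complex.Re X]harg /= mulrC ltr_pM2l.
Qed.

End Resolvent.

(** * Comparison with the library's differentiability *)

Section AbstractDifferentiability.
Variable K : numFieldType.

Lemma nbhs_disc (x : K^o) (P : K^o -> Prop) :
  (\forall z \near x, P z) <-> exists2 d : K, 0 < d & forall z, `|z - x| < d -> P z.
Proof.
split=> [/nbhs_ballP[d d0 hd]|[d d0 hd]].
  by exists d => // z zd; apply: hd; rewrite /ball /= distrC.
by apply/nbhs_ballP; exists d => // z; rewrite /ball /= distrC; exact: hd.
Qed.

Lemma differentiable_line (V : normedModType K) n (f : V -> 'rV[K]_n) (q d : V) (l : 'I_n) :
  differentiable f q -> forall e : K, 0 < e -> exists2 r : K, 0 < r &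
  forall t : K, `|t| < r ->
    `|f (q + t *: d) 0 l - f q 0 l - t * ('d f q d) 0 l| <= e * `|t|.
Proof.
move=> hf e e0; have hd := diff_derivable (v := d) hf.
have hcv : h^-1 *: ((f \o shift q) (h *: d) - f q) @[h --> (0 : K)^'] --> 'd f q d.
  by rewrite -deriveE //; exact: hd.
have /cvg_ballP /(_ e e0) [r /= r0 hr] := hcv; exists r => // t tr.
have [->|t0] := eqVneq t 0.
  by rewrite scale0r addr0 subrr mul0r subr0 normr0 mulr0.
have := hr t; rewrite /= sub0r normrN => /(_ tr t0) H0.
have : ball (('d f q d) 0 l) e ((t^-1 *: (f (t *: d + q) - f q)) 0 l) by case: H0.
move=> /ltW.
rewrite !mxE /= [t *: d + q]addrC => H.
have -> : f (q + t *: d) 0 l - f q 0 l - t * ('d f q d) 0 l =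
   - (t * (('d f q d) 0 l - t^-1 * (f (q + t *: d) 0 l - f q 0 l))).
  by rewrite mulrBr mulrA divff // mul1r opprB.
by rewrite normrN normrM mulrC ler_wpM2r.
Qed.

Lemma continuous_triple n m (F : K^o * K^o * 'rV[K]_n -> 'rV[K]_m) :
  {for (0, 0, 0), continuous F} -> forall e : K, 0 < e -> exists2 d : K, 0 < d &
  forall (x y : K^o) (w : 'rV[K]_n), `|x| < d -> `|y| < d -> (forall j, `|w 0 j| < d) ->
    forall l, `|F (x, y, w) 0 l - F (0, 0, 0) 0 l| < e.
Proof.
move=> hF e e0; have /cvg_ballP /(_ e e0) /nbhs_ballP[d d0 hd] := hF.
exists d => // x y w hx hy hw l.
rewrite distrC; have [_ /(_ 0 l)] : ball (F (0, 0, 0)) e (F (x, y, w)).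
  apply: (hd (x, y, w)); split; first by split; rewrite /ball /= sub0r normrN.
  by split=> // i j; rewrite (ord1 i) !mxE /ball /= sub0r normrN.
by [].
Qed.

Lemma derive1_row n (f : K -> 'rV[K]_n) (z : K) (v : 'rV[K]_n) :
  (forall l e, 0 < e -> exists2 d : K, 0 < d & forall h, `|h| < d ->
     `|f (z + h) 0 l - f z 0 l - v 0 l * h| <= e * `|h|) -> derive1 f z = v.
Proof.
move=> hf; rewrite /derive1; apply: cvg_lim => //.
apply/cvg_ballP => e e0; have e2 : 0 < e / 2 by rewrite divr_gt0.
have /choice[d hd] : forall l, exists d : K, 0 < d /\ forall h, `|h| < d ->
     `|f (z + h) 0 l - f z 0 l - v 0 l * h| <= e / 2 * `|h|.
  by move=> l; have [d d0 h] := hf l _ e2; exists d.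
have hall l : \forall h \near (0 : K)^', ball (v 0 l) e ((h^-1 *: (f (h + z) - f z)) 0 l).
  exists (d l); first by case: (hd l).
  move=> h /=; rewrite sub0r normrN => hdl h0.
  have := (hd l).2 h hdl; rewrite [z + h]addrC => H.
  rewrite /ball /= !mxE.
  have -> : v 0 l - h^-1 * (f (h + z) 0 l - f z 0 l) =
      - (h^-1 * (f (h + z) 0 l - f z 0 l - v 0 l * h)).
    by field; exact: h0.
  rewrite normrN normrM normfV mulrC ltr_pdivrMr ?normr_gt0 //.
  apply: le_lt_trans H _; rewrite ltr_pM2r ?normr_gt0 //.
  by rewrite ltr_pdivrMr // ltr_pMr // ltr1n.
near=> h; split=> // i j; rewrite (ord1 i); move: j; near: h; exact: filter_forall.
Unshelve. all: by end_near. Qed.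

(** After removal of the linear part, the remainder has an expansion with zero linear term;
    uniqueness of such an expansion gives its differential. *)
Lemma differentiable_pair_approx (g : K^o * K^o -> K^o) (x y a b : K) :
  (forall e, 0 < e -> exists2 d : K, 0 < d & forall h k, `|h| < d -> `|k| < d ->
     `|g (x + h, y + k) - g (x, y) - (h * a + k * b)| <= e * (`|h| + `|k|)) ->
  differentiable g (x, y).
Proof.
move=> hg.
pose L (p : K^o * K^o) : K^o := p.1 *: (a : K^o) + p.2 *: (b : K^o).
have dfst p : differentiable (fst : K^o * K^o -> K^o) p.
  by apply: (@linear_differentiable _ _ _ (@fst K^o K^o)) => q; exact: cvg_fst.
have dsnd p : differentiable (snd : K^o * K^o -> K^o) p.
  by apply: (@linear_differentiable _ _ _ (@snd K^o K^o)) => q; exact: cvg_snd.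
have dL p : differentiable L p by apply: differentiableD; apply: differentiableZl.
have -> : g = (fun p => (g p - L p) + L p) by apply: funext => p; rewrite subrK.
apply: differentiableD => //.
set r := fun p => g p - L p.
have hr : r \o shift (x, y) = cst (r (x, y)) + 0 +o_ (0 : K^o * K^o) id.
  apply/eqaddoP => e e0; have e2 : 0 < e / 2 by rewrite divr_gt0.
  have [d d0 hd] := hg _ e2.
  apply/nbhs_ballP; exists d => //= -[h k] [/=]; rewrite /ball /= !sub0r !normrN => hh hk.
  have := hd h k hh hk; rewrite /r /L /= /GRing.scale /= => H.
  rewrite [X in `|X|](_ : _ = g (x + h, y + k) - g (x, y) - (h * a + k * b)); last first.
    rewrite /= /GRing.add /=.
    transitivity (g (h + x, k + y) - ((h + x) * a + (k + y) * b)
      - (g (x, y) - (x * a + y * b) + 0)) => //.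
    rewrite [h + x]addrC [k + y]addrC.
    have key (u v h' k' : K) : u - ((x + h') * a + (y + k') * b) - (v - (x * a + y * b) + 0)
      = u - v - (h' * a + k' * b) by ring.
    exact: key.
  apply: le_trans H _; rewrite -mulrA ler_pM2l // ler_pdivrMl //.
  rewrite prod_normE /= mulr_natl mulr2n lerD // comparable_le_max ?lexx ?orbT //;
    by apply: real_comparable; exact: normr_real.
have d0 : 'd r (x, y) = 0 :> (K^o * K^o -> K^o).
  by apply: diff_unique hr => z; exact: cvg_cst.
by apply/diff_locallyP; rewrite d0; split=> // z; exact: cvg_cst.
Qed.

Lemma differentiable_approx (g : K^o -> K^o) (x a : K) :
  (forall e, 0 < e -> exists2 d : K, 0 < d & forall h, `|h| < d ->
     `|g (x + h) - g x - h * a| <= e * `|h|) ->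
  differentiable g x.
Proof.
move=> hg; have h : differentiable (fun p : K^o * K^o => g p.1) (x, 0).
  apply: (@differentiable_pair_approx _ _ _ a 0) => e e0; have [d d0 hd] := hg e e0.
  exists d => // h k hh _ /=; rewrite mulr0 addr0; apply: le_trans (hd h hh) _.
  by rewrite mulrDr lerDl mulr_ge0 // ltW.
have -> : g = (fun p : K^o * K^o => g p.1) \o (fun z : K^o => (z, 0 : K^o)) by [].
by apply: differentiable_comp.
Qed.

Lemma differentiable_row (V : normedModType K) n (f : V -> 'rV[K]_n) (q : V) :
  (forall l, differentiable (fun x => f x 0 l : K^o) q) -> differentiable f q.
Proof.
move=> hf; have -> : f = \sum_(l < n) (fun x => f x 0 l *: delta_mx 0 l).
  apply: funext => x; rewrite fct_sumE; exact: row_sum_delta.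
by apply: differentiable_sum => l; exact: differentiableZl.
Qed.

Lemma differentiable_within (V W : normedModType K) (U : set V) (f : V -> W) :
  (forall x, U x -> differentiable f x) -> {within U, continuous f}.
Proof.
move=> h; apply: continuous_in_subspaceT => x; rewrite inE => /h.
exact: differentiable_continuous.
Qed.

Lemma differentiable_section n m (F : K^o * K^o * 'rV[K]_n -> 'rV[K]_m) :
  differentiable F (0, 0, 0) -> differentiable (fun w => F (0, 0, w)) 0.
Proof.
move=> h; apply: (@differentiable_comp _ _ _ _ (fun w => (0, 0, w) : K^o * K^o * 'rV[K]_n)) => //.
Qed.

End AbstractDifferentiability.

Section Conversions.
Variable R : realType.
Notation C := R[i].

Lemma normCE (x : C) : `|x| = (cmod x)%:C. Proof. by []. Qed.

(** In the order of the complex numbers the positive elements are the positive reals, so the bounds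
    of the library can be exchanged for real ones. *)
Lemma posC (e : C) : 0 < e -> exists2 r : R, 0 < r & e = r%:C.
Proof.
case: e => a b; rewrite ltcE /= => /andP[/eqP e1 e2]; exists a => //.
by rewrite e1.
Qed.

Lemma nbhs_cmod (x : R[i]^o) (P : R[i]^o -> Prop) :
  (\forall z \near x, P z) <-> exists2 d : R, 0 < d & forall z, cmod (z - x) < d -> P z.
Proof.
split=> [/(nbhs_disc (K := R[i]))[d d0 hd]|[d d0 hd]].
  have [r r0 dE] := posC d0; exists r => // z zr; apply: hd.
  by rewrite normCE dE ltcR.
apply/(nbhs_disc (K := R[i])); exists d%:C; first by rewrite ltcR.
by move=> z; rewrite normCE ltcR; exact: hd.
Qed.

Lemma differentiable_cdiff (V : normedModType R[i]) n (f : V -> 'rV[R[i]]_n) (q d : V) l :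
  differentiable f q -> hasd (fun t => f (q + t *: d) 0 l) 0 (('d f q d) 0 l).
Proof.
move=> hf e e0; have [|r r0 hr] := differentiable_line d l hf (e := e%:C); first by rewrite ltcR.
have [r' r'0 rE] := posC r0; exists (r' / 2); first by rewrite divr_gt0.
move=> h hh; have := hr h; rewrite normCE rE ltcR => /(_ ltac:(lra)).
rewrite normCE -rmorphM lecR scale0r addr0 add0r [h * _]mulrC; exact.
Qed.

Lemma derive1_hasd n (f : R[i] -> 'rV[R[i]]_n) (z : R[i]) (v : 'rV[R[i]]_n) :
  (forall l, hasd (fun t => f t 0 l) z (v 0 l)) -> derive1 f z = v.
Proof.
move=> hf; apply: derive1_row => l e /posC[r r0 ->].
have [d d0 hd] := hf l r r0; exists d%:C; first by rewrite ltcR.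
by move=> h; rewrite !normCE ltcR -rmorphM lecR => /ltW /hd.
Qed.

Lemma cdiff_differentiable n (f : R[i]^o -> 'rV[R[i]]_n) (z : R[i]^o) :
  (forall l, cdiff (fun t => f t 0 l) z) -> differentiable f z.
Proof.
move=> hf; apply: differentiable_row => l; have [a ha] := hf l.
apply: (@differentiable_approx _ _ z a) => e /posC[r r0 ->].
have [d d0 hd] := ha r r0; exists d%:C; first by rewrite ltcR.
by move=> h; rewrite !normCE ltcR -rmorphM lecR [h * a]mulrC => /ltW /hd.
Qed.

(** The mixed second difference is [O(|h| |k|)]: the Lipschitz form of Cauchy's estimate in one
    variable is applied to increments in the other. The two partial derivatives therefore
    approximate the total increment. *)
Lemma osgood n (f : R[i]^o * R[i]^o -> 'rV[R[i]]_n) (x y : R[i]^o) (d K : R) : 0 < d ->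
  (forall l e z, cmod (e - x) < d -> cmod (z - y) < d -> cdiff (fun t => f (t, z) 0 l) e) ->
  (forall l e z, cmod (e - x) < d -> cmod (z - y) < d -> cdiff (fun t => f (e, t) 0 l) z) ->
  (forall l e z, cmod (e - x) < d -> cmod (z - y) < d -> cmod (f (e, z) 0 l) <= K) ->
  differentiable f (x, y).
Proof.
move=> d0 h1 h2 hK; apply: differentiable_row => l.
pose g e z := f (e, z) 0 l.
have c0 c : cmod (c - c : C) < d by rewrite subrr cmod0.
have [a ha] := h1 l x y (c0 x) (c0 y); have [b hb] := h2 l x y (c0 x) (c0 y).
have add (c h : C) : c + h - c = h by rewrite addrAC subrr add0r.
have lip k e : cmod k < d / 4 -> cmod (e - x) < d -> cmod (g e (y + k) - g e y) <= 8 * K / d * cmod k.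
  move=> hk he; apply: (@cauchy_lipschitz _ (g e) y d K d0) => // z hz.
    exact: (h2 l e z he hz).
  exact: (hK l e z he hz).
have mixed h k : cmod h < d / 4 -> cmod k < d / 4 ->
    cmod (g (x + h) (y + k) - g (x + h) y - (g x (y + k) - g x y)) <=
    8 * (8 * K / d * cmod k) / d * cmod h.
  move=> hh hk; have hk' : cmod (y + k - y) < d by rewrite add; have := cmod_ge0 k; lra.
  apply: (@cauchy_lipschitz _ (fun e => g e (y + k) - g e y) x d _ d0) => // e he.
    by apply: cdiffB; [exact: (h1 l e _ he hk')|exact: (h1 l e y he (c0 y))].
  exact: lip.
have K0 : 0 <= K by apply: le_trans (hK l x y (c0 x) (c0 y)); exact: cmod_ge0.
pose Q := 64 * K / d ^+ 2.
have Q0 : 0 <= Q by rewrite divr_ge0 ?mulr_ge0 ?exprn_ge0 ?(ltW d0).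
apply: (@differentiable_pair_approx _ _ x y a b) => e /posC[r r0 ->].
have r2 : 0 < r / 2 by lra.
have [d1 d10 k1] := ha _ r2; have [d2 d20 k2] := hb _ r2.
pose m := Num.min (d / 4) (Num.min d1 (Num.min d2 (r / (2 * (Q + 1))))).
have m0 : 0 < m by rewrite !lt_min d10 d20 !divr_gt0 //; lra.
exists m%:C; first by rewrite ltcR.
move=> h k; rewrite !normCE !ltcR -rmorphD -rmorphM lecR !lt_min.
move=> /and4P[u1 u2 u3 u4] /and4P[v1 v2 v3 v4].
have e1 : cmod (g (x + h) y - g x y - a * h) <= r / 2 * cmod h := k1 h (ltW u2).
have e2 : cmod (g x (y + k) - g x y - b * k) <= r / 2 * cmod k := k2 k (ltW v3).
have e3 := mixed h k u1 v1.
have -> : f (x + h, y + k) 0 l - f (x, y) 0 l - (h * a + k * b) =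
  (g (x + h) y - g x y - a * h) + ((g x (y + k) - g x y - b * k) +
  (g (x + h) (y + k) - g (x + h) y - (g x (y + k) - g x y))) by rewrite /g; ring.
apply: le_trans (cmodD _ _) _; apply: le_trans (lerD e1 (cmodD _ _)) _.
have e4 : 8 * (8 * K / d * cmod k) / d * cmod h <= r / 2 * cmod h.
  rewrite (_ : _ * cmod h = Q * cmod k * cmod h); last first.
    by rewrite /Q; field; rewrite gt_eqF.
  rewrite ler_wpM2r ?cmod_ge0 //; move: v4; rewrite ltr_pdivlMr; last lra.
  by have := cmod_ge0 k; nra.
by have : 0 <= r / 2 * cmod k; [rewrite mulr_ge0 ?cmod_ge0 // ltW|lra].
Qed.

End Conversions.

(** * The formal solution *)

Section FormalSeries.
Variable R : realType.
Notation C := R[i].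

Lemma common_radius (T : finType) (P : T -> R -> Prop) :
  (forall t s s', 0 < s' <= s -> P t s -> P t s') ->
  (forall t, exists2 s, 0 < s & P t s) -> exists2 s, 0 < s & forall t, P t s.
Proof.
move=> hmono hex; have /choice[f hf] : forall t, exists s, 0 < s /\ P t s.
  by move=> t; have [s s0 h] := hex t; exists s.
exists (\big[Num.min/1]_t f t).
  by apply: (big_ind (fun s => 0 < s)) => // [x y x0 y0|t _]; [rewrite lt_min x0|case: (hf t)].
move=> t; apply: hmono (hf t).2; apply/andP; split.
  by apply: (big_ind (fun s => 0 < s)) => // [x y x0 y0|t' _]; [rewrite lt_min x0|case: (hf t')].
exact: bigmin_le.
Qed.

(** Schwarz's lemma for the l1 norm. It serves for the term of order 0 in [e], which no power of [e]
    makes small. *)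
Lemma pser_small (s s1 b : R) (a : nat -> C) (f : C -> C) : 0 < s1 <= s -> a 0%N = 0 ->
  pser s b a f -> pser s1 (b * s1 / s) a f.
Proof.
move=> /andP[s10 ss] a0 hf; have s0 : 0 < s by lra.
have hm : pser s1 b a f by apply: pser_mono hf => //; rewrite s10.
apply: sum_cv_upgrade => // [L|z zs]; last exact: pser_cv zs hm.
apply: le_trans (_ : \sum_(k < L) (cmod (a k) * s ^+ k) * (s1 / s) <= _); last first.
  by rewrite -mulr_suml -mulrA ler_wpM2r ?hf.1 // divr_ge0 // ltW.
apply: ler_sum => -[[|k] kL] _ /=; first by rewrite a0 cmod0 !mul0r.
rewrite -!mulrA ler_wpM2l ?cmod_ge0 // exprS exprSr -mulrA [s * _]mulrC divfK ?gt_eqF //.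
by rewrite mulrC ler_pM2r // lerXn2r ?nnegrE // ltW.
Qed.

Lemma derive1n_pser nu n (f : R[i] -> 'rV[R[i]]_nu) (a : 'I_nu -> nat -> C) (s b : R) :
  0 < s -> (forall l, pser s b (a l) (fun e => f e 0 l)) ->
  forall l, derive1n n f 0 0 l = n`!%:R * a l n.
Proof.
elim: n f a s b => [|n IH] f a s b s0 hf l.
  by rewrite derive1n0 mul1r; exact: pser_at0 s0 (hf l).
have hd z : cmod z < s -> forall l', hasd (fun e => f e 0 l') z (derive1 f z 0 l').
  move=> zs; have /choice[v hv] : forall l', exists v, hasd (fun e => f e 0 l') z v.
    by move=> l'; have [v h _] := pser_hasd (hf l') zs; exists v.
  have hder : derive1 f z = \row_l' v l'.
    by apply: derive1_hasd => l'; rewrite mxE.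
  by move=> l'; rewrite hder mxE; exact: hv.
rewrite derive1Sn (IH _ (fun l k => k.+1%:R * a l k.+1) (s / 2) (4 * b / s)).
- by rewrite factS natrM; ring.
- by lra.
- by move=> l'; apply: (pser_deriv s0 (hf l')) => z zs; exact: hd.
Qed.

Variable nu : nat.
Notation I := (bool + 'I_nu)%type.
Variables (Fc : 'I_nu -> (I -> C) -> C) (r' r K : R).
Hypothesis hr : 0 < r < r'.
Hypothesis F_line : forall l (x d : I -> C) t, (forall i, cmod (x i + t * d i) < r') ->
  cdiff (fun t => Fc l (fun i => x i + t * d i)) t.
Hypothesis F_bound : forall l (x : I -> C), (forall i, cmod (x i) < r') -> cmod (Fc l x) <= K.
Variable am : nat -> 'I_nu -> C -> C.
Hypothesis am_pser : forall m l, exists s b, 0 < s /\ pser s b (coef (am m l)) (am m l).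
Hypothesis am00 : forall l, am 0%N l 0 = 0.

Let M : R := 2 ^+ #|{: I}| * K.
Let r0 : 0 < r. Proof. by case/andP: hr. Qed.

(** [z] comes before [e] because the expansion is taken in [e]. The coefficient of order [k] of
    [psi k] is the right-hand side of the formal equation of order [k]. *)
Definition psi k l z e := Fc l (pt e z (fun j => \sum_(m < k.+1) e ^+ m * am m j z)).

(** Finitely many orders at a time, since the radius of [am m] may shrink as [m] grows. *)
Lemma am_common i : exists s b : R, [/\ 0 < s, 0 <= b &
  forall m l, (m <= i)%N -> pser s b (coef (am m l)) (am m l)].
Proof.
pose P (t : 'I_i.+1 * 'I_nu) s := exists b, pser s b (coef (am t.1 t.2)) (am t.1 t.2).
have P_mono t s s' : 0 < s' <= s -> P t s -> P t s'.
  by move=> ss [b hb]; exists b; apply: pser_mono hb.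
have P_ex t : exists2 s, 0 < s & P t s.
  by have [s [b [s0 hs]]] := am_pser t.1 t.2; exists s => //; exists b.
have [s s0 /choice[b hb]] := common_radius P_mono P_ex.
exists s, (\sum_t b t); split=> // [|m l mi].
  by apply: sumr_ge0 => t _; exact: pser_b0 (hb t).
have mi' : (m < i.+1)%N by [].
apply: pser_mono (hb (Ordinal mi', l)); first by rewrite s0 lexx.
rewrite (bigD1 (Ordinal mi', l)) //= lerDl sumr_ge0 // => t _.
exact: pser_b0 (hb t).
Qed.

Lemma am_head s b l : 0 < s -> pser s b (coef (am 0 l)) (am 0 l) -> coef (am 0 l) 0%N = 0.
Proof. by move=> s0 h; rewrite -(pser_at0 s0 h). Qed.

(** The truncations at [i] and at [k <= i] differ by [O(e ^ (k + 1))]; by the Lipschitz bound so do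
    their images, which thus share the coefficients up to order [k]. *)
Lemma psi_pser i : exists d s, [/\ 0 < d, 0 < s &
  forall z, cmod z < d -> forall k l, (k <= i)%N ->
    pser s M (coef (psi k l z)) (psi k l z) /\
    forall p, (p <= k)%N -> coef (psi i l z) p = coef (psi k l z) p].
Proof.
have rp := r0; have [sa [b [sa0 b0 hab]]] := am_common i.
pose d := Num.min sa (Num.min (r / 64) (r * sa / (64 * (b + 1)))).
have d0 : 0 < d by rewrite !lt_min sa0 !divr_gt0 ?mulr_gt0 //; lra.
pose B := (b + 1) * i.+1%:R.
have i1 : 1 <= (i.+1%:R : R) by rewrite ler1n.
have B1 : b + 1 <= B by rewrite /B; nra.
(* The substituted series must have norm at most [r / 8]: [d] makes the term of order 0 at most
   [r / 64], and [s] bounds the terms of positive order by a small geometric sum. *)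
pose s := Num.min (1 / 2) (Num.min (r / 64) (r / (64 * B))).
have B0 : 0 < B by lra.
have s0 : 0 < s by rewrite !lt_min !divr_gt0 ?mulr_gt0 //; lra.
have s12 : s <= 1 / 2 by rewrite ge_min lexx.
have sr : s <= r / 64 by rewrite !ge_min lexx orbT.
have sB : s * (64 * B) <= r.
  have : s <= r / (64 * B) by rewrite !ge_min lexx !orbT.
  by rewrite ler_pdivlMr // mulr_gt0.
exists d, s; split=> // z zd.
have zsa : cmod z < sa by move: zd; rewrite !lt_min => /and3P[].
have zr : cmod z < r / 64 by move: zd; rewrite !lt_min => /and3P[].
have zb : cmod z * (64 * (b + 1)) < r * sa.
  have : cmod z < r * sa / (64 * (b + 1)) by move: zd; rewrite !lt_min => /and3P[].
  by rewrite ltr_pdivlMr // mulr_gt0 //; lra.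
have a0 j : cmod (am 0 j z) <= r / 64.
  have := (hab 0%N j isT).2 z zsa 1%N; rewrite big_ord_recl big_ord0.
  rewrite (am_head sa0 (hab 0%N j isT)) mul0r addr0 subr0 expr1 => /le_trans; apply.
  by rewrite mulrA ler_pdivrMr //; have := cmod_ge0 z; nra.
have norm_le k j : (k <= i)%N -> \sum_(m < k.+1) s ^+ m * cmod (am m j z) <= r / 8.
  move=> ki; rewrite big_ord_recl /= expr0 mul1r.
  apply: le_trans (_ : r / 64 + \sum_(m < k) s * b * (1 / 2) ^+ m <= _).
    apply: lerD (a0 j) _; apply: ler_sum => m _; rewrite /bump leq0n add1n exprS.
    have h1 : cmod (am m.+1 j z) <= b.
      by apply: pser_val zsa (hab _ _ _); exact: leq_trans (ltn_ord m) ki.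
    have h2 : s ^+ m <= (1 / 2) ^+ m by rewrite lerXn2r ?nnegrE //; lra.
    rewrite -!mulrA ler_pM2l // mulrC; apply: ler_pM => //; first exact: cmod_ge0.
    by rewrite exprn_ge0 // ltW.
  rewrite -mulr_sumr; have : \sum_(m < k) (1 / 2 : R) ^+ m <= 2 by apply: geo_sum_le; lra.
  have : s * b * 64 <= r by nra.
  have : 0 <= s * b by rewrite mulr_ge0 // ltW.
  set S := \sum_(m < k) _; nra.
have hps k l : (k <= i)%N -> pser s M (coef (psi k l z)) (psi k l z).
  (* The roles are exchanged: [e] is the variable of the series, [z] is a constant, and the
     parameter ranges over the single point 0. *)
  move=> ki; have h := @Wn_comp R I (Fc l) r' r K hr (@F_line l) (@F_bound l)
    (fun e => e = 0) s s0
    (fun i _ e => pt e z (fun j => \sum_(m < k.+1) e ^+ m * am m j z) i).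
  have [|a _ /(_ 0 erefl)] := h; last first.
    by move=> hp; exact: pser_coefE s0 hp.
  case=> [[]|j] /=.
  - by apply: (Wn_cst s0 (p := fun=> z)); [exact: Hol_cst|move=> _ _; lra].
  - by apply: (Wn_mono s0 _ (Wn_z _ s0)); lra.
  - have := Wn_sum s0 (index_enum 'I_k.+1) (Om := fun e => e = 0)
      (F := fun m _ e => e ^+ m * am m j z) (b := fun m => s ^+ m * cmod (am m j z)).
    move=> H; apply: (Wn_mono s0 _ (H _)).
      by apply: le_trans (norm_le k j ki) _; lra.
    move=> m; apply: (WnM s0 (WnX s0 m (Wn_z _ s0))).
    by apply: (Wn_cst s0 (p := fun=> am m j z)); [exact: Hol_cst|].
move=> k l ki; split=> [|p pk]; first exact: hps.
have h1 := hps i l (leqnn i); have h2 := hps k l ki.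
apply/eqP; rewrite -subr_eq0; apply/eqP.
suff hlip e : cmod e < s -> cmod (psi i l z e - psi k l z e) <= 16 * M / r * B * cmod e ^+ k.+1.
  have [H _] := pser_order (s0 := s) (m := k.+1) (introT andP (conj s0 (lexx s)))
    (pserB s0 h1 h2) hlip.
  exact: (H p pk).
move=> es; pose D q j := \sum_(m < q.+1) e ^+ m * am m j z.
have e1 : cmod e <= 1 by lra.
have DD j : cmod (D i j - D k j) <= B * cmod e ^+ k.+1.
  have -> : D i j - D k j = \sum_(m < i - k) e ^+ (k.+1 + m) * am (k.+1 + m)%N j z.
    have hsplit q : D (k + q)%N j = D k j +
        \sum_(m < q) e ^+ (k.+1 + m) * am (k.+1 + m)%N j z.
      by rewrite /D -addSn big_split_ord.
    by rewrite -{1}(subnKC ki) hsplit addrAC subrr add0r.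
  apply: le_trans (cmod_sum _ _ _) _.
  apply: le_trans (_ : \sum_(m < i - k) b * cmod e ^+ k.+1 <= _).
    apply: ler_sum => m _; rewrite cmodM cmodX mulrC; apply: ler_pM; rewrite ?cmod_ge0 //.
    - by rewrite exprn_ge0 // cmod_ge0.
    - apply: pser_val zsa (hab _ _ _); rewrite addSn -ltn_subRL; exact: ltn_ord.
    - by apply: ler_wiXn2l; rewrite ?cmod_ge0 ?leq_addr.
  rewrite sumr_const card_ord -[(b * _) *+ _]mulr_natl mulrA ler_wpM2r ?exprn_ge0 ?cmod_ge0 //.
  have : ((i - k)%:R : R) <= i.+1%:R by rewrite ler_nat leqW // leq_subr.
  have : 0 <= ((i - k)%:R : R) by [].
  by rewrite /B; nra.
have [ez|ez] := eqVneq e 0.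
  have -> : psi i l z e = psi k l z e.
    congr (Fc l _); congr (pt _ _ _); apply: funext => j.
    apply/eqP; rewrite -subr_eq0 -cmod_eq0 eq_le cmod_ge0 andbT.
    by apply: le_trans (DD j) _; rewrite ez cmod0 expr0n mulr0.
  by rewrite subrr cmod0 ez cmod0 expr0n mulr0.
have ep : 0 < cmod e by rewrite cmod_gt0.
have ek : cmod e ^+ k.+1 <= cmod e.
  by rewrite exprS ler_piMr ?cmod_ge0 // exprn_ile1 ?cmod_ge0.
have pl := @point_lipschitz R I (Fc l) r' r K hr (@F_line l) (@F_bound l)
  (pt e z (D k)) (pt 0 0 (fun j => D i j - D k j)) (B * cmod e ^+ k.+1).
rewrite -mulrA (_ : psi i l z e = Fc l (fun t => pt e z (D k) t +
   pt 0 0 (fun j => D i j - D k j) t)); last first.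
  congr (Fc l _); apply: funext => -[[]|j] /=; rewrite ?addr0 //.
  by rewrite addrC subrK.
apply: pl.
- rewrite mulr_gt0 ?exprn_gt0 //=; apply: le_lt_trans (_ : B * s < _); last by lra.
  by rewrite ler_pM2l //; lra.
- case=> [[]|j] /=; [lra|lra|].
  apply: le_trans (norm_le k j ki); apply: le_trans (cmod_sum _ _ _) _.
  apply: ler_sum => m _; rewrite cmodM cmodX ler_wpM2r ?cmod_ge0 //.
  by rewrite lerXn2r ?nnegrE ?cmod_ge0 ?(ltW s0) // ltW.
- case=> [[]|j] /=; last exact: DD.
    by rewrite cmod0 mulr_ge0 ?exprn_ge0 ?cmod_ge0 // ltW.
  by rewrite cmod0 mulr_ge0 ?exprn_ge0 ?cmod_ge0 // ltW.
Qed.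

Variable am' : nat -> 'I_nu -> C -> C.
Hypothesis am_deriv : forall m, exists2 d : R, 0 < d & forall z, cmod z < d ->
  forall l, hasd (am m l) z (am' m l z).
Hypothesis formal_eq : forall k, exists2 d : R, 0 < d & forall z, cmod z < d ->
  forall l, coef (psi k l z) k = if k is k'.+1 then z * am' k' l z else 0.

Lemma am_deriv_pser m : exists s b : R, [/\ 0 < s, 0 <= b & forall l,
  pser s b (fun k => k.+1%:R * coef (am m l) k.+1) (am' m l)].
Proof.
have [s [b [s0 b0 hs]]] := am_common m; have [d d0 hd] := am_deriv m.
pose t := Num.min s d; have t0 : 0 < t by rewrite lt_min s0.
exists (t / 2), (4 * b / t); split; first by lra.
  by rewrite divr_ge0 ?mulr_ge0 // ltW.
move=> l; have h : pser t b (coef (am m l)) (am m l).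
  by apply: pser_mono (hs m l (leqnn m)); rewrite // t0 ge_min lexx.
apply: (pser_deriv t0 h) => z; rewrite lt_min => /andP[_ /hd]; exact.
Qed.

Lemma formal_residual i : exists d s B : R, [/\ 0 < d, 0 < s, 0 <= B &
  forall z e l, cmod z < d -> cmod e < s ->
   cmod (e * z * (\sum_(m < i.+1) e ^+ m * am' m l z) - psi i l z e) <= B * cmod e ^+ i.+1].
Proof.
have [d1 [s [d10 s0 hpsi]]] := psi_pser i.
pose P (k : 'I_i.+1) d := forall z, cmod z < d -> forall l,
  coef (psi k l z) k = if val k is k'.+1 then z * am' k' l z else 0.
have P_mono k t t' : 0 < t' <= t -> P k t -> P k t'.
  by move=> /andP[t0 tt] h z zt; apply: h; exact: lt_le_trans tt.
have P_ex k : exists2 d, 0 < d & P k d.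
  by have [d d0 h] := formal_eq k; exists d.
have [d2 d20 hd2] := common_radius P_mono P_ex.
have [sa [b [sa0 b0 hb]]] := am_deriv_pser i.
have M0 : nu = 0%N \/ 0 <= M.
  case: (posnP nu) => [|h]; [by left|right].
  exact: pser_b0 (hpsi 0 ltac:(by rewrite cmod0) i (Ordinal h) (leqnn i)).1.
case: M0 => [nu0|M0].
  by exists 1, 1, 0; split=> // z e l; have := leq_trans (ltn_ord l) (eq_leq nu0).
pose d := Num.min 1 (Num.min d1 (Num.min d2 sa)).
exists d, s, (b + M / s ^+ i.+1); split=> //.
- by rewrite !lt_min ltr01 d10 d20.
- by rewrite addr_ge0 // divr_ge0 // exprn_ge0 // ltW.
move=> z e l; rewrite !lt_min => /and4P[z1 zd1 zd2 zsa] es.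
have [hp hcoef] := hpsi z zd1 i l (leqnn i).
have tail := hp.2 e es i.+1.
have hsum : \sum_(k < i.+1) coef (psi i l z) k * e ^+ k =
    e * z * \sum_(m < i) e ^+ m * am' m l z.
  rewrite big_ord_recl /= (_ : coef (psi i l z) 0%N = 0) ?mul0r ?add0r; last first.
    by rewrite ((hpsi z zd1 0%N l isT).2 0%N isT); exact: (hd2 ord0 z zd2 l).
  rewrite mulr_sumr; apply: eq_bigr => m _; rewrite /bump leq0n add1n.
  have mi : (m.+1 < i.+1)%N by rewrite ltnS.
  rewrite ((hpsi z zd1 m.+1 l (ltn_ord m)).2 _ (leqnn _)) (hd2 (Ordinal mi) z zd2 l) /= exprS.
  ring.
rewrite hsum in tail; rewrite big_ord_recr /= mulrDr.
set T := e * z * _ in tail *.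
have -> : T + e * z * (e ^+ i * am' i l z) - psi i l z e =
  e ^+ i.+1 * (z * am' i l z) - (psi i l z e - T) by rewrite exprS; ring.
apply: le_trans (cmodBD _ _) _; rewrite mulrDl; apply: lerD; last first.
  by apply: le_trans tail _; rewrite expr_div_n; lra.
rewrite cmodM cmodX mulrC ler_wpM2r ?exprn_ge0 ?cmod_ge0 // cmodM.
have := pser_val zsa (hb l); have := cmod_ge0 z; have := cmod_ge0 (am' i l z); nra.
Qed.

End FormalSeries.

(** * Expansion in [e] of the coefficients of the truncated solutions *)

Section Matching.
Variable R : realType.
Notation C := R[i].

Lemma pser_sum (s : R) (n : nat) (b : nat -> R) (a : nat -> nat -> C) (f : nat -> C -> C) :
  0 < s -> (forall m, (m < n)%N -> pser s (b m) (a m) (f m)) ->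
  pser s (\sum_(m < n) b m) (fun k => \sum_(m < n) a m k) (fun z => \sum_(m < n) f m z).
Proof.
move=> s0; elim: n => [|n IH] h.
  split=> [L|z zs L]; rewrite !big_ord0.
    by rewrite big1 // => k _; rewrite big_ord0 cmod0 mul0r.
  by rewrite mul0r sub0r cmodN big1 ?cmod0 // => k _; rewrite big_ord0 mul0r.
have hn := pserD s0 (IH (fun m mn => h m (leqW mn))) (h n (leqnn _)).
rewrite big_ord_recr /=.
have -> : (fun k => \sum_(m < n.+1) a m k) = fun k => \sum_(m < n) a m k + a n k.
  by apply: funext => k; rewrite big_ord_recr.
by apply: pser_ext hn => z _; rewrite [in RHS]big_ord_recr.
Qed.

Lemma pser_mulX (s b : R) (a : nat -> C) (f : C -> C) : 0 < s -> pser s b a f ->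
  pser s (b * s) (fun k => if k is k'.+1 then a k' else 0) (fun z => z * f z).
Proof.
move=> s0 hf; have b0 := pser_b0 hf; apply: sum_cv_upgrade => // [[|L]|z zs].
- by rewrite big_ord0 mulr_ge0 // ltW.
- rewrite big_ord_recl /= cmod0 mul0r add0r.
  apply: le_trans (ler_wpM2r (ltW s0) (hf.1 L)); rewrite mulr_suml.
  by apply: ler_sum => k _; rewrite /bump leq0n add1n exprSr mulrA.
- move=> e /(cvZ z (pser_cv s0 zs hf))[N hN]; exists N.+1 => -[//|n].
  rewrite ltnS => /hN; rewrite big_ord_recl /= mul0r add0r mulr_sumr.
  by congr (cmod (_ - _) < _); apply: eq_bigr => k _; rewrite /bump leq0n add1n exprS mulrCA.
Qed.

Variable nu : nat.
Notation I := (bool + 'I_nu)%type.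
Variables (Fc : 'I_nu -> (I -> C) -> C) (A : 'M[C]_nu) (r' r K : R).
Let G l (x : I -> C) : C := Fc l x - \sum_j A l j * x (inr j).
Hypothesis hr : 0 < r < r'.
Hypothesis F_line : forall l (x d : I -> C) t, (forall i, cmod (x i + t * d i) < r') ->
  cdiff (fun t => Fc l (fun i => x i + t * d i)) t.
Hypothesis F_bound : forall l (x : I -> C), (forall i, cmod (x i) < r') -> cmod (Fc l x) <= K.
Hypothesis G_line : forall l (x d : I -> C) t, (forall i, cmod (x i + t * d i) < r') ->
  cdiff (fun t => G l (fun i => x i + t * d i)) t.
Hypothesis G_bound : forall l (x : I -> C), (forall i, cmod (x i) < r') -> cmod (G l x) <= K.
Hypothesis G0 : forall l, G l (fun=> 0) = 0.
Hypothesis G_flat : forall l v, hasd (fun t => G l (fun i => t * pt 0 0 v i)) 0 0.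
Let M : R := 2 ^+ #|{: I}| * K.

Variables (C0 mu delta0 : R).
Hypothesis hC0 : 0 <= C0.
Hypothesis hmu : 0 < mu < r / 64.
Hypothesis hdelta0 : 0 < delta0 <= mu.
Hypothesis small2 : nu%:R * C0 * (256 * M / r ^+ 2 * (3 * mu)) <= 1 / 2.

Variables (am am' : nat -> 'I_nu -> C -> C).
Hypothesis am_pser : forall m l, exists s b, 0 < s /\ pser s b (coef (am m l)) (am m l).
Hypothesis am00 : forall l, am 0%N l 0 = 0.
Hypothesis am_deriv : forall m, exists2 d : R, 0 < d & forall z, cmod z < d ->
  forall l, hasd (am m l) z (am' m l z).
Hypothesis formal_eq : forall k, exists2 d : R, 0 < d & forall z, cmod z < d ->
  forall l, coef (psi Fc am k l z) k = if k is k'.+1 then z * am' k' l z else 0.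

(* Discarding the orders above n keeps the resolvents holomorphic on a disc of
   radius of order 1/n and does not change the coefficient of order n. *)
Definition trunc_resolvent n k j l (e : C) : C :=
  if (k <= n)%N then invmx ((e * k%:R)%:M - A) j l else 0.

Variables (n : nat) (Om : C -> Prop) (dn s : R) (w : 'I_nu -> C -> C -> C).
Hypothesis dn0 : 0 < dn.
Hypothesis hOm : forall e, cmod e < dn -> Om e.
Hypothesis hOm_le : forall e, Om e -> cmod e <= delta0.
Hypothesis hunit : forall e k, Om e -> (k <= n)%N -> (e * k%:R)%:M - A \in unitmx.
Hypothesis hres : forall e k j l, Om e -> cmod (trunc_resolvent n k j l e) <= C0.
Hypothesis hs : 0 < s <= delta0.
Hypothesis hw : forall j e, Om e -> pser s mu (coef (w j e)) (w j e).
Hypothesis hcoef : forall j e k, Om e ->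
  coef (w j e) k = \sum_l trunc_resolvent n k j l e * coef (nemytskii G w l e) k.

(** For fixed [e], the sum of the [e ^ m a_m] is an approximate solution in the sense of
    [perturbation]. The constant depends on [n] and [i], through a radius on which [a_0, ..., a_i]
    all converge; this does no harm, because the estimate only serves to identify Taylor
    coefficients. *)
Theorem matching i : exists Cst e1 : R, 0 < e1 /\ forall e, cmod e < e1 -> forall j,
  cmod (coef (w j e) n - \sum_(m < i.+1) e ^+ m * coef (am m j) n) <= Cst * cmod e ^+ i.+1.
Proof.
have m0 : 0 < mu by case/andP: hmu.
have s0 : 0 < s by case/andP: hs.
have [d [s1 [B [d0 s10 B0 hres']]]] :=
  formal_residual hr F_line F_bound am_pser am00 am_deriv formal_eq i.
have [sa [b [sa0 b0 hab]]] := am_common am_pser i.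
pose P (m : 'I_i.+1) t := exists2 b', 0 <= b' & forall l,
  pser t b' (fun k => k.+1%:R * coef (am m l) k.+1) (am' m l).
have P_mono m t t' : 0 < t' <= t -> P m t -> P m t'.
  by move=> tt [b' b'0 h]; exists b' => // l; apply: pser_mono (h l).
have P_ex m : exists2 t, 0 < t & P m t.
  by have [t [b' [t0 b'0 h]]] := am_deriv_pser am_pser am_deriv m; exists t => //; exists b'.
have [sd sd0 hsd] := common_radius P_mono P_ex.
(* The last entry makes the norm of the term of order 0 at most [mu / 4]; the last entry of [e1]
   below does the same for the sum of the other terms. *)
pose s2 := Num.min (Num.min s sa) (Num.min (Num.min d sd) (mu * sa / (4 * (b + 1)))).
have s20 : 0 < s2 by rewrite !lt_min s0 sa0 d0 sd0 divr_gt0 ?mulr_gt0 //; lra.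
have s2s : s2 <= s by rewrite !ge_min lexx.
have s2a : s2 <= sa by rewrite !ge_min lexx orbT.
have s2d : s2 <= d by rewrite !ge_min lexx !orbT.
have s2sd : s2 <= sd by rewrite !ge_min lexx !orbT.
have s2b : s2 * (4 * (b + 1)) <= mu * sa.
  have : s2 <= mu * sa / (4 * (b + 1)) by rewrite !ge_min lexx !orbT.
  by rewrite ler_pdivlMr // mulr_gt0 //; lra.
pose e1 := Num.min (Num.min dn s1) (Num.min (1 / 2) (mu / (8 * (b + 1)))).
have e10 : 0 < e1 by rewrite !lt_min dn0 s10 !divr_gt0 ?mulr_gt0 //; lra.
exists (2 * (C0 * (nu%:R * (n.+1%:R * (2 * B)))) / (s2 / 4) ^+ n), e1; split=> // e.
rewrite !lt_min => /andP[/andP[edn es1] /andP[e12 eb]] j.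
have he := hOm edn.
have eb' : cmod e * (8 * (b + 1)) <= mu.
  by rewrite -ler_pdivlMr ?(ltW eb) // mulr_gt0 //; lra.
have s4 : 0 < s2 / 4 by rewrite divr_gt0.
have s4s2 : s2 / 4 <= s2 by lra.
pose D j z := \sum_(m < i.+1) e ^+ m * am m j z.
pose aD j k := \sum_(m < i.+1) e ^+ m * coef (am m j) k.
have hD j' : pser s2 mu (aD j') (D j').
  have h m : (m < i.+1)%N -> pser s2 (cmod (e ^+ m) * (if m is 0%N then b * s2 / sa else b))
      (fun k => e ^+ m * coef (am m j') k) (fun z => e ^+ m * am m j' z).
    move=> mi; apply: pserZ => //; case: m mi => [|m] mi.
      apply: pser_small (hab 0%N j' isT); first by rewrite s20.
      exact: (am_head am00 sa0 (hab 0%N j' isT)).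
    by apply: pser_mono (hab m.+1 j' mi) => //; rewrite s20.
  apply: pser_mono (pser_sum s20 h); first by rewrite s20 lexx.
  rewrite big_ord_recl /= expr0 cmod1 mul1r.
  apply: le_trans (_ : mu / 4 + \sum_(m < i) cmod e * b * (1 / 2) ^+ m <= _).
    apply: lerD; first by rewrite ler_pdivrMr //; nra.
    apply: ler_sum => m _; rewrite /bump leq0n add1n /= cmodX exprS.
    rewrite mulrAC ler_wpM2l ?mulr_ge0 ?cmod_ge0 //.
    by rewrite lerXn2r ?nnegrE ?cmod_ge0 // ltW.
  rewrite -mulr_sumr.
  have g2 : \sum_(m < i) (1 / 2 : R) ^+ m <= 2 by apply: geo_sum_le; lra.
  have g1 : 0 <= cmod e * b by rewrite mulr_ge0 ?cmod_ge0.
  have g3 : cmod e * b * 8 <= mu by have := cmod_ge0 e; nra.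
  have g4 := ler_wpM2l g1 g2.
  lra.
pose nz l z := G l (pt e z (fun j => D j z)).
pose H l z := e * z * (\sum_(m < i.+1) e ^+ m * am' m l z) - psi Fc am i l z e.
have hnz l : exists b', pser s2 b' (coef (nz l)) (nz l).
  have s2delta : 0 < s2 <= delta0 by rewrite s20 (le_trans s2s) //; case/andP: hs.
  have hW j' : Wn (fun e' => e' = e) s2 mu (fun _ => D j').
    by exists (fun k _ => aD j' k) => [k|e' _]; [exact: Hol_point|exact: hD].
  have hle e' : e' = e -> cmod e' <= delta0 by move=> ->; exact: hOm_le.
  have := nemytskii_Wn hr G_line G_bound G0 G_flat hmu hdelta0 s2delta hle hW l.
  move=> /(Wn_coef s20)[_ /(_ e erefl) h].
  by eexists; exact: h.
have hH l : exists b', pser s2 b' (fun k => e * k%:R * aD l k -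
    (\sum_j A l j * aD j k + coef (nz l) k)) (H l).
  have [bn hn] := hnz l.
  have h1 m : (m < i.+1)%N -> exists b', pser s2 b'
      (fun k => e ^+ m * (k%:R * coef (am m l) k)) (fun z => e ^+ m * (z * am' m l z)).
    move=> mi; have [bm _ hm] := hsd (Ordinal mi); eexists; apply: pserZ => //.
    have := pser_mulX s20 (pser_mono (introT andP (conj s20 s2sd)) (lexx _) (hm l)).
    by congr (pser _ _ _ _); apply: funext => -[|k] //; rewrite mul0r.
  have /choice[bm hbm] : forall m, exists b', (m < i.+1)%N -> pser s2 b'
      (fun k => e ^+ m * (k%:R * coef (am m l) k)) (fun z => e ^+ m * (z * am' m l z)).
    move=> m; case: (ltnP m i.+1) => [/h1[b' hb']|_]; [by exists b'|by exists 0].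
  have h2 := pserZ e s20 (pser_sum s20 hbm).
  pose ja q : 'I_nu -> C := fun j => A l j * aD j q.
  have h3 : exists b', pser s2 b' (fun k => \sum_j A l j * aD j k) (fun z => \sum_j A l j * D j z).
    elim: (index_enum 'I_nu) => [|j' js [b' IH]].
      exists 0; split=> [L|z zs L].
        by rewrite big1 // => k _; rewrite big_nil cmod0 mul0r.
      by rewrite big_nil mul0r sub0r cmodN big1 ?cmod0 // => k _; rewrite big_nil mul0r.
    eexists; have := pserD s20 (pserZ (A l j') s20 (hD j')) IH.
    have -> : (fun k => \sum_(j <- j' :: js) A l j * aD j k) =
      fun k => A l j' * aD j' k + \sum_(j <- js) A l j * aD j k.
      by apply: funext => k; rewrite big_cons.
    by move=> h; apply: pser_ext h => z _; rewrite big_cons.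
  have [bs hs3] := h3.
  eexists; have h4 := pserB s20 h2 (pserD s20 hs3 hn).
  have -> : (fun k => e * k%:R * aD l k - (\sum_j A l j * aD j k + coef (nz l) k)) =
     (fun k => e * (\sum_(m < i.+1) e ^+ m * (k%:R * coef (am m l) k)) -
       (\sum_j A l j * aD j k + coef (nz l) k)).
    apply: funext => k; congr (_ - _); rewrite -mulrA; congr (_ * _).
    by rewrite /aD mulr_sumr; apply: eq_bigr => m _; rewrite mulrCA.
  apply: pser_ext h4 => z zs; rewrite /H /psi /nz /G; congr (_ - _).
    rewrite -mulrA; congr (_ * _); rewrite mulr_sumr; apply: eq_bigr => m _.
    by rewrite mulrCA.
  by rewrite addrC subrK.
pose h l k := e * k%:R * aD l k - (\sum_j A l j * aD j k + coef (nz l) k).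
have hh l : pser (s2 / 4) (2 * (B * cmod e ^+ i.+1)) (h l) (H l).
  have [b' hb'] := hH l.
  (* [formal_residual] bounds the residual pointwise; Cauchy's estimates turn this into the l1 bound
     that [perturbation] requires, on a quarter of the radius. *)
  have [||x hx] := @local_expansion R (H l) 0 s2 (B * cmod e ^+ i.+1) s20.
  - by move=> z; rewrite subr0; exact: pser_cdiff hb'.
  - by move=> z; rewrite subr0 => zs; apply: hres' => //; exact: lt_le_trans s2d.
  have hx' : pser (s2 / 4) (2 * (B * cmod e ^+ i.+1)) x (H l).
    by apply: pser_ext hx => z _; rewrite add0r.
  have xE : x = h l := pser_uniq s4 s20 s20 hx' hb' (fun _ _ => erefl).
  by rewrite -xE.
have s4delta : 0 < s2 / 4 <= delta0.
  by rewrite s4 /=; case/andP: hs => _; lra.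
have lift_s (x : nat -> C) (f : C -> C) : pser s2 mu x f -> pser (s2 / 4) mu x f.
  by apply: pser_mono => //; rewrite s4.
have hwe j' : pser (s2 / 4) mu (coef (w j' e)) (w j' e).
  by apply: lift_s; apply: pser_mono (hw j' he) => //; rewrite s20.
have hc0 j' k : (n < k)%N -> coef (w j' e) k = 0.
  move=> nk; rewrite hcoef // big1 // => l _.
  by rewrite /trunc_resolvent leqNgt nk mul0r.
have ha j' k : (k <= n)%N -> aD j' k =
    \sum_l trunc_resolvent n k j' l e * (coef (nz l) k + h l k).
  (* In order [k] the definition of the residual reads [(e k - A) a_k = nz_k + h_k], and the matrix
     is inverted. *)
  move=> kn; have hB := hunit he kn; set X := (e * k%:R)%:M - A in hB.
  pose v : 'cV[C]_nu := \col_l aD l k.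
  have Xv l : (X *m v) l 0 = coef (nz l) k + h l k.
    rewrite mulmxBl mul_scalar_mx !mxE /h.
    rewrite (eq_bigr (fun j0 => A l j0 * aD j0 k)); last by move=> j0 _; rewrite mxE.
    ring.
  have -> : aD j' k = (invmx X *m (X *m v)) j' 0 by rewrite mulKmx // mxE.
  by rewrite mxE; apply: eq_bigr => l _; rewrite Xv /trunc_resolvent kn.
have main := perturbation hr G_line G_bound G0 G_flat hC0 hmu hdelta0 small2
  s4delta (hOm_le he) (fun k j l => hres k j l he) hwe
  (fun j k _ => hcoef j k he) hc0 (fun j => lift_s _ _ (hD j)) ha j (leqnn n).
rewrite mulrAC ler_pdivlMr ?exprn_gt0 //; apply: le_trans main _.
rewrite (_ : 2 * _ * _ = 2 * (C0 * (\sum_(l < nu) n.+1%:R * (2 * (B * cmod e ^+ i.+1)))));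
  last by rewrite sumr_const card_ord -[(_ * _) *+ _]mulr_natl; ring.
rewrite ler_pM2l // ler_wpM2l //; apply: ler_sum => l _.
apply: le_trans (_ : \sum_(k < n.+1) 2 * (B * cmod e ^+ i.+1) <= _).
  by apply: ler_sum => k _; exact: pser_coef (hh l).
by rewrite sumr_const card_ord -[_ *+ n.+1]mulr_natl.
Qed.

End Matching.

(** * Gevrey estimates *)

Section GevreySums.
Variable R : realType.
Notation C := R[i].

(** The power is at most the falling factorial [(n + k) ... (n + 1)], which is [k!] times a binomial
    coefficient. *)
Lemma pow_le_fact (n k : nat) : (n.+1 ^ k <= k`! * 2 ^ (n + k))%N.
Proof.
have h1 : (n.+1 ^ k <= (n + k) ^_ k)%N.
  elim: k => [|k IH]; first by rewrite ffactn0.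
  by rewrite expnS addnS ffactnS /= leq_mul // ltnS leq_addr.
have h2 m j : ('C(m, j) <= 2 ^ m)%N.
  elim: m j => [|m IH] [|j] //; first by rewrite bin0 expn_gt0.
  by rewrite binS expnS mul2n -addnn leq_add.
by apply: leq_trans h1 _; rewrite -bin_ffact mulnC leq_mul2l h2 orbT.
Qed.

Lemma pser_poly (s : R) (a : nat -> C) n : 0 < s ->
  pser s (\sum_(k < n.+1) cmod (a k) * s ^+ k)
    (fun k => if (k <= n)%N then a k else 0) (fun z => \sum_(k < n.+1) a k * z ^+ k).
Proof.
move=> s0; apply: sum_cv_upgrade => // [L|z zs].
  have := @pser_finite_sum R (fun k => if (k <= n)%N then a k else 0) n L s s0.
  move=> /(_ _)/le_trans; apply; first by move=> k nk; rewrite leqNgt nk.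
  by apply: ler_sum => k _; rewrite -ltnS ltn_ord.
move=> e e0; exists n.+1 => L mL; rewrite -(subnKC mL) big_split_ord /=.
rewrite [X in _ + X - _]big1 ?addr0.
  rewrite (eq_bigr (fun k : 'I_n.+1 => a k * z ^+ k)) ?subrr ?cmod0 // => k _.
  by rewrite -ltnS ltn_ord.
by move=> k _; rewrite leqNgt leq_addr /= mul0r.
Qed.

(** The asymptotic expansion comes without any uniformity in [i]. Comparison with the Taylor
    polynomial of each degree identifies its coefficients, after which the bounds are those of
    Cauchy. *)
Lemma asymptotic_coefficients (c : C -> C) (a : nat -> C) (B t : R) : 0 < t ->
  (forall e, cmod e < t -> cdiff c e) -> (forall e, cmod e < t -> cmod (c e) <= B) ->
  (forall i, exists Cst e1 : R, 0 < e1 /\ forall e, cmod e < e1 ->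
     cmod (c e - \sum_(m < i.+1) e ^+ m * a m) <= Cst * cmod e ^+ i.+1) ->
  pser (t / 4) (2 * B) a c.
Proof.
move=> t0 hc hB ha; have t4 : 0 < t / 4 by rewrite divr_gt0.
have [||x hx] := @local_expansion R c 0 t B t0.
- by move=> z; rewrite subr0; exact: hc.
- by move=> z; rewrite subr0; exact: hB.
have {}hx : pser (t / 4) (2 * B) x c by apply: pser_ext hx => z _; rewrite add0r.
suff -> : a = x by [].
apply: funext => i; have [Cst [e1 [e10 h]]] := ha i.
pose s0 := Num.min e1 (t / 4).
have s00 : 0 < s0 by rewrite lt_min e10.
have tail e : cmod e < s0 -> cmod (\sum_(k < i.+1) (x k - a k) * e ^+ k) <=
    (Cst + 2 * B / (t / 4) ^+ i.+1) * cmod e ^+ i.+1.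
  rewrite lt_min => /andP[ee1 et]; have h1 := h e ee1; have h2 := hx.2 e et i.+1.
  have -> : \sum_(k < i.+1) (x k - a k) * e ^+ k =
     (c e - \sum_(m < i.+1) e ^+ m * a m) - (c e - \sum_(k < i.+1) x k * e ^+ k).
    have -> : \sum_(k < i.+1) (x k - a k) * e ^+ k =
       \sum_(k < i.+1) x k * e ^+ k - \sum_(k < i.+1) e ^+ k * a k.
      by rewrite -sumrB; apply: eq_bigr => k _; ring.
    move: (\sum_(k < i.+1) x k * e ^+ k) (\sum_(k < i.+1) e ^+ k * a k) => u v; ring.
  apply: le_trans (cmodBD _ _) _; rewrite mulrDl; apply: lerD => //.
  by apply: le_trans h2 _; rewrite expr_div_n; lra.
have [H _] := pser_order (s0 := s0) (introT andP (conj s00 (lexx s0)))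
  (pser_poly (fun k => x k - a k) i s00) tail.
have := H i (ltnSn i); rewrite leqnn => /eqP; rewrite subr_eq0 => /eqP.
by [].
Qed.

(** Valid beyond the disc of convergence: for [|e| >= t] the value is at most [B] and the Taylor
    terms are at most [2 B (2 |e| / t) ^ n] times powers of 1/2, which gives [B + 4 B]. This matters
    because [t] shrinks with the order in [z] while [e] stays in a fixed sector. *)
Lemma coefficient_remainder (c : C -> C) (a : nat -> C) (B t : R) n e : 0 < t ->
  pser t (2 * B) a c -> cmod (c e) <= B ->
  cmod (c e - \sum_(k < n) a k * e ^+ k) <= 5 * B * (2 * cmod e / t) ^+ n.
Proof.
move=> t0 hp hB; have B0 : 0 <= B by apply: le_trans hB; exact: cmod_ge0.
have X0 : 0 <= cmod e / t by rewrite divr_ge0 ?cmod_ge0 // ltW.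
have [X hX] : exists X : R, X = cmod e / t by exists (cmod e / t).
rewrite -hX in X0; rewrite -[2 * cmod e / t]mulrA -hX.
have X2 : 0 <= (2 * X) ^+ n by rewrite exprn_ge0 // mulr_ge0.
have [et|et] := ltP (cmod e) t.
  apply: le_trans (hp.2 e et n) _; rewrite -hX.
  have : X ^+ n <= (2 * X) ^+ n.
    apply: lerXn2r; rewrite ?nnegrE ?mulr_ge0 //.
    lra.
  have : 0 <= X ^+ n by rewrite exprn_ge0.
  by nra.
have X1 : 1 <= X by rewrite hX ler_pdivlMr // mul1r.
have h1 : 1 <= (2 * X) ^+ n by rewrite exprn_ege1 //; lra.
apply: le_trans (cmodBD _ _) _.
have : cmod (\sum_(k < n) a k * e ^+ k) <= 2 * B * (2 * X) ^+ n * 2.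
  apply: le_trans (cmod_sum _ _ _) _.
  apply: le_trans (_ : \sum_(k < n) 2 * B * (2 * X) ^+ n * (1 / 2) ^+ k <= _); last first.
    rewrite -mulr_sumr ler_wpM2l ?mulr_ge0 //; apply: geo_sum_le; lra.
  apply: ler_sum => k _; rewrite cmodM cmodX.
  have -> : cmod e ^+ k = t ^+ k * ((2 * X) ^+ k * (1 / 2) ^+ k).
    by rewrite -!exprMn hX; congr (_ ^+ _); field; rewrite gt_eqF.
  rewrite mulrA mulrA ler_wpM2r ?exprn_ge0 // ler_pM //.
  - by rewrite mulr_ge0 ?cmod_ge0 ?exprn_ge0 // ltW.
  - by rewrite exprn_ge0 // mulr_ge0.
  - exact: pser_coef hp.
  - by apply: ler_weXn2l; [lra|exact: ltnW].
have : B <= B * (2 * X) ^+ n by nra.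
lra.
Qed.

Variable nu : nat.
Variables (S : C -> Prop) (c : nat -> 'I_nu -> C -> C) (a : nat -> 'I_nu -> nat -> C).
Variables (mu s dd : R).
Hypotheses (mu0 : 0 < mu) (s0 : 0 < s) (dd0 : 0 < dd).
Hypothesis S_open : forall x, S x -> exists2 d : R, 0 < d & forall y, cmod (y - x) < d -> S y.
Hypothesis c_hol : forall n j e, S e \/ cmod e < dd / n.+1%:R -> cdiff (c n j) e.
Hypothesis c_le : forall n j e, S e \/ cmod e < dd / n.+1%:R -> cmod (c n j e) <= mu / s ^+ n.
Hypothesis c_asymp : forall n i, exists Cst e1 : R, 0 < e1 /\ forall e, cmod e < e1 ->
  forall j, cmod (c n j e - \sum_(m < i.+1) e ^+ m * a m j n) <= Cst * cmod e ^+ i.+1.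

Lemma c_pser n j : pser (dd / n.+1%:R / 4) (2 * (mu / s ^+ n)) (a ^~ j ^~ n) (c n j).
Proof.
apply: asymptotic_coefficients.
- by rewrite divr_gt0.
- by move=> e he; apply: c_hol; right.
- by move=> e he; apply: c_le; right.
- by move=> i; have [Cst [e1 [e10 h]]] := c_asymp n i; exists Cst, e1; split=> // e /h.
Qed.

Definition fsum j e := csum (fun n => c n j e).
Definition bsum i j := csum (fun n => a i j n).

Lemma fsum_pser j e : S e -> pser (s / 2) (2 * mu) (fun n => c n j e) (fsum j e).
Proof.
move=> he; apply: pser_csum; first by rewrite divr_gt0.
move=> L; apply: le_trans (_ : \sum_(k < L) mu * (1 / 2) ^+ k <= _); last first.
  by rewrite -mulr_sumr mulrC ler_wpM2r ?(ltW mu0) //; apply: geo_sum_le; lra.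
apply: ler_sum => k _; have := @c_le k j e (or_introl he).
rewrite ler_pdivlMr ?exprn_gt0 // => h.
have -> : (s / 2) ^+ k = s ^+ k * (1 / 2) ^+ k by rewrite -exprMn; congr (_ ^+ _); field.
by rewrite mulrA ler_wpM2r ?exprn_ge0.
Qed.

Lemma a_le i j n : cmod (a i j n) <= 2 * mu * i`!%:R * (8 / dd) ^+ i * (2 / s) ^+ n.
Proof.
have t0 : 0 < dd / n.+1%:R / 4 by rewrite !divr_gt0.
have h := pser_coef i t0 (c_pser n j).
have h1 : cmod (a i j n) <= 2 * (mu / s ^+ n) / (dd / n.+1%:R / 4) ^+ i.
  by rewrite ler_pdivlMr ?exprn_gt0.
apply: le_trans h1 _.
have -> : (dd / n.+1%:R / 4) ^+ i = (dd / 4) ^+ i / n.+1%:R ^+ i.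
  by rewrite -expr_div_n mulrAC.
rewrite invf_div.
have h2 : n.+1%:R ^+ i <= i`!%:R * 2 ^+ (n + i) :> R.
  by rewrite -!natrX -natrM ler_nat pow_le_fact.
have p1 : 0 < (dd / 4) ^+ i by rewrite exprn_gt0 // divr_gt0.
have p2 : 0 < s ^+ n by rewrite exprn_gt0.
have -> : 2 * mu * i`!%:R * (8 / dd) ^+ i * (2 / s) ^+ n =
  2 * (mu / s ^+ n) * (i`!%:R * 2 ^+ (n + i) / (dd / 4) ^+ i).
  have -> : (8 / dd) ^+ i = 2 ^+ i / (dd / 4) ^+ i.
    by rewrite -expr_div_n; congr (_ ^+ _); field; rewrite gt_eqF.
  by rewrite exprD [(2 / s) ^+ n]expr_div_n; ring.
apply: ler_wpM2l; first by rewrite mulr_ge0 // divr_ge0 ?(ltW mu0) ?(ltW p2).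
by apply: ler_wpM2r => //; rewrite invr_ge0 ltW.
Qed.

Lemma bsum_pser i j : pser (s / 4) (2 * (2 * mu * i`!%:R * (8 / dd) ^+ i)) (a i j) (bsum i j).
Proof.
apply: pser_csum; first by rewrite divr_gt0.
move=> L; set Q := 2 * mu * i`!%:R * (8 / dd) ^+ i.
have Q0 : 0 <= Q by rewrite !mulr_ge0 ?(ltW mu0) // exprn_ge0 // divr_ge0 // ltW.
apply: le_trans (_ : \sum_(k < L) Q * (1 / 2) ^+ k <= _); last first.
  by rewrite -mulr_sumr mulrC ler_wpM2r //; apply: geo_sum_le; lra.
apply: ler_sum => k _.
have -> : Q * (1 / 2) ^+ k = Q * (2 / s) ^+ k * (s / 4) ^+ k.
  by rewrite -mulrA -exprMn; congr (_ * _ ^+ _); field; rewrite gt_eqF.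
by rewrite ler_wpM2r ?exprn_ge0 ?divr_ge0 ?(ltW s0) // a_le.
Qed.

(** In order [k] of [z] the remainder carries [(8 (k + 1) / dd) ^ n / s ^ k]. By [pow_le_fact] the
    factor [(k + 1) ^ n] costs [n! 2 ^ (k + n)]: the [2 ^ n] changes 8 into 16, and the [2 ^ k] is
    absorbed by [|z| <= s / 8], which leaves a geometric sum of ratio 1/4. *)
Lemma gevrey_remainder j e z n : S e -> cmod z <= s / 8 ->
  cmod (fsum j e z - \sum_(i < n) e ^+ i * bsum i j z) <=
  10 * mu * (16 / dd) ^+ n * n`!%:R * cmod e ^+ n.
Proof.
move=> he hz; have z2 : cmod z < s / 2 by apply: le_lt_trans hz _; move: s0; lra.
have z4 : cmod z < s / 4 by apply: le_lt_trans hz _; move: s0; lra.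
have h1 : cv (fun L => \sum_(k < L) (c k j e - \sum_(i < n) a i j k * e ^+ i) * z ^+ k)
    (fsum j e z - \sum_(i < n) e ^+ i * bsum i j z).
  have hf := pser_cv (divr_gt0 s0 (ltr0n _ 2)) z2 (fsum_pser j he).
  have hb := cv_sum (m := n) (u := fun L i => e ^+ i * \sum_(k < L) a i j k * z ^+ k)
    (l := fun i => e ^+ i * bsum i j z)
    (fun i _ => cvZ _ (pser_cv (divr_gt0 s0 (ltr0n _ 4)) z4 (bsum_pser i j))).
  apply: cv_ext (cvB hf hb) => L.
  under [X in _ - X]eq_bigr do rewrite mulr_sumr.
  rewrite exchange_big /= -sumrB; apply: eq_bigr => k _.
  by rewrite mulrBl mulr_suml; congr (_ - _); apply: eq_bigr => i _; ring.
apply: (cv_le0 h1); exists 0%N => L _; apply: le_trans (cmod_sum _ _ _) _.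
pose Q := 5 * mu * (16 / dd) ^+ n * n`!%:R * cmod e ^+ n.
have Q0 : 0 <= Q.
  by rewrite !mulr_ge0 ?(ltW mu0) ?exprn_ge0 ?cmod_ge0 // divr_ge0 // ltW.
apply: le_trans (_ : \sum_(k < L) Q * (1 / 4) ^+ k <= _); last first.
  rewrite -mulr_sumr (_ : 10 * mu * _ * _ * _ = Q * 2); last by rewrite /Q; ring.
  by rewrite ler_wpM2l //; apply: geo_sum_le; lra.
apply: ler_sum => k _; rewrite cmodM cmodX.
have t0 : 0 < dd / k.+1%:R / 4 by rewrite !divr_gt0.
have p2 : 0 < s ^+ k by rewrite exprn_gt0.
have hr := coefficient_remainder n t0 (c_pser k j) (@c_le k j e (or_introl he)).
have zk : cmod z ^+ k <= (s / 8) ^+ k.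
  by rewrite lerXn2r ?nnegrE ?cmod_ge0 ?divr_ge0 // ltW.
apply: le_trans (ler_pM (cmod_ge0 _) (exprn_ge0 _ (cmod_ge0 _)) hr zk) _.
have h2 : k.+1%:R ^+ n <= n`!%:R * 2 ^+ (k + n) :> R.
  by rewrite -!natrX -natrM ler_nat pow_le_fact.
have -> : (2 * cmod e / (dd / k.+1%:R / 4)) ^+ n = (8 / dd) ^+ n * k.+1%:R ^+ n * cmod e ^+ n.
  rewrite -!exprMn; congr (_ ^+ _).
  have : k.+1%:R != 0 :> R by rewrite pnatr_eq0.
  by move: (k.+1%:R : R) => N N0; field; rewrite N0 gt_eqF.
have -> : 5 * (mu / s ^+ k) * ((8 / dd) ^+ n * k.+1%:R ^+ n * cmod e ^+ n) * (s / 8) ^+ k =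
  5 * mu * (8 / dd) ^+ n * cmod e ^+ n * (1 / 8) ^+ k * k.+1%:R ^+ n.
  rewrite [(s / 8) ^+ k](_ : _ = s ^+ k * (1 / 8) ^+ k).
    by field; rewrite gt_eqF.
  by rewrite -exprMn; congr (_ ^+ _); field.
have -> : Q * (1 / 4) ^+ k =
  5 * mu * (8 / dd) ^+ n * cmod e ^+ n * (1 / 8) ^+ k * (n`!%:R * 2 ^+ (k + n)).
  rewrite /Q [(16 / dd) ^+ n](_ : _ = (8 / dd) ^+ n * 2 ^+ n).
    rewrite [(1 / 4) ^+ k](_ : _ = (1 / 8) ^+ k * 2 ^+ k).
      by rewrite exprD; ring.
    by rewrite -exprMn; congr (_ ^+ _); field.
  by rewrite -exprMn; congr (_ ^+ _); field; rewrite gt_eqF.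
rewrite ler_wpM2l // !mulr_ge0 ?(ltW mu0) ?exprn_ge0 ?cmod_ge0 //.
by rewrite divr_ge0 // ltW.
Qed.

Lemma fsum_cdiff1 j e z : S e -> cmod z < s / 2 -> cdiff (fun t => fsum j t z) e.
Proof.
move=> he zs; have [d d0 hd] := S_open he.
apply: (@cdiff_limit R (fun L t => \sum_(k < L) c k j t * z ^+ k) _ e d (2 * mu) d0).
- move=> L t /hd ht; apply: cdiff_sum => k _; apply: cdiffM; last exact: cdiff_cst.
  by apply: c_hol; left.
- by move=> L t /hd ht; exact: poly_le zs (fsum_pser j ht).
- by move=> t /hd ht; exact: pser_cv (divr_gt0 s0 (ltr0n _ 2)) zs (fsum_pser j ht).
Qed.

Lemma fsum_differentiable (x y : R[i]^o) : S x -> cmod y < s / 2 ->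
  differentiable (fun p : R[i]^o * R[i]^o => \row_j fsum j p.1 p.2) (x, y).
Proof.
move=> hx hy; have [d d0 hd] := S_open hx.
have m0 : 0 < Num.min d (s / 2 - cmod y) by rewrite lt_min d0 /= subr_gt0.
have hz z : cmod (z - y) < Num.min d (s / 2 - cmod y) -> cmod z < s / 2.
  by rewrite lt_min => /andP[_ h]; have := cmodD (z - y) y; rewrite subrK; lra.
have he e : cmod (e - x) < Num.min d (s / 2 - cmod y) -> S e.
  by rewrite lt_min => /andP[/hd].
apply: (@osgood R nu _ x y _ (2 * mu) m0) => l e z /he hSe /hz zs.
- by apply: (cdiff_ext (f := fun t => fsum l t z)) => [t|]; [rewrite mxE|exact: fsum_cdiff1].
- apply: (cdiff_ext (f := fsum l e)) => [t|]; first by rewrite mxE.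
  exact: pser_cdiff (fsum_pser l hSe) zs.
- by rewrite mxE; exact: pser_val zs (fsum_pser l hSe).
Qed.

End GevreySums.

(* Stated for normed modules so that the topology of ['rV[R[i]]_nu] is inferred. *)
Definition differentiable_at (R : realType) (V W : normedModType R[i]) (f : V -> W) (q : V) :=
  differentiable f q.

(** * Analytic data extracted from the differential system *)

Section System.
Variables (R : realType) (nu : nat).
Notation C := R[i].
Notation I := (bool + 'I_nu)%type.
Variable F : R[i]^o * R[i]^o * 'rV[R[i]]_nu -> 'rV[R[i]]_nu.

Lemma hasd_unshift (f : C -> C) t l : hasd (fun h => f (t + h)) 0 l -> hasd f t l.
Proof. by move=> h e e0; have [d d0 hd] := h e e0; exists d => // x /hd; rewrite add0r addr0. Qed.

Definition emb (x : I -> C) : R[i]^o * R[i]^o * 'rV[R[i]]_nu :=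
  (x (inl false), x (inl true), \row_j x (inr j)).

Definition Fcomp l (x : I -> C) := F (emb x) 0 l.

Lemma emb_line (x d : I -> C) (t s : C) :
  emb (fun i => x i + t * d i) + s *: emb d = emb (fun i => x i + (t + s) * d i).
Proof.
have padd (a a' b b' : R[i]^o) (c c' : 'rV[R[i]]_nu) :
  (a, b, c) + s *: (a', b', c') = (a + s * a', b + s * b', c + s *: c') by [].
rewrite /emb padd; congr (_, _, _); [ring|ring|].
by apply/rowP => j; rewrite !mxE; ring.
Qed.

Lemma Fcomp_line l (x d : I -> C) t : differentiable_at F (emb (fun i => x i + t * d i)) ->
  cdiff (fun t => Fcomp l (fun i => x i + t * d i)) t.
Proof.
move=> hF; have [D h] : exists D, hasd (fun s =>
    F (emb (fun i => x i + t * d i) + s *: emb d) 0 l) 0 D.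
  by eexists; exact: (differentiable_cdiff (emb d) l hF).
apply: (@hasd_cdiff _ _ _ D); apply: hasd_unshift.
by apply: hasd_ext h => s; rewrite /Fcomp emb_line.
Qed.

(** Supplies the flatness hypothesis: on lines through the origin in the directions of [f] alone,
    [A01_0 F] is the whole derivative. *)
Lemma linear_part l (v : 'I_nu -> C) : differentiable_at F (0, 0, 0) ->
  hasd (fun t => Fcomp l (fun i => t * pt 0 0 v i) -
    \sum_j A01_0 F l j * (t * pt 0 0 v (inr j))) 0 0.
Proof.
move=> hF; have hd := differentiable_section hF; pose V := \row_j v j.
have h := differentiable_cdiff V l hd.
have DE : ('d (fun w : 'rV[R[i]]_nu => F (0, 0, w)) 0 V) 0 l = \sum_j A01_0 F l j * v j.
  rewrite -mul_rV_lin1 mxE; apply: eq_bigr => j _.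
  by rewrite !mxE mulrC.
rewrite DE in h.
have {h} := hasdD h (hasdZ (- \sum_j A01_0 F l j * v j) (hasd_id 0)).
rewrite mulr1 subrr; apply: hasd_ext => t.
rewrite mulNr mulr_suml; congr (_ - _); last by apply: eq_bigr => j _ /=; ring.
rewrite /Fcomp /emb /= !mulr0; congr (F (_, _, _) 0 l).
by apply/rowP => j; rewrite !mxE add0r.
Qed.

Lemma system_data (rho rho1 : R) : 0 < rho -> rho < rho1 ->
  holomorphic_near (@cpolydisc R nu rho rho1) F ->
  (forall e : R[i]^o, cdisc rho e -> F (e, 0, 0) = 0) ->
  exists r' K : R, [/\ 0 < r', 0 <= K, differentiable_at F (0, 0, 0), F (0, 0, 0) = 0 &
    [/\ forall l (x d : I -> C) t, (forall i, cmod (x i + t * d i) < r') ->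
          cdiff (fun t => Fcomp l (fun i => x i + t * d i)) t,
        forall l (x : I -> C), (forall i, cmod (x i) < r') -> cmod (Fcomp l x) <= K,
        forall l (x d : I -> C) t, (forall i, cmod (x i + t * d i) < r') ->
          cdiff (fun t => Fcomp l (fun i => x i + t * d i) -
            \sum_j A01_0 F l j * (x (inr j) + t * d (inr j))) t &
        forall l (x : I -> C), (forall i, cmod (x i) < r') ->
          cmod (Fcomp l x - \sum_j A01_0 F l j * x (inr j)) <= K]].
Proof.
move=> rho0 rho01 [U [_ hU hF]] hF0.
have hdiff (x : I -> C) : (forall i, cmod (x i) < rho) -> differentiable_at F (emb x).
  move=> hx; apply: hF; apply: hU; split=> /=; rewrite /cdisc /=.
  - exact: ltW.
  - exact: ltW (lt_trans (hx _) _).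
  - by move=> j; rewrite mxE ltW.
have emb0 : emb (fun=> 0) = (0, 0, 0).
  by rewrite /emb; congr (_, _, _); apply/rowP => j; rewrite !mxE.
have hd0 : differentiable_at F (0, 0, 0).
  by rewrite -emb0; apply: hdiff => i; rewrite cmod0.
have F0 : F (0, 0, 0) = 0 by apply: hF0; rewrite /cdisc /= cmod0 ltW.
have := continuous_triple (differentiable_continuous hd0) (e := 1) ltr01.
move=> [d0 /posC[d dp ->] hd].
pose r' := Num.min rho d; have r0 : 0 < r' by rewrite lt_min rho0.
have hb l (x : I -> C) : (forall i, cmod (x i) < r') -> cmod (Fcomp l x) <= 1.
  move=> hx; have hx' i : `|x i| < d%:C.
    by rewrite normCE ltcR; move: (hx i); rewrite lt_min => /andP[].
  have := hd (x (inl false)) (x (inl true)) (\row_j x (inr j)) (hx' _) (hx' _).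
  move=> /(_ _ l); rewrite F0 mxE subr0 normCE => H.
  have : (cmod (Fcomp l x))%:C < 1 :> C by apply: H => j; rewrite mxE.
  by rewrite -(rmorph1 (real_complex R)) ltcR => /ltW.
have hl l (x e : I -> C) t : (forall i, cmod (x i + t * e i) < r') ->
    cdiff (fun t => Fcomp l (fun i => x i + t * e i)) t.
  move=> hx; apply: Fcomp_line; apply: hdiff => i.
  by move: (hx i); rewrite lt_min => /andP[].
pose N := \sum_l \sum_j cmod (A01_0 F l j) * r'.
have N0 : 0 <= N by apply: sumr_ge0 => l _; apply: sumr_ge0 => j _; rewrite mulr_ge0 ?cmod_ge0 ?ltW.
exists r', (1 + N); split=> //; first by rewrite addr_ge0.
split=> // [l x hx|l x e t hx|l x hx].
- by apply: le_trans (hb l x hx) _; rewrite lerDl.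
- apply: cdiffB; first exact: hl.
  apply: cdiff_sum => j _; apply: cdiffM; first exact: cdiff_cst.
  by apply: cdiffD; [exact: cdiff_cst|apply: cdiffM; [exact: cdiff_id|exact: cdiff_cst]].
- apply: le_trans (cmodBD _ _) _; apply: lerD; first exact: hb.
  apply: le_trans (_ : \sum_j cmod (A01_0 F l j) * r' <= _); last first.
    by rewrite /N [leRHS](bigD1 l) //= lerDl; apply: sumr_ge0 => l' _; apply: sumr_ge0 => j _; rewrite mulr_ge0 ?cmod_ge0 ?ltW.
  apply: le_trans (cmod_sum _ _ _) _; apply: ler_sum => j _.
  by rewrite cmodM ler_wpM2l ?cmod_ge0 // ltW.
Qed.

Lemma sector_data (A : 'M[C]_nu) (gamma : R) : pi < gamma -> A \in unitmx ->
  (forall (l : C) (t : R), eigenvalue A l -> - pi < t <= pi -> is_arg l t -> gamma / 2 < `|t|) ->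
  exists gamma' kappa B d : R, [/\ pi < gamma', -1 <= kappa <= 1, 0 < B, 0 < d &
    [/\ forall x : C, spectral_gap kappa d x -> x%:M - A \in unitmx /\
          forall i j, cmod (invmx (x%:M - A) i j) <= B
      & forall E (e : R[i]^o), sector 0 gamma' E e <->
          0 < cmod e < E /\ kappa * cmod e < complex.Re e]].
Proof.
move=> hg hA heig; have p0 : 0 < pi :> R := pi_gt0 R.
(* The opening is capped so that half of it stays below [pi], where [cos] is decreasing. *)
pose g := Num.min gamma (3 / 2 * pi).
have g1 : pi < g by rewrite lt_min hg /=; lra.
have g2 : g <= gamma by rewrite ge_min lexx.
have g3 : g <= 3 / 2 * pi by rewrite ge_min lexx orbT.
(* [b0] is a lower bound for the arguments of the eigenvalues and [b1 < b0] the half opening of the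
   sector for [e]. Halfway between [pi] and [g], the opening [g'] leaves a gap and still exceeds
   [pi]. *)
pose b0 := g / 2; pose g' := (pi + g) / 2; pose b1 := g' / 2.
have hk : cos b0 < cos b1.
  rewrite cos_lt_iff /b0 /b1 /g'; [|apply/andP; split; lra|apply/andP; split; lra].
  by rewrite ger0_norm; lra.
have hl (l : C) : eigenvalue A l -> l != 0 /\ complex.Re l <= cos b0 * cmod l.
  move=> hl; have l0 : l != 0.
    apply/eqP => l0; move: hl => /eigenvalueP[v hv /eqP]; apply.
    by rewrite -[v]mulmx1 -(mulmxV hA) mulmxA hv l0 scale0r mul0mx.
  split=> //; have [t ht hat] := arg_exists l0; have ht2 := heig l t hl ht hat.
  rewrite {1}hat /= mulrC ler_wpM2r ?cmod_ge0 // leNgt cos_lt_iff.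
  - by rewrite -leNgt /b0; lra.
  - by move: ht => /andP[/ltW -> ->].
  - by rewrite /b0; apply/andP; split; lra.
have [B [d [B0 d0 hB]]] := resolvent_bound (cos_geN1 b0) hk (cos_le1 b1) hl.
exists g', (cos b1), B, d; split=> //; first by rewrite /g'; lra.
  by rewrite cos_geN1 cos_le1.
have b1p : 0 <= b1 <= pi by rewrite /b1 /g'; apply/andP; split; lra.
split=> // E e; split=> [[he [t hat]]|[he hr]].
  rewrite subr0 => htb; split=> //; apply: arg_cone hat htb _ _.
    by case/andP: he.
  by case/andP: b1p.
split=> //; have [|t hat htb] := cone_arg _ b1p hr; first by case/andP: he.
by exists t => //; rewrite subr0.
Qed.

Lemma formal_data (a : nat -> R[i]^o -> 'rV[R[i]]_nu) : formal_solution F a ->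
  forall (r' r K : R), 0 < r < r' ->
  (forall l (x d : I -> C) t, (forall i, cmod (x i + t * d i) < r') ->
      cdiff (fun t => Fcomp l (fun i => x i + t * d i)) t) ->
  (forall l (x : I -> C), (forall i, cmod (x i) < r') -> cmod (Fcomp l x) <= K) ->
  let am := fun m l (z : C) => a m z 0 l in
  let am' := fun m l (z : C) => derive1 (a m : R[i] -> 'rV[R[i]]_nu) z 0 l in
  [/\ forall m l, exists s b, 0 < s /\ pser s b (coef (am m l)) (am m l),
      forall l, am 0%N l 0 = 0,
      forall m, exists2 d : R, 0 < d & forall z, cmod z < d -> forall l, hasd (am m l) z (am' m l z) &
      forall k, exists2 d : R, 0 < d & forall z, cmod z < d -> forall l,
        coef (psi Fcomp am k l z) k = if k is k'.+1 then z * am' k' l z else 0].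
Proof.
move=> [a00 ahol aeq] r' r K hr F_line F_bound am am'.
have am_pser m l : exists s b, 0 < s /\ pser s b (coef (am m l)) (am m l).
  have [U [Uo U0 hU]] := ahol m.
  have : \forall z \near (0 : R[i]^o), U z by apply: open_nbhs_nbhs; split=> //; exact: U0.
  move=> /nbhs_cmod[d d0 hd].
  have hc z : cmod z < d -> cdiff (am m l) z.
    move=> zd; have /hU h : U z by apply: hd; rewrite subr0.
    have [D {}h] : exists D, hasd (fun t => a m ((z : R[i]^o) + t *: (1 : R[i]^o)) 0 l) 0 D.
      by eexists; exact: (differentiable_cdiff (1 : R[i]^o) l h).
    apply: (@hasd_cdiff _ _ _ D); apply: hasd_unshift; apply: hasd_ext h => t; rewrite /am.
    by congr (a m (_ + _) 0 l); exact: mulr1.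
  (* Differentiability at 0 provides the bound on a small disc that the local expansion asks for. *)
  have [v hv] : cdiff (am m l) 0 by apply: hc; rewrite cmod0.
  have [d1 d10 hd1] := hv 1 ltr01.
  pose d2 := Num.min d d1; have d20 : 0 < d2 by rewrite lt_min d0.
  have hb z : cmod z < d2 -> cmod (am m l z) <= cmod (am m l 0) + (cmod v + 1) * d2.
    move=> zd; have := hd1 z; rewrite add0r mul1r => H.
    have {}H : cmod (am m l z - am m l 0 - v * z) <= cmod z.
      by apply: H; move: zd; rewrite lt_min => /andP[_ /ltW].
    have -> : am m l z = am m l 0 + (v * z + (am m l z - am m l 0 - v * z)) by ring.
    apply: le_trans (cmodD _ _) _; rewrite lerD2l; apply: le_trans (cmodD _ _) _.
    rewrite cmodM; have := cmod_ge0 v; have := cmod_ge0 z; nra.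
  have [||x hx] := @local_expansion R (am m l) 0 d2 (cmod (am m l 0) + (cmod v + 1) * d2) d20.
  - by move=> z; rewrite subr0 lt_min => /andP[/hc].
  - by move=> z; rewrite subr0; exact: hb.
  have d24 : 0 < d2 / 4 by rewrite divr_gt0.
  exists (d2 / 4); eexists; split=> //; apply: pser_coefE d24 _.
  by apply: pser_ext hx => z _; rewrite add0r.
have am00 l : am 0%N l 0 = 0 by rewrite /am a00 mxE.
have am_deriv m : exists2 d : R, 0 < d &
    forall z, cmod z < d -> forall l, hasd (am m l) z (am' m l z).
  have [s [b [s0 b0 hs]]] := am_common am_pser m; exists s => // z zs.
  have /choice[v hv] : forall l, exists v, hasd (am m l) z v.
    by move=> l; have [v h _] := pser_hasd (hs m l (leqnn m)) zs; exists v.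
  have hder : derive1 (a m : R[i] -> 'rV[R[i]]_nu) z = \row_l v l.
    by apply: derive1_hasd => l; rewrite mxE; exact: hv.
  by move=> l; rewrite /am' hder mxE; exact: hv.
split=> // k; have /nbhs_cmod[d1 d10 hd1] := aeq k.
have [d [s [d0 s0 hd]]] := psi_pser hr F_line F_bound am_pser am00 k.
exists (Num.min d1 d); first by rewrite lt_min d10.
move=> z; rewrite lt_min => /andP[z1 zd] l.
have := hd1 z; rewrite subr0 => /(_ z1) /rowP /(_ l); rewrite /rhs_coef !mxE => heq.
have hps l' := (hd z zd k l' (leqnn k)).1.
have hder := @derive1n_pser R nu k
  (fun e => F (e, z, \sum_(j < k.+1) e ^+ j *: a j z)) (fun l' => coef (psi Fcomp am k l' z)) _ _ s0
  (fun l' => pser_ext _ (hps l')).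
rewrite hder in heq; last first.
  move=> l' e _; rewrite /psi /Fcomp /emb /=; congr (F (_, _, _) 0 l').
  by apply/rowP => j; rewrite mxE summxE; apply: eq_bigr => m _; rewrite mxE.
rewrite mulKf ?pnatr_eq0 -?lt0n ?fact_gt0 // in heq.
rewrite -heq /lhs_coef; case: k {hd1 hd heq hps hder} => [|k']; by rewrite mxE.
Qed.

End System.

(** * Choice of the constants and summation of the series *)

Section Conclusion.
Variables (R : realType) (nu : nat).
Notation C := R[i].
Notation I := (bool + 'I_nu)%type.

Lemma small_parameter (X b c : R) : 0 <= X -> 0 < b -> 0 < c ->
  exists2 m : R, 0 < m < c & X * m <= b.
Proof.
move=> X0 b0 c0; have X1 : 0 < X + 1 by lra.
pose m := Num.min (c / 2) (b / (X + 1)).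
have m0 : 0 < m by rewrite lt_min !divr_gt0.
have mc : m <= c / 2 by rewrite ge_min lexx.
have : m <= b / (X + 1) by rewrite ge_min lexx orbT.
rewrite ler_pdivlMr // => mX; exists m; last by nra.
by rewrite m0 /=; lra.
Qed.

Definition cone (kappa E : R) (e : C) := 0 < cmod e < E /\ kappa * cmod e < complex.Re e.

Lemma cone_open kappa E e : -1 <= kappa <= 1 -> cone kappa E e ->
  exists2 d : R, 0 < d & forall y, cmod (y - e) < d -> cone kappa E y.
Proof.
move=> /andP[k1 k2] [/andP[e0 eE] he].
pose d := Num.min (Num.min (cmod e) (E - cmod e)) ((complex.Re e - kappa * cmod e) / 2).
exists d; first by rewrite !lt_min e0 subr_gt0 eE divr_gt0 // subr_gt0.
move=> y; rewrite !lt_min => /andP[/andP[y1 y2] y3].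
have h1 := cmodD (y - e) e; rewrite subrK in h1.
have h2 := cmod_lb e y; rewrite cmodB in h2.
have h3 := Re_le_cmod (y - e); rewrite ler_norml raddfB /= in h3.
move: h3 => /andP[h3 h4]; split; first by apply/andP; split; lra.
have := cmod_ge0 (y - e); set p := cmod (y - e) in h1 h2 h3 h4 y1 y2 y3 * => p0.
set u := cmod y in h1 h2 *; set v := cmod e in h1 h2 he y1 y2 y3 e0 eE *.
have : kappa * (u - v) <= p by nra.
lra.
Qed.

(** One truncated equation is solved for each [n], on a domain that depends on [n], but with the
    same radius in [z], the same ball and the same bound on the resolvents. This uniformity gives a
    bound [mu / s ^ n] for all orders at once. *)
Lemma holomorphic_coefficients (Fc : 'I_nu -> (I -> C) -> C) (A : 'M[C]_nu)
    (r' K kappa B d : R) (am am' : nat -> 'I_nu -> C -> C) :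
  0 < r' -> 0 <= K -> -1 <= kappa <= 1 -> 0 < B -> 0 < d ->
  (forall l (x d : I -> C) t, (forall i, cmod (x i + t * d i) < r') ->
    cdiff (fun t => Fc l (fun i => x i + t * d i)) t) ->
  (forall l (x : I -> C), (forall i, cmod (x i) < r') -> cmod (Fc l x) <= K) ->
  (forall l (x d : I -> C) t, (forall i, cmod (x i + t * d i) < r') ->
    cdiff (fun t => Fc l (fun i => x i + t * d i) -
      \sum_j A l j * (x (inr j) + t * d (inr j))) t) ->
  (forall l (x : I -> C), (forall i, cmod (x i) < r') ->
    cmod (Fc l x - \sum_j A l j * x (inr j)) <= K) ->
  (forall l, Fc l (fun=> 0) = 0) ->
  (forall l v, hasd (fun t => Fc l (fun i => t * pt 0 0 v i) -
    \sum_j A l j * (t * pt 0 0 v (inr j))) 0 0) ->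
  (forall x, spectral_gap kappa d x -> x%:M - A \in unitmx /\
    forall i j, cmod (invmx (x%:M - A) i j) <= B) ->
  (forall m l, exists s b, 0 < s /\ pser s b (coef (am m l)) (am m l)) ->
  (forall l, am 0%N l 0 = 0) ->
  (forall m, exists2 d : R, 0 < d &
    forall z, cmod z < d -> forall l, hasd (am m l) z (am' m l z)) ->
  (forall k, exists2 d : R, 0 < d & forall z, cmod z < d -> forall l,
    coef (psi Fc am k l z) k = if k is k'.+1 then z * am' k' l z else 0) ->
  exists (E mu s dd : R) (c : nat -> 'I_nu -> C -> C),
  [/\ 0 < E, 0 < mu, 0 < s, 0 < dd &
   [/\ forall n j e, cone kappa E e \/ cmod e < dd / n.+1%:R -> cdiff (c n j) e,
       forall n j e, cone kappa E e \/ cmod e < dd / n.+1%:R -> cmod (c n j e) <= mu / s ^+ n &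
       forall n i, exists Cst e1 : R, 0 < e1 /\ forall e, cmod e < e1 -> forall j,
         cmod (c n j e - \sum_(m < i.+1) e ^+ m * coef (am m j) n) <= Cst * cmod e ^+ i.+1]].
Proof.
move=> r'0 K0 hkappa B0 d0 F_line F_bound G_line G_bound F0 G_flat hB am_pser am00 am_deriv formal_eq.
have [r hr] : exists r, 0 < r < r' by exists (r' / 2); apply/andP; split; lra.
have r0 : 0 < r by case/andP: hr.
have [M M0 hM] : exists2 M : R, 0 <= M & M = 2 ^+ #|{: I}| * K.
  by exists (2 ^+ #|{: I}| * K); rewrite ?mulr_ge0 ?exprn_ge0.
have B0' := ltW B0.
have n0 : 0 <= nu%:R * B by rewrite mulr_ge0.
(* [mu] is fixed first, for the contraction; [E], which limits both [e] and [z], is chosen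
   afterwards in terms of [mu], so that the image of 0 is small. *)
have [|||mu hmu hmuX] := @small_parameter (nu%:R * B * (256 * M / r ^+ 2 * 3)) (1 / 2) (r / 64).
- have r2 : 0 <= (r ^+ 2)^-1 by rewrite invr_ge0 exprn_ge0 // ltW.
  have M256 : 0 <= 256 * M := mulr_ge0 (ler0n R 256) M0.
  exact: mulr_ge0 n0 (mulr_ge0 (mulr_ge0 M256 r2) (ler0n R 3)).
- by lra.
- by rewrite divr_gt0.
have mu0 : 0 < mu by case/andP: hmu.
have small2 : nu%:R * B * (256 * M / r ^+ 2 * (3 * mu)) <= 1 / 2.
  by apply: le_trans hmuX; rewrite le_eqVlt; apply/orP; left; apply/eqP; ring.
have [||E /andP[E0 Emu] hE] := @small_parameter (nu%:R * B * (16 * M / r)) (mu / 2) mu _ _ mu0.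
- by rewrite mulr_ge0 // divr_ge0 ?mulr_ge0 // ltW.
- by rewrite divr_gt0.
have small1 : nu%:R * B * (16 * M / r * E) <= mu / 2 by rewrite mulrA.
rewrite hM in small1 small2.
have hE0 : 0 < E <= mu by rewrite E0 ltW.
have hs : 0 < E <= E by rewrite E0 lexx.
have G0 l : Fc l (fun=> 0) - \sum_j A l j * 0 = 0.
  by rewrite F0 sub0r big1 ?oppr0 // => j _; rewrite mulr0.
pose dd := Num.min d E; have dd0 : 0 < dd by rewrite lt_min d0.
pose Om n e := cone kappa E e \/ cmod e < dd / n.+1%:R.
have ddn n : dd / n.+1%:R <= dd.
  by rewrite ler_pdivrMr // ler_peMr ?(ltW dd0) // ler1n.
have hOm_le n e : Om n e -> cmod e <= E.
  case=> [[/andP[_ /ltW]] //|/ltW h]; apply: le_trans h (le_trans (ddn n) _).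
  by rewrite ge_min lexx orbT.
(* The closed cone is stable under multiplication by [k]; on the disc, the radius [dd / (n + 1)]
   gives [|e k| <= dd <= d] for [k <= n]. *)
have gap n e k : Om n e -> (k <= n)%N -> spectral_gap kappa d (e * k%:R).
  move=> he kn; rewrite /spectral_gap cmodM cmod_nat; case: he => [[_ he]|he].
    left; have -> : complex.Re (e * k%:R) = complex.Re e * k%:R.
      by rewrite -(rmorph_nat (real_complex R)); case: (e) => x y /=; rewrite mulr0 subr0.
    by rewrite mulrA ler_wpM2r // ltW.
  right; apply: le_trans (_ : dd <= _); last by rewrite ge_min lexx.
  apply: le_trans (_ : dd / n.+1%:R * n.+1%:R <= _); last by rewrite divfK // pnatr_eq0.
  by apply: ler_pM; [exact: cmod_ge0|exact: ler0n|exact: ltW|rewrite ler_nat leqW].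
have res_hol n k j l : Hol (Om n) (trunc_resolvent A n k j l).
  case kn: (k <= n)%N; rewrite /trunc_resolvent kn; last exact: Hol_cst.
  by apply: Hol_resolvent => e he; exact: (hB _ (gap n e k he kn)).1.
have res_le n k j l e : Om n e -> cmod (trunc_resolvent A n k j l e) <= B.
  move=> he; rewrite /trunc_resolvent; case: ifP => kn; last by rewrite cmod0.
  exact: (hB _ (gap n e k he kn)).2.
have /choice[w hw] : forall n, exists w : 'I_nu -> C -> C -> C,
    (forall j, Wn (Om n) E mu (w j)) /\
    forall j e k, Om n e -> coef (w j e) k = \sum_l trunc_resolvent A n k j l e *
      coef (nemytskii (fun l (x : I -> C) => Fc l x - \sum_j A l j * x (inr j)) w l e) k.
  move=> n; have [w [h1 _ h2]] := contraction_solution hr G_line G_bound G0 G_flat B0' hmu hE0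
    small1 small2 hs (hOm_le n) (res_hol n) (res_le n).
  by exists w.
have wcoef n j := Wn_coef E0 ((hw n).1 j).
exists E, mu, E, dd, (fun n j e => coef (w n j e) n); split=> //; split.
- move=> n j e he; have [hol _] := wcoef n j.
  case: (he) => [/(cone_open hkappa)[q q0 hq]|hn].
    by apply: (hol n e q q0) => y /hq; left.
  apply: (hol n e (dd / n.+1%:R - cmod e)); first by rewrite subr_gt0.
  move=> y hy; right; have := cmodD (y - e) e; rewrite subrK => /le_lt_trans; apply.
  by rewrite -ltrBrDr.
- move=> n j e he; rewrite ler_pdivlMr ?exprn_gt0 //.
  exact: pser_coef E0 ((wcoef n j).2 e he).
- move=> n i; have ddn0 : 0 < dd / n.+1%:R by rewrite divr_gt0.
  apply: (@matching R nu Fc A r' r K hr F_line F_bound G_line G_bound G0 G_flat B mu E B0' hmu hE0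
    small2 am am' am_pser am00 am_deriv formal_eq n (Om n) _ E (w n) ddn0) => //.
  + by move=> e he; right.
  + exact: hOm_le.
  + by move=> e k he kn; exact: (hB _ (gap n e k he kn)).1.
  + by move=> e k j l he; exact: res_le.
  + by move=> j e he; exact: (wcoef n j).2.
  + by move=> j e k he; exact: (hw n).2.
Qed.

Lemma enorm_le (v : 'rV[C]_nu) : enorm v <= \sum_j cmod (v 0 j).
Proof.
have S0 : 0 <= \sum_j cmod (v 0 j) by apply: sumr_ge0 => j _; exact: cmod_ge0.
rewrite /enorm -[leRHS](ger0_norm S0) -sqrtr_sqr ler_wsqrtr //.
rewrite [leRHS]expr2 mulr_suml; apply: ler_sum => j _; rewrite expr2 ler_wpM2l ?cmod_ge0 //.
by rewrite (bigD1 j) //= lerDl; apply: sumr_ge0 => k _; exact: cmod_ge0.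
Qed.

End Conclusion.

Theorem theorem1 (R : realType) (nu : nat) (hnu : (1 <= nu)%N)
    (rho rho1 : R) (hrho : 0 < rho) (hrho1 : rho < rho1)
    (F : R[i]^o * R[i]^o * 'rV[R[i]]_nu -> 'rV[R[i]]_nu)
    (hF : holomorphic_near (@cpolydisc R nu rho rho1) F)
    (hF0 : forall e : R[i]^o, cdisc rho e -> F (e, 0, 0) = 0)
    (hinv : A01_0 F \in unitmx)
    (gamma : R) (hgamma : pi < gamma)
    (heig : forall (l : R[i]) (t : R), eigenvalue (A01_0 F) l ->
       - pi < t <= pi -> is_arg l t -> gamma / 2 < `|t|)
    (a : nat -> R[i]^o -> 'rV[R[i]]_nu)
    (ha : formal_solution F a) :
  exists (sigma : R) (b : nat -> R[i]^o -> 'rV[R[i]]_nu),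
    [/\ 0 < sigma,
        forall i, \forall z \near (0 : R[i]^o), b i z = a i z
      & one_summable 0 sigma b].
Proof.
have [r' [K [r'0 K0 dF F0 [F_line F_bound G_line G_bound]]]] := system_data hrho hrho1 hF hF0.
have [g' [kappa [B [d [hg' hkappa B0 d0 [hB hsec]]]]]] := sector_data hgamma hinv heig.
have hr : 0 < r' / 2 < r' by apply/andP; split; lra.
have [am_pser am00 am_deriv formal_eq] := formal_data ha hr F_line F_bound.
have Fc0 l : Fcomp F l (fun=> 0) = 0.
  rewrite /Fcomp /emb (_ : \row_j 0 = 0) ?F0 ?mxE //.
  by apply/rowP => j; rewrite !mxE.
have [E [mu [s [dd [c [E0 mu0 s0 dd0 [c_hol c_le c_asymp]]]]]]] :=
  holomorphic_coefficients r'0 K0 hkappa B0 d0 F_line F_bound G_line G_bound Fc0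
    (fun l v => linear_part l v dF) hB am_pser am00 am_deriv formal_eq.
pose al i j n := coef (fun z => a i z 0 j) n.
have bps i j := @bsum_pser R nu (cone kappa E) c al mu s dd mu0 s0 dd0 c_hol c_le c_asymp i j.
have s8 : 0 < s / 8 by rewrite divr_gt0.
have s4 : 0 < s / 4 by rewrite divr_gt0.
(* The [a i] are germs whose domains may shrink with [i]. The sums of their Taylor series, whose
   coefficients inherit bounds from the [c n], represent them on one disc of radius [s / 4]. *)
pose b i (z : R[i]^o) : 'rV[R[i]]_nu := \row_j bsum al i j z.
have bdiff i (z : R[i]^o) : cmod z < s / 4 -> differentiable_at (b i) z.
  move=> hz; apply: cdiff_differentiable => l.
  by apply: cdiff_ext (pser_cdiff (bps i l) hz) => t; rewrite mxE.
have fdiff (e z : R[i]^o) : cone kappa E e -> cmod z < s / 2 ->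
    differentiable_at (fun p : R[i]^o * R[i]^o => \row_j fsum c j p.1 p.2) (e, z).
  move=> he hz; apply: (@fsum_differentiable R nu (cone kappa E) c mu s dd) => //.
  by move=> x; exact: cone_open.
(* The radius is that of [gevrey_remainder]; being smaller than [s / 4], it places the closed disc
   inside an open disc of holomorphy, and continuity up to the boundary follows. *)
exists (s / 8), b; split=> //.
  move=> i; have [q [q1 [q0 q10 hq]]] := am_common am_pser i.
  apply/nbhs_cmod; exists (Num.min q (s / 4)); first by rewrite lt_min q0.
  move=> z; rewrite subr0 lt_min => /andP[zq zs]; apply/rowP => j; rewrite mxE.
  exact: csumE (pser_cv q0 zq (hq i j (leqnn i))).
split=> [i|].
  split=> [z zs|]; first by apply: bdiff; move: zs; rewrite /disc /=; lra.
  apply: differentiable_within => z zs.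
  by apply: bdiff; move: zs; rewrite /cdisc /=; lra.
exists g', E, (fun p => \row_j fsum c j p.1 p.2); split=> //.
- move=> [e z] [/= /hsec he zs]; apply: fdiff => //.
  by move: zs; rewrite /disc /=; lra.
- apply: differentiable_within => -[e z] [/= /hsec he zs]; apply: fdiff => //.
  by move: zs; rewrite /cdisc /=; lra.
- move=> theta1 gamma1 E1 g10 E10 hsub.
  exists (nu%:R * (10 * mu)), (16 / dd); split.
  + by rewrite !mulr_gt0 // ltr0n.
  + by rewrite divr_gt0.
  (* A subsector lies in its closure and does not contain 0, hence is contained in the cone. *)
  move=> n e z he hz; have hcone : cone kappa E e.
    have [/hsec//|/= e0] := hsub (e : R[i]^o) (subset_closure he).
    by move: he => -[]; rewrite e0 cmod0 ltxx.
  apply: le_trans (enorm_le _) _.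
  apply: le_trans (_ : \sum_(j < nu) 10 * mu * (16 / dd) ^+ n * n`!%:R * cmod e ^+ n <= _).
    apply: ler_sum => j _; rewrite !mxE summxE.
    under eq_bigr do rewrite !mxE.
    exact: (@gevrey_remainder R nu (cone kappa E) c al mu s dd mu0 s0 dd0 c_hol c_le c_asymp).
  by rewrite sumr_const card_ord -[leLHS]mulr_natl -!mulrA lexx.
Qed.
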